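(* Let $\{d_j\}_{j=1}^\infty$ be a sequence of nonzero integers such that $\lim_{j\to+\infty}\prod_{n=1}^j|d_n|=\infty$. Define $\lambda_0:=1$ and $\lambda_j:=\big(\prod_{n=1}^jd_n\big)^{-1}$ for all $j\in\mathbb N$. Let $a^j$ and $\tilde a^j$, $j\in\mathbb N$, be $2\pi$-periodic trigonometric polynomials such that $a^j(0)=\tilde a^j(0)=1$ for all $j\in\mathbb N$ and $$\sum_{j=1}^\infty|\lambda_j|\deg(a^j)\|a^j\|_{L_\infty(\mathbb T)}<\infty\quad\text{and}\quad\sum_{j=1}^\infty|\lambda_j|\deg(\tilde a^j)\|\tilde a^j\|_{L_\infty(\mathbb T)}<\infty.$$ Define, for $j\in\mathbb N\cup\{0\}$ and $\xi\in\mathbb R$, $$\varphi^j(\xi):=\prod_{n=1}^\infty a^{j+n}(\lambda_{j+n}\lambda_j^{-1}\xi)\quad\text{and}\quad\tilde\varphi^j(\xi):=\prod_{n=1}^\infty\tilde a^{j+n}(\lambda_{j+n}\lambda_j^{-1}\xi).$$ Then all $\varphi^{j-1},\tilde\varphi^{j-1}$, $j\in\mathbb N$, are elements of $L_\infty^{loc}(\mathbb R)$ satisfying $$\varphi^{j-1}(d_j\xi)=a^j(\xi)\varphi^j(\xi)\quad\text{and}\quad\tilde\varphi^{j-1}(d_j\xi)=\tilde a^j(\xi)\tilde\varphi^j(\xi),\qquad\forall\xi\in\mathbb R,\ j\in\mathbb N.$$ Let $\theta^{j,1},\dots,\theta^{j,r_{j-1}}$, $b^{j,1},\dots,b^{j,s_{j-1}}$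 and $\tilde\theta^{j,1},\dots,\tilde\theta^{j,r_{j-1}}$, $\tilde b^{j,1},\dots,\tilde b^{j,s_{j-1}}$, with $r_{j-1},s_{j-1}\in\mathbb N$ and $j\in\mathbb N$, be $2\pi$-periodic measurable functions in $L_2^{loc}(\mathbb R)$. Define for $j\in\mathbb N$ $$\varphi^{j-1,\ell}(\xi):=\theta^{j,\ell}(\xi)\varphi^{j-1}(\xi),\quad\tilde\varphi^{j-1,\ell}(\xi):=\tilde\theta^{j,\ell}(\xi)\tilde\varphi^{j-1}(\xi),\quad\ell=1,\dots,r_{j-1},$$ $$\psi^{j-1,\ell}(d_j\xi):=b^{j,\ell}(\xi)\varphi^j(\xi),\quad\tilde\psi^{j-1,\ell}(d_j\xi):=\tilde b^{j,\ell}(\xi)\tilde\varphi^j(\xi),\quad\ell=1,\dots,s_{j-1}.$$ Then $\Phi^j:=\{\varphi^{j,1},\dots,\varphi^{j,r_j}\}$, $\tilde\Phi^j:=\{\tilde\varphi^{j,1},\dots,\tilde\varphi^{j,r_j}\}$, $\Psi^j:=\{\psi^{j,1},\dots,\psi^{j,s_j}\}$, $\tilde\Psi^j:=\{\tilde\psi^{j,1},\dots,\tilde\psi^{j,s_j}\}$ are subsets of $L_2^{loc}(\mathbb R)$ for all $j\ge0$. Moreover, the pair $(FWS_J(\Phi^J;\{\Psi^j\}_{j=J}^\infty),FWS_J(\tilde\Phi^J;\{\tilde\Psi^j\}_{j=J}^\infty))$ forms a pair of frequency-based nonstationary dual wavelet frames in $\mathscr D'(\mathbb R)$ for every integer $J\ge0$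 if and only if, for all $j\in\mathbb N$, $$\Theta^j(d_j\xi)\overline{a^j(\xi)}\tilde a^j(\xi)+\sum_{\ell=1}^{s_{j-1}}\overline{b^{j,\ell}(\xi)}\tilde b^{j,\ell}(\xi)=\Theta^{j+1}(\xi),\qquad\text{a.e. }\xi\in\mathbb R,$$ $$\Theta^j(d_j\xi)\overline{a^j(\xi)}\tilde a^j(\xi+\tfrac{2\pi\omega}{d_j})+\sum_{\ell=1}^{s_{j-1}}\overline{b^{j,\ell}(\xi)}\tilde b^{j,\ell}(\xi+\tfrac{2\pi\omega}{d_j})=0,\qquad\text{a.e. }\xi\in\mathbb R,\ \forall\omega\in\mathbb Z\setminus d_j\mathbb Z,$$ and $$\lim_{j\to+\infty}\Theta^{j+1}(\lambda_j\cdot)=1\quad\text{in the sense of distributions},$$ where $\Theta^j(\xi):=\sum_{\ell=1}^{r_{j-1}}\overline{\theta^{j,\ell}(\xi)}\tilde\theta^{j,\ell}(\xi)$, $j\in\mathbb N$.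
   Context: $\mathbb N=\{1,2,\dots\}$. For a trigonometric polynomial $a(\xi)=\sum_{k=k_1}^{k_2}a(k)e^{-ik\xi}$ with $a(k_1)a(k_2)\ne0$, $\deg(a):=\max(|k_1|,|k_2|)$. $\|\cdot\|_{L_\infty(\mathbb T)}$ is the essential supremum norm of a $2\pi$-periodic function. $\mathscr D(\mathbb R)$ is the space of compactly supported $C^\infty$ functions $\mathbb R\to\mathbb C$ and $\mathscr D'(\mathbb R)$ is its dual. For $1\le p\le\infty$, $L_p^{loc}(\mathbb R)$ is the space of measurable functions $f:\mathbb R\to\mathbb C$ with $\int_K|f|^p<\infty$ (for $p=\infty$: $f$ essentially bounded on $K$) for every compact $K\subset\mathbb R$. Pairing: $\langle f,g\rangle=\int_{\mathbb R}f\overline g$ whenever one of $f,g$ is in $\mathscr D(\mathbb R)$ and the other is locally integrable. $F_n\to1$ in the sense of distributions means $\langle F_n,f\rangle\to\langle1,f\rangle$ for all $f\in\mathscr D(\mathbb R)$. For $\lambda\ne0$, $f_{\lambda;0,k}(\xi):=|\lambda|^{1/2}e^{-ik\lambda\xi}f(\lambda\xi)$. ''Sets'' of generators are finite families whose elements need not be distinct; sums run over them with multiplicity. For an integer $J\ge0$, the pair $(FWS_J(\Phi^J;\{\Psi^j\}_{j=J}^\infty),FWS_J(\tilde\Phi^J;\{\tilde\Psi^j\}_{j=J}^\infty))$ (associated with $\{\lambda_j\}_{j=J}^\infty$) forms a pair of frequency-based nonstationary dual wavelet frames in $\mathscr D'(\mathbb R)$ if for all $f,g\in\mathscr D(\mathbb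 R)$: (1) the series $\sum_{k\in\mathbb Z}\langle f,\varphi^{J,\ell}_{\lambda_J;0,k}\rangle\langle\tilde\varphi^{J,\ell}_{\lambda_J;0,k},g\rangle$ and $\sum_{k\in\mathbb Z}\langle f,\psi^{j,\ell'}_{\lambda_j;0,k}\rangle\langle\tilde\psi^{j,\ell'}_{\lambda_j;0,k},g\rangle$ converge absolutely for every $j\ge J$, $1\le\ell\le r_J$, $1\le\ell'\le s_j$; and (2) the following limit exists and satisfies $$\lim_{J'\to+\infty}\Big(\sum_{\ell=1}^{r_J}\sum_{k\in\mathbb Z}\langle f,\varphi^{J,\ell}_{\lambda_J;0,k}\rangle\langle\tilde\varphi^{J,\ell}_{\lambda_J;0,k},g\rangle+\sum_{j=J}^{J'-1}\sum_{\ell=1}^{s_j}\sum_{k\in\mathbb Z}\langle f,\psi^{j,\ell}_{\lambda_j;0,k}\rangle\langle\tilde\psi^{j,\ell}_{\lambda_j;0,k},g\rangle\Big)=2\pi\langle f,g\rangle.$$ *)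

(* Defs.v *)
From HB Require Import structures.
From mathcomp Require Import all_boot all_order all_algebra.
From mathcomp Require Import all_classical all_reals all_analysis.
From mathcomp Require Import ess_sup_inf.
From mathcomp Require Import complex.

Set Implicit Arguments.
Unset Strict Implicit.
Unset Printing Implicit Defensive.

Import Order.TTheory GRing.Theory Num.Theory numFieldNormedType.Exports Normc.

Local Open Scope classical_set_scope.
Local Open Scope ring_scope.

(* R[i] carries the topology of its modulus. *)
HB.instance Definition _ (R : rcfType) :=
  NormedModule.copy R[i] (R[i] : numFieldType)^o.

(* R with the sigma-algebra of Lebesgue (not merely Borel) measurable sets,
   the domain of completed_lebesgue_measure. *)
Notation lebesgueType R := (caratheodory_type (@wlength R idfun)^*%mu).
Notation leb := (@completed_lebesgue_measure _).

Section Functions.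
Variable R : realType.
Implicit Types (f g : R -> R[i]) (u : int -> R[i]).

Definition expi (t : R) : R[i] := Complex (cos t) (sin t).

Definition cmeasurable f : Prop :=
  measurable_fun [set: lebesgueType R] (fun x => complex.Re (f x)) /\
  measurable_fun [set: lebesgueType R] (fun x => complex.Im (f x)).

Definition cintegral f : R[i] :=
  Complex (\int[leb]_x complex.Re (f x)) (\int[leb]_x complex.Im (f x)).

Definition pairing f g : R[i] := cintegral (fun x => f x * (g x)^*%C).

Definition L2loc f : Prop :=
  cmeasurable f /\
  forall K : set R, compact K ->
    (\int[leb]_(x in K) (normc (f x) ^+ 2)%:E < +oo)%E.

Definition Linfloc f : Prop :=
  cmeasurable f /\
  forall K : set R, compact K ->
    exists M : R, {ae leb, forall x : R, K x -> normc (f x) <= M}.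

(* For a periodic f the essential supremum over a period and over the whole
   line coincide. *)
Definition Linfnorm f : \bar R := ess_sup leb (fun x : R => (normc (f x))%:E).

Definition test_function f : Prop :=
  [/\ forall (n : nat) (x : R),
        derivable (derive1n n (fun y => complex.Re (f y))) x 1,
      forall (n : nat) (x : R),
        derivable (derive1n n (fun y => complex.Im (f y))) x 1
    & compact (closure [set x : R | f x != 0])].

Definition distribution_cvg (F : nat -> R -> R[i]) (G : R -> R[i]) : Prop :=
  forall f, test_function f ->
    (fun n => pairing (F n) f) @ \oo --> pairing G f.

Definition abs_summable u : Prop :=
  summable [set: int] (fun k => (normc (u k))%:E).

(* The N-th partial sum runs over - N <= k < N; this is the sum of u as soon
   as u is absolutely summable, the only case in which it is used. *)
Definition sumZ u : R[i] :=
  limn (fun N : nat => \sum_(0 <= n < N) (u n%:Z + u (- n.+1%:Z))).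

End Functions.

Section TrigonometricPolynomials.
Variable R : realType.

(* Nonzero trigonometric polynomials. The values of tp_coef outside
   [tp_lo, tp_hi] are irrelevant. *)
Record trigpoly := TrigPoly {
  tp_lo : int;
  tp_hi : int;
  tp_coef : int -> R[i];
  tp_le : tp_lo <= tp_hi;
  tp_neq0 : tp_coef tp_lo * tp_coef tp_hi != 0 }.

Definition tp_eval (a : trigpoly) (xi : R) : R[i] :=
  \sum_(0 <= n < `|tp_hi a - tp_lo a|%N.+1)
    tp_coef a (tp_lo a + n%:Z) * expi (- ((tp_lo a + n%:Z)%:~R * xi)).

Definition tp_deg (a : trigpoly) : nat := maxn `|tp_lo a|%N `|tp_hi a|%N.

End TrigonometricPolynomials.

Coercion tp_eval : trigpoly >-> Funclass.

Section FrequencyBasedFrames.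
Variable R : realType.
Implicit Types (f g : R -> R[i]) (lambda : R) (k : int).

(* f_{lambda; 0, k} *)
Definition dilmod lambda k f (xi : R) : R[i] :=
  (Num.sqrt `|lambda|)%:C%C * expi (- (k%:~R * lambda * xi)) * f (lambda * xi).

Definition frame_term f g lambda (phi tphi : R -> R[i]) k : R[i] :=
  pairing f (dilmod lambda k phi) * pairing (dilmod lambda k tphi) g.

Definition dual_wavelet_frames (lam : nat -> R) (J : nat)
    (rJ : nat) (Phi tPhi : 'I_rJ -> R -> R[i])
    (s : nat -> nat) (Psi tPsi : forall j, 'I_(s j) -> R -> R[i]) : Prop :=
  forall f g, test_function f -> test_function g ->
  [/\ forall l : 'I_rJ,
        abs_summable (frame_term f g (lam J) (Phi l) (tPhi l)),
      forall j, (J <= j)%N -> forall l : 'I_(s j),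
        abs_summable (frame_term f g (lam j) (Psi j l) (tPsi j l))
    & (fun J' : nat =>
         \sum_(l < rJ) sumZ (frame_term f g (lam J) (Phi l) (tPhi l)) +
         \sum_(J <= j < J') \sum_(l < s j)
            sumZ (frame_term f g (lam j) (Psi j l) (tPsi j l))) @ \oo
      --> (2 * pi)%:C%C * pairing f g].

End FrequencyBasedFrames.

(* Sequences indexed by {1, 2, ...} are functions on nat whose value at 0 is
   never used. *)
Section Construction.
Variables (R : realType) (d : nat -> int).

Definition lam (j : nat) : R := (\prod_(1 <= n < j.+1) (d n)%:~R)^-1.

Definition mask_product (a : nat -> trigpoly R) (j : nat) (xi : R) (N : nat)
    : R[i] :=
  \prod_(1 <= n < N.+1) a (j + n)%N (lam (j + n) * (lam j)^-1 * xi).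

(* varphi^j *)
Definition refinable (a : nat -> trigpoly R) (j : nat) (xi : R) : R[i] :=
  limn (mask_product a j xi).

Variables r s : nat -> nat.

(* varphi^{j, l}, for j >= 0 *)
Definition Phi (a : nat -> trigpoly R)
    (theta : forall j, 'I_(r j.-1) -> R -> R[i])
    (j : nat) (l : 'I_(r j)) (xi : R) : R[i] :=
  theta j.+1 l xi * refinable a j xi.

(* psi^{j, l}, for j >= 0; the defining relation
   psi^{j, l} (d_{j+1} xi) = b^{j+1, l} xi * varphi^{j+1} xi is solved for
   psi^{j, l}, using d_{j+1} != 0. *)
Definition Psi (a : nat -> trigpoly R)
    (b : forall j, 'I_(s j.-1) -> R -> R[i])
    (j : nat) (l : 'I_(s j)) (xi : R) : R[i] :=
  b j.+1 l (xi / (d j.+1)%:~R) * refinable a j.+1 (xi / (d j.+1)%:~R).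

Definition Theta (theta ttheta : forall j, 'I_(r j.-1) -> R -> R[i])
    (j : nat) (xi : R) : R[i] :=
  \sum_(l < r j.-1) (theta j l xi)^*%C * ttheta j l xi.

End Construction.

(* Main.v *)
Require Import Defs.
From mathcomp Require Import all_boot all_order all_algebra.
From mathcomp Require Import all_classical all_reals all_analysis.
From mathcomp Require Import complex.
From mathcomp Require finmap.
From mathcomp Require Import measurable_realfun ess_sup_inf ring lra zify.
Set Implicit Arguments.
Unset Strict Implicit.
Unset Printing Implicit Defensive.
Import Order.TTheory GRing.Theory Num.Theory numFieldNormedType.Exports Normc.
Local Open Scope classical_set_scope.
Local Open Scope ring_scope.

(** Write lam for the dilations, x for the frequency variable and H_j(y) for the
    product of the a^n(lam_n y) over n > j, so that phi^j(lam_j y) = H_j(y).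

    Products.  Bernstein's inequality bounds the m-th Taylor coefficient of
    a^n(lam_n y) at the origin by s_n^m / m!, where s_n is a constant times
    |lam_n| deg(a^n) |a^n|, a summable sequence.  The class of functions dominated
    in this way by exp(s y) (majorized) is stable under products, the exponents
    being added, and under locally uniform limits.  Hence the products converge
    locally uniformly to continuous functions, H_j is majorized by the tail
    sigma_j of the series, which tends to zero, and it vanishes only where one of
    the masks does, on a null set (refinable_majorized, refinable_ae_neq0).

    Frame sums.  For test functions f and g the coefficients at level j are
    Fourier coefficients, and Parseval's identity for periodizations turns the
    series over k into the finite sum over k of
      int f(x) conj(g(x + 2 pi k / lam_j)) W_k(x) dx,
    where W_k pairs the generators at lam_j x and lam_j x + 2 pi k (frame_sum,
    frame_blocks).  In particular the series converge absolutely.  Inserting the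
    refinement equations, the scaling part at level j+1 minus the scaling and
    wavelet parts at level j is a sum of the same shape whose kernel is the defect
    of the two algebraic conditions times conj(phi^{j+1}) tphi^{j+1}
    (cascade_defect).

    Equivalence with the algebraic conditions.  Frames at all levels mean that
    this difference vanishes for all f, g and all j and that the scaling part
    alone tends to 2 pi <f, g> (frames_iff).  Testing with a bump on an interval
    shorter than 2 pi / |lam_j| and its translate isolates one k, so the
    difference vanishes for all f and g exactly when all the defects vanish almost
    everywhere; the refinable functions are divided out (cascade_iff).

    Equivalence with the limit.  For large j only k = 0 contributes, and the
    scaling part is 2 pi times the integral of F V_j h_j, where F = f conj(g),
    V_j(x) = Theta^{j+1}(lam_j x) and h_j = conj(H_j) tH_j.  It remains to compare
    the limits of int F V_j h_j and of int F V_j, though nothing bounds V_j in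
    absolute value.  Here h_j, close to 1, is majorized by exp(sigma_j x), so
    that int F V_j (h_j - 1) is a series in the moments of F V_j whose
    coefficients tend to zero (moment_perturb).  If int G V_j is bounded in j for
    every test function G, it is so for G = F c with c entire, and a gliding hump
    argument, the uniform boundedness principle for entire functions, yields a
    bound B rho^m on all the moments, uniform in j (hump_bound, moments_bounded).
    This proves one direction (limit_perturbed).  In the other the moments of
    F V_j h_j are bounded in this way, and the moments of F V_j inherit such a
    bound because they differ from them by at most half of any bound they satisfy
    (limit_unperturbed). *)

(** * Complex modulus and the unit circle *)

Section ComplexModulus.
Variable R : realType.
Implicit Types (z w : R[i]) (x y : R).

Lemma normcE2 z : normc z ^+ 2 = complex.Re z ^+ 2 + complex.Im z ^+ 2.
Proof. by case: z => a b /=; rewrite sqr_sqrtr// addr_ge0 ?sqr_ge0. Qed.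

Lemma normcC z : (normc z)%:C%C = `|z| :> R[i].
Proof. by case: z => a b; rewrite normc_def. Qed.

Lemma normc_ge0 z : 0 <= normc z.
Proof. by case: z => a b; rewrite /= sqrtr_ge0. Qed.

Lemma normc_real x : normc x%:C%C = `|x|.
Proof. by rewrite /= expr0n addr0 sqrtr_sqr. Qed.

Lemma normc_conj z : normc z^*%C = normc z.
Proof. by case: z => a b; rewrite /= sqrrN. Qed.

Lemma normcB z w : normc (z - w) <= normc z + normc w.
Proof. by rewrite -(normcN w) le_normcD. Qed.

Lemma normcBC z w : normc (z - w) = normc (w - z).
Proof. by rewrite -opprB normcN. Qed.

Lemma normc_sum I (r : seq I) (P : pred I) (F : I -> R[i]) :
  normc (\sum_(i <- r | P i) F i) <= \sum_(i <- r | P i) normc (F i).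
Proof.
elim/big_rec2 : _ => [|i y1 y2 _ h]; first by rewrite normc0.
by rewrite (le_trans (le_normcD _ _))// lerD2l.
Qed.

Lemma normcX z n : normc (z ^+ n) = normc z ^+ n.
Proof. by elim: n => [|n ih]; rewrite ?expr0 ?normc1// !exprS normcM ih. Qed.

Lemma normc_nat n : normc (n%:R : R[i]) = n%:R.
Proof. by rewrite normcMn normc1. Qed.

Lemma Re_le_normc z : `|complex.Re z| <= normc z.
Proof. by rewrite -lecR normc_ge_Re. Qed.

Lemma Im_le_normc z : `|complex.Im z| <= normc z.
Proof.
rewrite -(@ler_pXn2r _ 2) ?nnegrE ?normc_ge0 ?normr_ge0//.
by rewrite real_normK ?num_real// normcE2 lerDr sqr_ge0.
Qed.

Lemma normc_le_ReIm z : normc z <= `|complex.Re z| + `|complex.Im z|.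
Proof.
rewrite -(@ler_pXn2r _ 2) ?nnegrE ?normc_ge0 ?addr_ge0//.
rewrite normcE2 sqrrD !real_normK ?num_real//.
by rewrite addrAC lerDl mulrn_wge0// mulr_ge0.
Qed.

Lemma normc_mulJ z : z * z^*%C = (normc z ^+ 2)%:C%C.
Proof. by rewrite -sqr_normc -normcC rmorphXn. Qed.

Lemma lerB_normc z w : normc z - normc w <= normc (z - w).
Proof. by rewrite lerBlDr -{1}(subrK w z) le_normcD. Qed.

Lemma normc_eq0 z : (normc z == 0) = (z == 0).
Proof. by apply/eqP/eqP => [/eq0_normc//|->]; rewrite normc0. Qed.

Lemma normc_sqrD z w : normc (z + w) ^+ 2 <= 2 * normc z ^+ 2 + 2 * normc w ^+ 2.
Proof.
have h := le_normcD z w; have h0 := normc_ge0 (z + w).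
apply: (@le_trans _ _ ((normc z + normc w) ^+ 2)).
  by rewrite ler_pXn2r// nnegrE// (le_trans h0).
by have := sqr_ge0 (normc z - normc w); nra.
Qed.

Lemma normcM_le z w : normc (z * w) <= normc z ^+ 2 + normc w ^+ 2.
Proof.
rewrite normcM; have := sqr_ge0 (normc z - normc w).
have := mulr_ge0 (normc_ge0 z) (normc_ge0 w); nra.
Qed.

Lemma cReD z w : complex.Re (z + w) = complex.Re z + complex.Re w.
Proof. by case: z; case: w. Qed.
Lemma cImD z w : complex.Im (z + w) = complex.Im z + complex.Im w.
Proof. by case: z; case: w. Qed.
Lemma cReN z : complex.Re (- z) = - complex.Re z.
Proof. by case: z. Qed.
Lemma cImN z : complex.Im (- z) = - complex.Im z.
Proof. by case: z. Qed.
Lemma cReM z w : complex.Re (z * w) =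
  complex.Re z * complex.Re w - complex.Im z * complex.Im w.
Proof. by case: z; case: w. Qed.
Lemma cImM z w : complex.Im (z * w) =
  complex.Re z * complex.Im w + complex.Im z * complex.Re w.
Proof. by case: z => a b; case: w. Qed.
Lemma cReJ z : complex.Re z^*%C = complex.Re z. Proof. by case: z. Qed.
Lemma cImJ z : complex.Im z^*%C = - complex.Im z. Proof. by case: z. Qed.

Lemma conjcM z w : (z * w)^*%C = z^*%C * w^*%C.
Proof. exact: rmorphM. Qed.

(** The topology of R[i] comes from its norm, which takes values in R[i] itself;
    this brings convergence back to real sequences. *)
Lemma cvg_complexP (u : nat -> R[i]) (l : R[i]) :
  u @ \oo --> l <-> normc (u n - l) @[n --> \oo] --> (0 : R).
Proof.
split=> [/cvgrPdist_lt h|h]; apply/cvgrPdist_lt => e e0.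
- have e0' : (0 : R[i]) < e%:C%C by rewrite ltcR.
  have [N _ hN] := h _ e0'; exists N => // n /hN /=.
  rewrite -normcC ltcR sub0r normrN ger0_norm ?normc_ge0//.
  by rewrite -[u n - l]opprB normcN.
- have e0' : e = (complex.Re e)%:C%C.
    by rewrite RRe_real// realE ltW.
  have h0 : 0 < complex.Re e by rewrite -ltcR -e0'.
  move/cvgrPdist_lt : h => /(_ _ h0)[N _ hN]; exists N => // n /hN /=.
  rewrite e0' -normcC ltcR sub0r normrN ger0_norm ?normc_ge0//.
  by rewrite -[u n - l]opprB normcN.
Qed.

Lemma cvg_complex_unique (u : nat -> R[i]) (l l' : R[i]) :
  u @ \oo --> l -> u @ \oo --> l' -> l = l'.
Proof. exact: cvg_unique. Qed.

End ComplexModulus.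

Section Expi.
Variable R : realType.
Implicit Types (x y : R).

Lemma expi0 : expi 0 = 1 :> R[i].
Proof. by rewrite /expi cos0 sin0. Qed.

Lemma expiD x y : expi (x + y) = expi x * expi y.
Proof.
by apply/eqP; rewrite eq_complex /= cosD sinD eqxx/= addrC (mulrC (sin x)) eqxx.
Qed.

Lemma normc_expi x : normc (expi x) = 1.
Proof. by rewrite /= cos2Dsin2 sqrtr1. Qed.

Lemma expiN x : expi (- x) = (expi x)^*%C.
Proof. by rewrite /expi /= cosN sinN. Qed.

Lemma expi_neq0 x : expi x != 0.
Proof. by rewrite -normc_eq0 normc_expi oner_neq0. Qed.

Lemma expiX x n : expi x ^+ n = expi (n%:R * x).
Proof.
elim: n => [|n ih]; first by rewrite mul0r expi0 expr0.
by rewrite exprS ih -expiD -{1}(mul1r x) -mulrDl nat1r.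
Qed.

Lemma expi_2pin n : expi (2 * pi * n%:R : R) = 1.
Proof.
elim: n => [|n ih]; first by rewrite mulr0 expi0.
rewrite -(natr1 n) mulrDr mulr1 expiD ih mul1r.
by rewrite /expi mulr_natl -[pi *+ 2]add0r cosD2pi sinD2pi cos0 sin0.
Qed.

Lemma expi_2piz (n : int) : expi (2 * pi * n%:~R : R) = 1.
Proof.
case: n => n; first exact: expi_2pin.
by rewrite NegzE mulrNz mulrN expiN expi_2pin conjc1.
Qed.

Lemma expiDz x (n : int) : expi (x + 2 * pi * n%:~R) = expi x.
Proof. by rewrite expiD expi_2piz mulr1. Qed.

Lemma cos_half x : cos x = 1 - 2 * sin (x / 2) ^+ 2.
Proof.
rewrite {1}(_ : x = x / 2 + x / 2); last by field.
by rewrite cosD -!expr2 -[X in _ = X - _](cos2Dsin2 (x / 2)); ring.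
Qed.

Lemma expi_eq1 x : expi x = 1 -> exists n : int, x = 2 * pi * n%:~R.
Proof.
have p0 : 0 < 2 * pi :> R by rewrite mulr_gt0// pi_gt0.
pose n := Num.floor (x / (2 * pi)); move=> h.
have : expi (x - 2 * pi * n%:~R) = 1.
  by rewrite -mulrN -mulrNz expiDz.
set y := x - _ => [] [cy _].
have y0 : 0 <= y.
  rewrite /y subr_ge0 mulrC -ler_pdivlMr//.
  exact: floor_le.
have y1 : y < 2 * pi.
  rewrite /y ltrBlDl mulrC -[X in _ < _ + X]mul1r -mulrDl -ltr_pdivrMr//.
  by have /andP[_] := floor_itv (x / (2 * pi)); rewrite intrD.
exists n; apply/eqP; rewrite -subr_eq0 -/y; apply/negP => /negP yn0.
have /sin_gt0_pi : 0 < y / 2 < pi.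
  by rewrite divr_gt0//= ?ltr_pdivrMr// ?(mulrC pi)// lt_neqAle eq_sym yn0.
move: cy; rewrite cos_half => cy s0.
have : 0 < sin (y / 2) ^+ 2 by rewrite exprn_gt0.
lra.
Qed.

End Expi.

(** * Dirichlet kernels, Bernstein's inequality and Fejer means *)

Section DirichletKernel.
Variable R : realType.
Implicit Types (x t : R) (N L : nat).

Definition node L (m : nat) : R := 2 * pi * m%:R / L%:R.

(** The root of unity at the nodes has powers summing to zero unless s is a
    multiple of L. *)
Lemma sum_node (L : nat) (s : int) : (0 < L)%N -> (`|s| < L)%N ->
  \sum_(m < L) expi (s%:~R * node L m) = (L * (s == 0))%:R :> R[i].
Proof.
move=> L0 sL; have Ln0 : L%:R != 0 :> R by rewrite pnatr_eq0 -lt0n.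
have [->|s0] := eqVneq s 0.
  under eq_bigr do rewrite mul0r expi0.
  by rewrite sumr_const card_ord muln1.
rewrite muln0; set w := expi (s%:~R * (2 * pi / L%:R) : R).
have wE (m : 'I_L) : expi (s%:~R * node L m) = w ^+ m.
  by rewrite /w expiX /node; congr expi; field.
under eq_bigr do rewrite wE.
have w1 : w - 1 != 0.
  rewrite subr_eq0; apply/eqP => /expi_eq1[n].
  have p0 : 2 * pi != 0 :> R by rewrite mulf_neq0// gt_eqF// pi_gt0.
  rewrite mulrCA => /(mulfI p0)/(canRL (mulfVK Ln0)).
  rewrite -[L%:R]/(L%:Z%:~R) -intrM => /intr_inj sE.
  move: sL; rewrite sE abszM; case: n sE => [[|n]|n] sE; nia.
apply/(mulfI w1); rewrite -subrX1 mulr0 expiX.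
rewrite (_ : _ * _ = 2 * pi * s%:~R); last by field.
by rewrite expi_2piz subrr.
Qed.

Definition dirichlet N t : R[i] := \sum_(i < N) expi (i%:R * t).

Lemma dirichlet_sqr N t : (normc (dirichlet N t) ^+ 2)%:C%C =
  \sum_(i < N) \sum_(j < N) expi ((i%:Z - j%:Z)%:~R * t).
Proof.
rewrite -normc_mulJ rmorph_sum mulr_suml; apply: eq_bigr => i _.
rewrite mulr_sumr; apply: eq_bigr => j _.
by rewrite -[(_ : {rmorphism _ -> _}) _]/((expi _)^*%C) -expiN -expiD;
  congr expi; rewrite intrB mulrBl.
Qed.

(** Parseval's identity on the group of [L]-th roots of unity: no two of the
    [N <= L] frequencies of the kernel alias. *)
Lemma dirichlet_energy N L x : (0 < N)%N -> (N <= L)%N ->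
  \sum_(m < L) normc (dirichlet N (x - node L m)) ^+ 2 = (L * N)%:R.
Proof.
move=> N0 NL; apply: (@complexI R); rewrite rmorph_sum /=.
under eq_bigr do rewrite dirichlet_sqr.
rewrite exchange_big /=.
transitivity (\sum_(i < N) (L%:R : R[i])); last first.
  by rewrite sumr_const card_ord -mulrnA -[RHS]/((_)%:C%C) rmorph_nat.
apply: eq_bigr => i _; rewrite exchange_big /= (bigD1 i)//= [X in _ + X]big1 => [|j ji].
  rewrite addr0 subrr; under eq_bigr do rewrite mul0r expi0.
  by rewrite sumr_const card_ord.
transitivity (expi ((i%:Z - j%:Z)%:~R * x) *
    \sum_(m < L) expi ((j%:Z - i%:Z)%:~R * node L m)).
  rewrite mulr_sumr; apply: eq_bigr => m _.
  by rewrite -expiD; congr expi; rewrite !intrB; ring.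
rewrite sum_node; first last.
- have := ltn_ord i; have := ltn_ord j; lia.
- exact: leq_trans NL.
- rewrite subr_eq0 (_ : (j%:Z == i%:Z) = false) ?muln0 ?mulr0//.
  by apply: contra_neqF ji => /eqP[] /val_inj.
Qed.

(** The geometric sum telescopes, so that away from the multiples of 2 pi the
    kernel is bounded uniformly in N. *)
Lemma dirichlet_geom N t :
  normc (dirichlet N t) * normc (1 - expi t) <= 2.
Proof.
have -> : dirichlet N t = \sum_(i < N) expi t ^+ i.
  by apply: eq_bigr => i _; rewrite expiX.
rewrite -normcM mulrC -[1 - _]opprB mulNr -subrX1 normcN.
by rewrite (le_trans (normcB _ _))// normc1 normcX normc_expi expr1n.
Qed.

End DirichletKernel.
Arguments node {R} L m.

Section Bernstein.
Variable R : realType.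

(** On the frequencies [0 <= n <= N] multiplication by [n] coincides with the
    multiplier [#{(i, j) : i, j < N, i + j + 1 = n}], a convolution of two
    Dirichlet kernels; its kernel, sampled at [2 N] nodes, has average modulus
    exactly [N] by [dirichlet_energy]. *)
Lemma bernstein_pos (c : nat -> R[i]) (N : nat) (M : R) : (0 < N)%N ->
  (forall x : R, normc (\sum_(n < N.+1) c n * expi (- (n%:R * x))) <= M) ->
  forall x : R, normc (\sum_(n < N.+1) n%:R * c n * expi (- (n%:R * x))) <= N%:R * M.
Proof.
move=> N0 cM x; pose L := (2 * N)%N.
have L0 : (0 < L)%N by rewrite muln_gt0.
have NL : (N <= L)%N by rewrite /L; lia.
pose P (y : R) := \sum_(n < N.+1) c n * expi (- (n%:R * y)).
pose K t : R[i] := \sum_(i < N) \sum_(j < N) expi ((i + j).+1%:R * t).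
have KE t : normc (K t) = normc (dirichlet N t) ^+ 2.
  have -> : K t = dirichlet N t * (expi t * dirichlet N t).
    rewrite {1}/dirichlet mulr_suml; apply: eq_bigr => i _.
    rewrite !mulr_sumr; apply: eq_bigr => j _; rewrite -!expiD; congr expi.
    by rewrite -addnS natrD -addn1 natrD; ring.
  by rewrite !normcM normc_expi mul1r expr2.
have key : L%:R * \sum_(n < N.+1) n%:R * c n * expi (- (n%:R * x)) =
    \sum_(m < L) P (x - node L m : R) * K (0 - node L m).
  rewrite mulr_sumr.
  under [RHS]eq_bigr do rewrite mulr_suml.
  rewrite exchange_big /=; apply: eq_bigr => n _.
  transitivity (c n * expi (- (n%:R * x)) * \sum_(i < N) \sum_(j < N)
      \sum_(m < L) expi ((n%:Z - (i + j).+1%:Z)%:~R * node L m)).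
    have -> : \sum_(i < N) \sum_(j < N)
        \sum_(m < L) expi ((n%:Z - (i + j).+1%:Z)%:~R * node L m) =
        \sum_(i < N) ((L * (i < n))%:R : R[i]).
      apply: eq_bigr => i _.
      transitivity (\sum_(j < N) (L * (n == (i + j).+1 :> nat))%:R : R[i]).
        apply: eq_bigr => j _; rewrite sum_node//; last first.
          by rewrite /L; have := ltn_ord i; have := ltn_ord j;
            have := ltn_ord n; lia.
        by rewrite subr_eq0; congr (_ * _)%:R; congr nat_of_bool; lia.
      have [ni|ni] := ltnP i n.
        have jP : (n - i.+1 < N)%N by have := ltn_ord n; lia.
        rewrite (bigD1 (Ordinal jP))//= big1 => [|j /eqP jn].
          by rewrite addr0; congr (_ * _)%:R; rewrite (_ : (_ == _) = true)//; lia.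
        rewrite (_ : (_ == _) = false) ?muln0//; apply/negP => /eqP nE.
        by apply: jn; apply/val_inj => /=; lia.
      rewrite muln0 big1// => j _; rewrite (_ : (_ == _) = false) ?muln0//; lia.
    (* n has exactly n representations as i + j + 1 with i, j < N *)
  have -> : \sum_(i < N) ((L * (i < n))%:R : R[i]) = L%:R * n%:R.
      under eq_bigr do rewrite natrM.
      rewrite -mulr_sumr; congr (_ * _).
      rewrite -natr_sum; congr (_%:R).
      have nN : (n <= N)%N by rewrite -ltnS.
      rewrite -big_mkcond/= -(big_ord_widen N (fun=> 1%N) nN).
      by rewrite sum1_card card_ord.
    by ring.
  have swap (G : 'I_N -> 'I_N -> 'I_L -> R[i]) :
      \sum_i \sum_j \sum_m G i j m = \sum_m \sum_i \sum_j G i j m.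
    by rewrite [RHS]exchange_big; apply: eq_bigr => i _; rewrite exchange_big.
  rewrite swap mulr_sumr /=; apply: eq_bigr => m _.
  rewrite /K mulr_sumr [RHS]mulr_sumr; apply: eq_bigr => i _.
  rewrite mulr_sumr [RHS]mulr_sumr; apply: eq_bigr => j _.
  rewrite -!mulrA -!expiD; congr (_ * expi _).
  by rewrite intrB -!pmulrn; ring.
have Lr : (0 : R) < L%:R by rewrite ltr0n.
rewrite -(ler_pM2l Lr) -{1}(normc_nat R L) -normcM key.
rewrite (le_trans (normc_sum _ _ _))//.
apply: (@le_trans _ _ (\sum_(m < L) M * normc (dirichlet N (0 - node L m)) ^+ 2)).
  apply: ler_sum => m _; rewrite normcM KE ler_wpM2r ?sqr_ge0//; exact: cM.
by rewrite -mulr_sumr dirichlet_energy// natrM mulrC -!mulrA.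
Qed.

End Bernstein.

Section FejerApproximation.
Variable R : realType.
Implicit Types (F : R -> R[i]) (x : R) (N : nat).

Definition fejer_mean F N x : R[i] :=
  (N%:R ^- 2)%:C%C *
  \sum_(m < N) F (node N m) * (normc (dirichlet N (x - node N m)) ^+ 2)%:C%C.

Lemma normc_fejer_mean F N x (B : R) : (0 < N)%N ->
  (forall y, normc (F y) <= B) -> normc (fejer_mean F N x) <= B.
Proof.
move=> N0 FB; have Nr : (0 : R) < N%:R by rewrite ltr0n.
rewrite normcM normc_real ger0_norm ?invr_ge0 ?exprn_ge0//.
rewrite mulrC ler_pdivrMr ?exprn_gt0//.
rewrite (le_trans (normc_sum _ _ _))//.
rewrite -[_ ^+ 2]/(N%:R * N%:R : R) -natrM -(dirichlet_energy x N0 (leqnn N)) mulr_sumr.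
apply: ler_sum => m _; rewrite normcM normc_real ger0_norm ?sqr_ge0//.
by rewrite ler_wpM2r ?sqr_ge0.
Qed.

(** The kernel has average one and is at most [4 / |1 - exp(i t)|^2] before
    normalisation by [N], so it concentrates at the points congruent to [x],
    where a continuous periodic [F] differs little from [F x]. *)
Lemma fejer_mean_cvg F (B : R) x :
  (forall y (n : int), F (y + 2 * pi * n%:~R) = F y) ->
  (forall y, normc (F y) <= B) ->
  (forall e, 0 < e -> exists2 d, 0 < d &
     forall y, `|y - x| < d -> normc (F y - F x) < e) ->
  normc (fejer_mean F N x - F x) @[N --> \oo] --> (0 : R).
Proof.
move=> Fper FB Fx; apply/cvgrPdist_lt => e e0.
have e20 : 0 < e / 2 by rewrite divr_gt0.
have B0 : 0 <= B by rewrite (le_trans (normc_ge0 (F 0))).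
have [d0 d00 dF0] := Fx _ e20.
pose d := Num.min d0 1; have d_gt0 : 0 < d by rewrite lt_min d00/=.
have dpi : d < pi.
  rewrite /d gt_min; apply/orP; right.
  by rewrite (lt_le_trans _ (pi_ge2 _))// ltr1n.
have dF y : `|y - x| < d -> normc (F y - F x) < e / 2.
  by move=> h; apply: dF0; rewrite (lt_le_trans h)// ge_min lexx.
pose h := 2 - 2 * cos d.
have h0 : 0 < h.
  rewrite /h subr_gt0 gtr_pMr// -cos0 ltr_cos// in_itv/= ?lexx ?pi_ge0//.
  by rewrite !ltW.
(* Either t is close to a multiple of 2 pi or |1 - exp(it)| is bounded below. *)
have far t : (exists2 n : int, `|t - 2 * pi * n%:~R| < d & True) \/
    h <= normc (1 - expi t) ^+ 2.
  have -> : normc (1 - expi t) ^+ 2 = 2 - 2 * cos t.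
    rewrite normcE2 /= sub0r sqrrN sqrrB expr1n.
    by have := cos2Dsin2 t; nra.
  pose n := Num.floor ((t + pi) / (2 * pi)).
  have p0 : 0 < 2 * pi :> R by rewrite mulr_gt0// pi_gt0.
  have /andP[z1 z2] := floor_itv ((t + pi) / (2 * pi)).
  rewrite ler_pdivlMr// in z1; rewrite ltr_pdivrMr// in z2.
  rewrite -/n in z1 z2; rewrite intrD in z2.
  pose z := t - 2 * pi * n%:~R.
  have zpi : `|z| <= pi by rewrite ler_norml /z; apply/andP; split; nra.
  have [zd|dz] := ltP `|z| d; first by left; exists n.
  right; have -> : cos t = cos `|z|.
    have := expiDz t (- n); rewrite mulrNz mulrN -/z cos_norm.
    by move=> /(congr1 (@complex.Re R)).
  have : cos `|z| <= cos d.
    move: dz; rewrite le_eqVlt => /predU1P[<-//|dz].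
    apply/ltW; rewrite ltr_cos// in_itv/= ?normr_ge0//.
    by rewrite !ltW.
  rewrite /h; lra.
pose C := 8 * B / h.
have C0 : 0 <= C by apply: divr_ge0; [exact: mulr_ge0|exact: ltW].
have [N0 N0P] : exists N0 : nat, 2 * C / e < N0%:R.
  by exists (Num.truncn (2 * C / e)).+1; rewrite truncnS_gt.
exists N0.+1 => // N /= N0N.
have Ngt0 : (0 < N)%N by apply: leq_trans N0N.
have Nr : (0 : R) < N%:R by rewrite ltr0n.
have energy := dirichlet_energy x Ngt0 (leqnn N).
have FxE : F x = (N%:R ^- 2)%:C%C * \sum_(m < N)
    F x * (normc (dirichlet N (x - node N m)) ^+ 2)%:C%C.
  rewrite -mulr_sumr -rmorph_sum energy mulrCA -rmorphM natrM -expr2.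
  by rewrite mulVf ?mulr1// expf_neq0// gt_eqF.
rewrite sub0r normrN ger0_norm ?normc_ge0// FxE.
rewrite /fejer_mean -mulrBr -sumrB.
rewrite normcM normc_real ger0_norm ?invr_ge0 ?exprn_ge0 ?ltW//.
rewrite mulrC ltr_pdivrMr ?exprn_gt0//.
rewrite (le_lt_trans (normc_sum _ _ _))//.
apply: (@le_lt_trans _ _ (\sum_(m < N)
    ((e / 2) * normc (dirichlet N (x - node N m)) ^+ 2 + C))).
  apply: ler_sum => m _; rewrite -mulrBl normcM normc_real.
  rewrite (ger0_norm (sqr_ge0 _)).
  have D0 := sqr_ge0 (normc (dirichlet N (x - node N m))).
  have := far (x - node N m) => -[[n nd _]|hfar].
    rewrite -(Fper _ n); apply: ler_wpDr => //.
    apply: ler_wpM2r => //; apply/ltW/dF.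
    by rewrite distrC opprD addrA.
  apply: ler_wpDl; first by rewrite mulr_ge0// ltW.
  rewrite /C ler_pdivlMr// -mulrA.
  have := dirichlet_geom N (x - node N m).
  set D := normc (dirichlet _ _) in D0 *; set G := normc (1 - _) in hfar * => DG.
  have DG4 : D ^+ 2 * G ^+ 2 <= 4.
    have -> : 4 = 2 ^+ 2 :> R by rewrite expr2 -natrM.
    rewrite -exprMn ler_pXn2r// nnegrE//.
    by apply: mulr_ge0; exact: normc_ge0.
  have Dh : D ^+ 2 * h <= 4 by apply: le_trans DG4; rewrite ler_wpM2l.
  have F2 : normc (F (node N m) - F x) <= 2 * B.
    by rewrite (le_trans (normcB _ _))// mulr_natl mulr2n lerD.
  rewrite (_ : 8 * B = (2 * B) * 4); last by ring.
  apply: ler_pM => //; [exact: normc_ge0|by apply: mulr_ge0 => //; exact: ltW].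
rewrite big_split/= -mulr_sumr energy sumr_const card_ord natrM.
rewrite -[C *+ N]mulr_natl.
have : 2 * C < N%:R * e.
  move: N0P; rewrite ltr_pdivrMr// => /lt_le_trans; apply.
  by rewrite ler_wpM2r ?ltW// ltr_nat.
by rewrite expr2; nra.
Qed.

End FejerApproximation.

(** * Limits of complex sequences *)

Section ComplexLimits.
Variable R : realType.

Lemma complex_cvg_ReIm (u : nat -> R[i]) (l : R[i]) :
  complex.Re (u n) @[n --> \oo] --> complex.Re l ->
  complex.Im (u n) @[n --> \oo] --> complex.Im l -> u @ \oo --> l.
Proof.
move=> h1 h2; apply/cvg_complexP.
apply: (@squeeze_cvgr _ _ _ _ (fun=> 0) (fun n =>
  `|complex.Re (u n) - complex.Re l| + `|complex.Im (u n) - complex.Im l|)).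
- near=> n; rewrite normc_ge0/= (le_trans (normc_le_ReIm _))//.
  by rewrite !(cReD, cImD, cReN, cImN).
- exact: cvg_cst.
- rewrite -[0]addr0; apply: cvgD.
  + by rewrite -(normr0 R); apply: cvg_norm; apply/subr_cvg0.
  + by rewrite -(normr0 R); apply: cvg_norm; apply/subr_cvg0.
Unshelve. all: by end_near. Qed.

Lemma real_cauchy_cvg (u : nat -> R) :
  (forall e, 0 < e -> exists N, forall n, `|u (N + n)%N - u N| <= e) -> cvgn u.
Proof.
move=> h; apply/cauchy_cvgP/cauchy_exP => e e0.
have e2 : 0 < e / 2 by rewrite divr_gt0.
have [N hN] := h _ e2; exists (u N); exists N => // n /= Nn.
rewrite /ball/= distrC -(subnKC Nn) (le_lt_trans (hN _))//.
by rewrite gtr_pMr// invf_lt1// ltr1n.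
Qed.

Lemma complex_cauchy_cvg (u : nat -> R[i]) :
  (forall e : R, 0 < e -> exists N, forall n, normc (u (N + n)%N - u N) <= e) ->
  cvgn u.
Proof.
move=> h.
have hR : cvgn (fun n => complex.Re (u n)).
  apply: real_cauchy_cvg => e /h[N hN]; exists N => n.
  by rewrite (le_trans _ (hN n))// -cReN -cReD Re_le_normc.
have hI : cvgn (fun n => complex.Im (u n)).
  apply: real_cauchy_cvg => e /h[N hN]; exists N => n.
  by rewrite (le_trans _ (hN n))// -cImN -cImD Im_le_normc.
apply/cvg_ex; exists (Complex (limn (fun n => complex.Re (u n)))
  (limn (fun n => complex.Im (u n)))).
exact: complex_cvg_ReIm.
Qed.

Lemma limc_unique (u : nat -> R[i]) (l : R[i]) : u @ \oo --> l -> limn u = l.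
Proof. exact: cvg_lim. Qed.

Lemma normc_lim_le (u : nat -> R[i]) (l z : R[i]) (e : R) N :
  u @ \oo --> l -> (forall n, (N <= n)%N -> normc (u n - z) <= e) ->
  normc (l - z) <= e.
Proof.
move=> /cvg_complexP ul h; apply/ler_addgt0Pr => d d0.
move/cvgrPdist_lt : ul => /(_ _ d0)[M _ hM].
have := hM (maxn N M) (leq_maxr _ _); have := h _ (leq_maxl N M).
rewrite sub0r normrN ger0_norm ?normc_ge0//.
set w := u _ => h1 h2.
rewrite -[l - z](subrKA w) (le_trans (le_normcD _ _))//.
by rewrite addrC lerD// normcBC ltW.
Qed.

Lemma cvg_complexM (u v : nat -> R[i]) (l l' : R[i]) :
  u @ \oo --> l -> v @ \oo --> l' -> (fun n => u n * v n) @ \oo --> l * l'.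
Proof. exact: cvgM. Qed.

Lemma cvg_complexD (u v : nat -> R[i]) (l l' : R[i]) :
  u @ \oo --> l -> v @ \oo --> l' -> (fun n => u n + v n) @ \oo --> l + l'.
Proof. exact: cvgD. Qed.

End ComplexLimits.

(** * Taylor polynomials on the imaginary axis *)

Section ExponentialTaylor.
Variable R : realType.
Implicit Types (x y : R).

Definition expsum n x : R := \sum_(0 <= k < n) x ^+ k / k`!%:R.

Lemma expsum_le n x : 0 <= x -> expsum n x <= expR x.
Proof.
move=> x0; apply: (@nondecreasing_cvgn_le R (expsum^~ x)).
  apply/nondecreasing_seqP => m; rewrite /expsum big_nat_recr//= lerDl.
  by rewrite divr_ge0// exprn_ge0.
exact: is_cvg_series_exp_coeff.
Qed.

Lemma expsum_cvg x : expsum n x @[n --> \oo] --> expR x.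
Proof. exact: is_cvg_series_exp_coeff. Qed.

Lemma iX y k : (Complex 0 y : R[i]) ^+ k =
  Complex ((~~ odd k)%:R * (-1) ^+ k./2 * y ^+ k)
          ((odd k)%:R * (-1) ^+ k.-1./2 * y ^+ k).
Proof.
elim: k => [|k ih]; first by rewrite /= !mul0r !expr0 !mulr1.
rewrite exprS ih; apply/eqP; rewrite eq_complex /= !mul0r !add0r.
have [ok|ek] := boolP (odd k) => /=.
  case: k ok {ih} => // k /= ok; rewrite !mul0r mulr0 eqxx andbT !mul1r.
  by rewrite [in X in _ == X]exprS mulN1r (exprS y k.+1); apply/eqP; ring.
by rewrite !mul0r mulr0 oppr0 eqxx/= !mul1r exprS; apply/eqP; ring.
Qed.

Definition expi_taylor n y : R[i] :=
  \sum_(0 <= k < n) (Complex 0 y) ^+ k * (k`!%:R^-1)%:C%C.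

Lemma expi_taylor_cvg y : expi_taylor n y @[n --> \oo] --> expi y.
Proof.
have RE n : complex.Re (expi_taylor n y) = series (cos_coeff y) n.
  rewrite /expi_taylor /series /=; elim/big_ind2 : _ => [//|a b c d <- <-|k _].
    by rewrite cReD.
  by rewrite cReM iX /= mulr0 subr0 /cos_coeff.
have IE n : complex.Im (expi_taylor n y) = series (sin_coeff y) n.
  rewrite /expi_taylor /series /=; elim/big_ind2 : _ => [//|a b c d <- <-|k _].
    by rewrite cImD.
  by rewrite cImM iX /= mulr0 add0r /sin_coeff.
apply: complex_cvg_ReIm.
- under eq_cvg do rewrite RE.
  have -> : complex.Re (expi y) = limn (series (cos_coeff y)) by rewrite /= unlock.
  exact: is_cvg_series_cos_coeff.
- under eq_cvg do rewrite IE.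
  have -> : complex.Im (expi y) = limn (series (sin_coeff y)) by rewrite /= unlock.
  exact: is_cvg_series_sin_coeff.
Qed.

(** The remainder is dominated by the tail of the exponential series, whatever
    the sign pattern of the powers of i. *)
Lemma normc_expi_taylor n y (B : R) : `|y| <= B ->
  normc (expi y - expi_taylor n y) <= expR B - expsum n B.
Proof.
move=> yB; have B0 : 0 <= B by rewrite (le_trans _ yB).
apply: (@normc_lim_le _ _ _ _ _ n (@expi_taylor_cvg y)) => m nm.
rewrite /expi_taylor (big_cat_nat (leq0n n) nm)//= addrAC subrr add0r.
rewrite (le_trans (normc_sum _ _ _))//.
apply: (@le_trans _ _ (expsum m B - expsum n B)); last first.
  by rewrite lerB// expsum_le.
rewrite /expsum [X in _ <= X - _](big_cat_nat (leq0n n) nm)//= addrAC subrr add0r.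
apply: ler_sum => k _; rewrite normcM normcX normc_real.
rewrite ger0_norm ?invr_ge0// ler_wpM2r ?invr_ge0//.
rewrite (_ : normc _ = `|y|) ?lerXn2r ?nnegrE//.
by rewrite /= expr0n add0r sqrtr_sqr.
Qed.

Lemma expi_taylor_unif (B e : R) : 0 <= B -> 0 < e -> exists n, (0 < n)%N /\
  forall y, `|y| <= B -> normc (expi y - expi_taylor n y) <= e.
Proof.
move=> B0 e0; have /cvgrPdist_lt/(_ _ e0)[N _ hN] := @expsum_cvg B.
exists N.+1; split=> // y yB; rewrite (le_trans (normc_expi_taylor _ yB))//.
by have /ltW := hN N.+1 (leqnSn N); rewrite ger0_norm// subr_ge0 expsum_le.
Qed.

End ExponentialTaylor.

(** * Functions majorized by an exponential *)

Section Majorants.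
Variable R : realType.
Implicit Types (f g : R -> R[i]) (s t x : R) (p q : {poly R[i]}).

Definition majorized_poly s q : Prop :=
  q`_0 = 1 /\ forall m, normc q`_m <= s ^+ m / m`!%:R.

(** Up to locally uniform limits, [f] has a power series with value one at the
    origin whose coefficients are dominated by those of [exp (s x)]. Polynomial
    approximants are used instead of the series itself so that products and
    limits need no rearrangement of infinite sums. *)
Definition majorized f s : Prop := forall A e, 0 < e ->
  exists2 q, majorized_poly s q &
    forall x, `|x| <= A -> normc (f x - q.[x%:C%C]) <= e.

(** By the binomial formula: exp(sx) exp(tx) = exp((s + t)x), coefficientwise. *)
Lemma majorized_polyM s t p q : 0 <= s -> 0 <= t ->
  majorized_poly s p -> majorized_poly t q -> majorized_poly (s + t) (p * q).
Proof.
move=> s0 t0 [p0 ps] [q0 qt]; split=> [|m].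
  by rewrite coefM big_ord_recl big_ord0 p0 q0 mulr1 addr0.
rewrite coefM (le_trans (normc_sum _ _ _))//.
rewrite addrC exprDn mulr_suml; apply: ler_sum => j _.
have jm : (j <= m)%N by rewrite -ltnS.
rewrite normcM; apply: (@le_trans _ _ (s ^+ j / j`!%:R * (t ^+ (m - j) / (m - j)`!%:R))).
  by apply: ler_pM; rewrite ?normc_ge0.
rewrite -(bin_fact jm) -mulr_natr !natrM.
have f0 n : n`!%:R != 0 :> R by rewrite pnatr_eq0 -lt0n fact_gt0.
have b0 : 'C(m, j)%:R != 0 :> R by rewrite pnatr_eq0 -lt0n bin_gt0.
rewrite le_eqVlt; apply/orP; left; apply/eqP; field.
by rewrite !f0 b0.
Qed.

Lemma majorized_horner s q x : 0 <= s -> majorized_poly s q ->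
  normc (q.[x%:C%C] - 1) <= expR (s * `|x|) - 1.
Proof.
move=> s0 [q0 qs].
have sx0 : 0 <= s * `|x| by rewrite mulr_ge0.
have sz : (size q <= (size q).+1)%N by [].
rewrite (horner_coef_wide _ sz) big_ord_recl q0 expr0 mulr1 addrAC subrr add0r.
apply: (@le_trans _ _ (expsum (size q).+1 (s * `|x|) - 1)); last first.
  by rewrite lerB// expsum_le.
rewrite /expsum big_mkord big_ord_recl expr0 fact0 divr1 addrAC subrr add0r.
rewrite (le_trans (normc_sum _ _ _))//; apply: ler_sum => m _.
by rewrite normcM normcX normc_real exprMn mulrAC ler_wpM2r ?exprn_ge0.
Qed.

Lemma majorized_le s t f : 0 <= s -> s <= t -> majorized f s -> majorized f t.
Proof.
move=> s0 st fs A e /(fs A)[q [q0 qs] qf]; exists q => //; split=> // m.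
rewrite (le_trans (qs m))// ler_wpM2r ?invr_ge0// lerXn2r// nnegrE//.
exact: le_trans st.
Qed.

Lemma majorized1 : majorized (fun=> 1) 0.
Proof.
move=> A e e0; exists 1; last by move=> x _; rewrite hornerC subrr normc0 ltW.
split=> [|m]; rewrite coef1// expr0n.
by case: m => [|m]; rewrite ?fact0 ?normc1 ?divr1// normc0 mul0r.
Qed.

Lemma majorized_limit f s :
  (forall A e, 0 < e -> exists2 g, majorized g s &
     forall x, `|x| <= A -> normc (f x - g x) <= e) -> majorized f s.
Proof.
move=> h A e e0; have e2 : 0 < e / 2 by rewrite divr_gt0.
have [g gs fg] := h A _ e2; have [q qs gq] := gs A _ e2.
exists q => // x xA; rewrite -[f x - _](subrKA (g x)).
by rewrite (le_trans (le_normcD _ _))// [e]splitr lerD ?fg ?gq.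
Qed.

Lemma majorized_near1 f s x : 0 <= s -> majorized f s ->
  normc (f x - 1) <= expR (s * `|x|) - 1.
Proof.
move=> s0 fs; apply/ler_addgt0Pr => e e0.
have [q qs qf] := fs `|x| _ e0.
rewrite -[f x - 1](subrKA q.[x%:C%C]) (le_trans (le_normcD _ _))// addrC lerD//.
  exact: majorized_horner.
exact: qf.
Qed.

Lemma majorized_bound f s x : 0 <= s -> majorized f s ->
  normc (f x) <= expR (s * `|x|).
Proof.
move=> s0 fs; rewrite -[f x](subrK 1) (le_trans (le_normcD _ _))//.
by rewrite normc1 -lerBrDr; exact: majorized_near1.
Qed.

Lemma majorizedM f g s t : 0 <= s -> 0 <= t ->
  majorized f s -> majorized g t -> majorized (fun x => f x * g x) (s + t).
Proof.
move=> s0 t0 fs gt A e e0.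
pose B := expR (s * `|A|) + expR (t * `|A|).
have B0 : 0 < B by rewrite addr_gt0// expR_gt0.
have eB : 0 < e / B by rewrite divr_gt0.
have [p ps fp] := fs A _ eB; have [q qt gq] := gt A _ eB.
exists (p * q); first exact: majorized_polyM.
move=> x xA; rewrite hornerM.
have xA' : `|x| <= `|A| by rewrite (le_trans xA)// ler_norm.
rewrite (_ : _ - _ = (f x - p.[x%:C%C]) * g x + p.[x%:C%C] * (g x - q.[x%:C%C])); last by ring.
rewrite (le_trans (le_normcD _ _))// !normcM.
rewrite -[e](divfK (lt0r_neq0 B0)) mulrDr addrC.
apply: lerD.
  rewrite mulrC; apply: ler_pM; rewrite ?normc_ge0 ?gq//.
  rewrite -[p.[_]](subrK 1) (le_trans (le_normcD _ _))// normc1 -lerBrDr.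
  by rewrite (le_trans (majorized_horner _ s0 ps))// lerB// ler_expR ler_wpM2l.
apply: ler_pM; rewrite ?normc_ge0 ?fp//.
by rewrite (le_trans (majorized_bound x t0 gt))// ler_expR ler_wpM2l.
Qed.

Lemma majorizedJ f s : majorized f s -> majorized (fun x => (f x)^*%C) s.
Proof.
move=> fs A e /(fs A)[q [q0 qs] qf].
exists (map_poly (@conjc R) q).
  by split=> [|m]; rewrite coef_map/= ?q0 ?conjc1// normc_conj.
move=> x /qf; rewrite -(normc_conj (_ - _)) rmorphB/=.
by rewrite -[in X in _ -> X](conjc_real x) horner_map.
Qed.

End Majorants.

Section TrigonometricPolynomials.
Variable R : realType.
Implicit Types (a : trigpoly R) (x : R).

Definition centered_sum (D : nat) (c : nat -> R[i]) (x : R) : R[i] :=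
  \sum_(n < (2 * D).+1) c n * expi (- ((n%:Z - D%:Z)%:~R * x)).

(** Writing the frequencies as n - D with 0 <= n <= 2D makes them nonnegative up
    to a factor of modulus one, the form required by bernstein_pos. *)
Definition centered_coef a (n : nat) : R[i] :=
  let k := (n%:Z - (tp_deg a)%:Z)%R in
  if (tp_lo a <= k <= tp_hi a)%R then tp_coef a k else 0.

Lemma tp_eval_centered a x :
  a x = centered_sum (tp_deg a) (centered_coef a) x.
Proof.
pose D := tp_deg a; have le := tp_le a.
have loD : (`|tp_lo a| <= D)%N by rewrite leq_maxl.
have hiD : (`|tp_hi a| <= D)%N by rewrite leq_maxr.
pose n0 := `|(tp_lo a + D%:Z)%R|%N; pose n1 := `|(tp_hi a - tp_lo a)%R|%N.
have n0E : (n0%:Z = tp_lo a + D%:Z)%R by rewrite /n0; lia.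
have n1E : (n1%:Z = tp_hi a - tp_lo a)%R by rewrite /n1; lia.
have n01 : (n0 + n1.+1 <= (2 * D).+1)%N by lia.
pose F n := centered_coef a n * expi (- ((n%:Z - D%:Z)%:~R * x)).
rewrite /centered_sum -/D -(big_mkord xpredT F).
rewrite (big_cat_nat (leq0n (n0 + n1.+1)) n01)/= [X in _ + X]big_nat_cond.
rewrite [X in _ + X]big1 => [|n]; last first.
  rewrite andbT => /andP[h _]; rewrite /F /centered_coef -/D.
  by rewrite ifF ?mul0r//; apply/negP => /andP[]; lia.
rewrite addr0 (big_cat_nat (leq0n n0) (leq_addr _ _))/= [X in X + _]big_nat_cond.
rewrite [X in X + _]big1 => [|n]; last first.
  rewrite andbT => /andP[_ h]; rewrite /F /centered_coef -/D.
  by rewrite ifF ?mul0r//; apply/negP => /andP[]; lia.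
rewrite add0r -{1}[n0]add0n big_addn addKn /tp_eval -/n1.
apply: eq_big_nat => n /andP[_ nn1]; rewrite /F /centered_coef -/D.
have -> : ((n + n0)%:Z - D%:Z = tp_lo a + n%:Z)%R by lia.
by rewrite ifT//; apply/andP; split; lia.
Qed.

(** As n - D is the difference of n, at most 2D, and of D, each
    differentiation costs 2D + D = 3D. *)
Lemma bernstein_iter (D : nat) (c : nat -> R[i]) (M : R) m :
  (forall x, normc (centered_sum D c x) <= M) ->
  forall x, normc (centered_sum D (fun n => (n%:Z - D%:Z)%:~R ^+ m * c n) x)
    <= (3 * D)%:R ^+ m * M.
Proof.
move=> cM; elim: m => [|m ih] x.
  rewrite expr0 mul1r (_ : centered_sum _ _ x = centered_sum D c x)//.
  by apply: eq_bigr => n _; rewrite expr0 mul1r.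
set b := (fun n => (n%:Z - D%:Z)%:~R ^+ m * c n) in ih.
have [D0|D0] := posnP D.
  rewrite /centered_sum D0 muln0 big_ord1 exprS subrr mul0r mul0r mul0r normc0.
  by rewrite muln0 exprS !mul0r.
have shift (c' : nat -> R[i]) y : centered_sum D c' y =
    expi (D%:R * y) * \sum_(n < (2 * D).+1) c' n * expi (- (n%:R * y)).
  rewrite mulr_sumr; apply: eq_bigr => n _; rewrite mulrCA -expiD.
  by congr (_ * expi _); rewrite intrB -!pmulrn; ring.
have bB y : normc (\sum_(n < (2 * D).+1) b n * expi (- (n%:R * y))) <=
    (3 * D)%:R ^+ m * M.
  by have := ih y; rewrite shift normcM normc_expi mul1r.
have D2 : (0 < 2 * D)%N by rewrite muln_gt0.
have h1 : normc (centered_sum D (fun n => n%:R * b n) x) <=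
    (2 * D)%:R * ((3 * D)%:R ^+ m * M).
  by rewrite shift normcM normc_expi mul1r; exact: bernstein_pos.
have -> : centered_sum D (fun n => (n%:Z - D%:Z)%:~R ^+ m.+1 * c n) x =
    centered_sum D (fun n => n%:R * b n) x - D%:R * centered_sum D b x.
  rewrite /centered_sum mulr_sumr -sumrB; apply: eq_bigr => n _.
  by rewrite exprS /b intrB -!pmulrn; ring.
rewrite (le_trans (normcB _ _))// normcM normc_nat.
have := ih x; have D1 : (0 : R) <= D%:R by [].
move=> /(ler_wpM2l D1) h2; rewrite (le_trans (lerD h1 h2))//.
rewrite exprS -mulrA -mulrDl -natrD; rewrite (_ : (2 * D + D = 3 * D)%N)//; lia.
Qed.

(** Bernstein's inequality bounds the Taylor coefficients of [a] at the origin;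
    [1 <= M] since [a 0 = 1], whence [M <= M ^ m] for [m > 0]. *)
Lemma majorized_trigpoly a (M lam : R) : a 0 = 1 ->
  (forall x, normc (a x) <= M) ->
  majorized (fun x => a (lam * x)) (3 * (`|lam| * (tp_deg a)%:R * M)).
Proof.
move=> a0 aM; pose D := tp_deg a; pose c := centered_coef a.
have aE x : a x = centered_sum D c x by exact: tp_eval_centered.
have M1 : 1 <= M by rewrite -(normc1 R) -a0.
have M0 : 0 <= M by rewrite (le_trans _ M1).
pose C := \sum_(n < (2 * D).+1) normc (c n).
have C0 : 0 <= C by apply: sumr_ge0 => n _; exact: normc_ge0.
move=> A e e0; pose B := D%:R * (`|lam| * `|A|).
have B0 : 0 <= B by rewrite !mulr_ge0.
have eC : 0 < e / (C + 1) by rewrite divr_gt0// ltr_wpDl.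
have [K [K0 KP]] := expi_taylor_unif B0 eC.
pose v (n : nat) : R := - ((n%:Z - D%:Z)%:~R * lam).
pose q : {poly R[i]} := \poly_(m < K)
  (\sum_(n < (2 * D).+1) c n * (Complex 0 (v n)) ^+ m * (m`!%:R^-1)%:C%C).
have qE x : q.[x%:C%C] = \sum_(n < (2 * D).+1) c n * expi_taylor K (v n * x).
  rewrite horner_poly.
  under eq_bigr do rewrite mulr_suml.
  rewrite exchange_big /=; apply: eq_bigr => n _.
  rewrite /expi_taylor big_mkord mulr_sumr; apply: eq_bigr => m _.
  have -> : Complex 0 (v n * x) = Complex 0 (v n) * x%:C%C :> R[i].
    by apply/eqP; rewrite eq_complex/= !mul0r !mulr0 ?subr0 ?addr0 ?add0r !eqxx.
  by rewrite exprMn; ring.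
(* q replaces each exponential by its Taylor polynomial *)
exists q; last first.
  move=> x xA; rewrite aE qE /centered_sum -sumrB.
  under eq_bigr do rewrite -mulrBr.
  rewrite (le_trans (normc_sum _ _ _))//.
  apply: (@le_trans _ _ (\sum_(n < (2 * D).+1) normc (c n) * (e / (C + 1)))).
    apply: ler_sum => n _; rewrite normcM ler_wpM2l ?normc_ge0//.
    rewrite (_ : - _ = v n * x); last by rewrite /v; ring.
    apply: KP; rewrite /v !normrM normrN !normrM -!mulrA.
    apply: ler_pM => //; last first.
      by rewrite ler_wpM2l// (le_trans xA)// ler_norm.
    rewrite -intr_norm -[D%:R]/(D%:Z%:~R) ler_int.
    by have := ltn_ord n; lia.
  rewrite -mulr_suml -/C mulrCA ger_pMr// ler_pdivrMr ?mul1r ?lerDl//.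
  by rewrite ltr_wpDl.
have coef_bound m : normc (\sum_(n < (2 * D).+1)
    c n * (Complex 0 (v n)) ^+ m * (m`!%:R^-1)%:C%C) <=
    (3 * (`|lam| * D%:R)) ^+ m * M / m`!%:R.
  rewrite -mulr_suml normcM normc_real ger0_norm ?invr_ge0// ler_wpM2r ?invr_ge0//.
  have -> : \sum_(n < (2 * D).+1) c n * (Complex 0 (v n)) ^+ m =
     (Complex 0 (- lam)) ^+ m *
       centered_sum D (fun n => (n%:Z - D%:Z)%:~R ^+ m * c n) 0.
    rewrite /centered_sum mulr_sumr; apply: eq_bigr => n _.
    rewrite mulr0 oppr0 expi0 mulr1.
    have -> : Complex 0 (v n) = Complex 0 (- lam) * (n%:Z - D%:Z)%:~R :> R[i].
      rewrite -(rmorph_int (real_complex R)); apply/eqP; rewrite eq_complex/=.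
      by rewrite /v !mul0r !mulr0 subr0 add0r eqxx/= mulNr mulrC.
    by rewrite exprMn; ring.
  rewrite normcM normcX (_ : normc _ = `|lam|); last first.
    by rewrite /= expr0n add0r sqrtr_sqr normrN.
  have := @bernstein_iter D c M m _ 0; rewrite natrM exprMn => h.
  rewrite [X in _ <= X * M](_ : _ = `|lam| ^+ m * (3 ^+ m * D%:R ^+ m)).
    by rewrite -mulrA ler_wpM2l ?exprn_ge0// h// => x; rewrite -aE.
  by rewrite !exprMn; ring.
have coef0 : \sum_(n < (2 * D).+1)
    c n * (Complex 0 (v n)) ^+ 0 * (0`!%:R^-1)%:C%C = 1.
  rewrite -(a0) aE; apply: eq_bigr => n _.
  by rewrite expr0 fact0 invr1 !mulr1 mulr0 oppr0 expi0 mulr1.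
split; first by rewrite coef_poly K0.
move=> m; rewrite coef_poly; case: ifP => mK; last first.
  by rewrite normc0 divr_ge0// exprn_ge0// !mulr_ge0.
case: m mK => [_|m mK]; first by rewrite coef0 normc1 expr0 fact0 divr1.
rewrite (le_trans (coef_bound _))// ler_wpM2r ?invr_ge0//.
rewrite [in X in _ <= X]mulrA [in X in _ <= X]exprMn ler_wpM2l ?exprn_ge0 ?mulr_ge0//.
by rewrite exprS ler_peMr// exprn_ege1.
Qed.

End TrigonometricPolynomials.

(** * Continuous complex functions *)

Section Continuity.
Variable R : realType.
Implicit Types (f g : R -> R[i]) (q : {poly R[i]}).

Definition ccontinuous f : Prop :=
  continuous (fun x => complex.Re (f x)) /\ continuous (fun x => complex.Im (f x)).

Lemma ccontinuousP f : ccontinuous f <-> forall x e, 0 < e ->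
  exists2 d, 0 < d & forall y, `|y - x| < d -> normc (f y - f x) < e.
Proof.
split=> [[cR cI] x e e0|h].
- have e2 : 0 < e / 2 by rewrite divr_gt0.
  have /cvgrPdist_lt/(_ _ e2)/nbhs_ballP[d1 /= d10 h1] := cR x.
  have /cvgrPdist_lt/(_ _ e2)/nbhs_ballP[d2 /= d20 h2] := cI x.
  exists (Num.min d1 d2); first by rewrite lt_min d10.
  move=> y; rewrite lt_min => /andP[y1 y2].
  rewrite (le_lt_trans (normc_le_ReIm _))// !(cReD, cImD, cReN, cImN) [e]splitr.
  by rewrite ltrD// distrC; [apply: h1|apply: h2]; rewrite /ball/= distrC.
- split=> x; apply/cvgrPdist_lt => e /(h x)[d d0 hd]; apply/nbhs_ballP;
    exists d => //= y; rewrite /ball/= distrC => /hd; apply: le_lt_trans;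
    rewrite distrC.
  + by rewrite -cReN -cReD Re_le_normc.
  + by rewrite -cImN -cImD Im_le_normc.
Qed.

Lemma ccontinuousM f g : ccontinuous f -> ccontinuous g ->
  ccontinuous (fun x => f x * g x).
Proof.
move=> [fR fI] [gR gI]; split=> x.
- under eq_fun do rewrite cReM.
  by apply: cvgB; apply: cvgM; [exact: fR|exact: gR|exact: fI|exact: gI].
- under eq_fun do rewrite cImM.
  by apply: cvgD; apply: cvgM; [exact: fR|exact: gI|exact: fI|exact: gR].
Qed.

Lemma ccontinuousD f g : ccontinuous f -> ccontinuous g ->
  ccontinuous (fun x => f x + g x).
Proof.
move=> [fR fI] [gR gI]; split=> x.
- under eq_fun do rewrite cReD.
  by apply: cvgD; [exact: fR|exact: gR].
- under eq_fun do rewrite cImD.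
  by apply: cvgD; [exact: fI|exact: gI].
Qed.

Lemma ccontinuous_cst (z : R[i]) : ccontinuous (fun=> z).
Proof. by split=> x; exact: cvg_cst. Qed.

Lemma ccontinuous_real (h : R -> R) : continuous h ->
  ccontinuous (fun x => (h x)%:C%C).
Proof. by move=> hc; split=> x; [exact: hc|exact: cvg_cst]. Qed.

Lemma ccontinuous_comp f (h : R -> R) : continuous h -> ccontinuous f ->
  ccontinuous (fun x => f (h x)).
Proof.
move=> hc [fR fI]; split=> x.
- by apply: (@continuous_comp _ _ _ h (fun y => complex.Re (f y))); [exact: hc|exact: fR].
- by apply: (@continuous_comp _ _ _ h (fun y => complex.Im (f y))); [exact: hc|exact: fI].
Qed.

Lemma ccontinuous_sum I (r : seq I) (F : I -> R -> R[i]) :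
  (forall i, ccontinuous (F i)) -> ccontinuous (fun x => \sum_(i <- r) F i x).
Proof.
move=> h; elim: r => [|i r ih].
  by under eq_fun do rewrite big_nil; exact: ccontinuous_cst.
by under eq_fun do rewrite big_cons; exact: ccontinuousD.
Qed.

Lemma ccontinuous_expi : ccontinuous (@expi R).
Proof. by split=> x; [exact: continuous_cos|exact: continuous_sin]. Qed.

Lemma ccontinuous_expi_lin (k : R) : ccontinuous (fun x => expi (k * x)).
Proof.
apply: (ccontinuous_comp _ ccontinuous_expi) => x.
exact: mulrl_continuous.
Qed.

Lemma ccontinuous_horner q : ccontinuous (fun x : R => q.[x%:C%C]).
Proof.
rewrite (_ : (fun x : R => q.[x%:C%C]) =
  (fun x => \sum_(i < size q) q`_i * (x ^+ i)%:C%C)); last first.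
  by apply/funext => x; rewrite horner_coef; under eq_bigr do rewrite -rmorphXn.
apply: ccontinuous_sum => i; apply: ccontinuousM; first exact: ccontinuous_cst.
by apply: ccontinuous_real; exact: exprn_continuous.
Qed.

(** A locally uniform limit of polynomials. *)
Lemma ccontinuous_majorized f (s : R) : majorized f s -> ccontinuous f.
Proof.
move=> fs; apply/ccontinuousP => x e e0.
have e4 : 0 < e / 4 by rewrite divr_gt0.
have [q _ qf] := fs (`|x| + 1) _ e4.
have /ccontinuousP/(_ x _ e4)[d d0 hd] := ccontinuous_horner q.
exists (Num.min d 1) => [|y]; first by rewrite lt_min d0/=.
rewrite lt_min => /andP[/hd yd y1].
have hy : normc (f y - q.[y%:C%C]) <= e / 4.
  apply: qf; rewrite -[y](subrK x) (le_trans (ler_normD _ _))// addrC lerD2l.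
  exact: ltW.
have hx : normc (f x - q.[x%:C%C]) <= e / 4 by apply: qf; rewrite lerDl.
rewrite -[f y - f x](subrKA q.[y%:C%C]) -[q.[_] - f x](subrKA q.[x%:C%C]).
rewrite (le_lt_trans (le_normcD _ _))//.
have := le_normcD (q.[y%:C%C] - q.[x%:C%C]) (q.[x%:C%C] - f x).
rewrite (normcBC _ (f x)); lra.
Qed.

Lemma ccontinuous_trigpoly (a : trigpoly R) : ccontinuous a.
Proof.
apply: ccontinuous_sum => n; apply: ccontinuousM; first exact: ccontinuous_cst.
under eq_fun do rewrite -mulNr.
exact: ccontinuous_expi_lin.
Qed.

End Continuity.

(** * Infinite products of majorized functions *)

Section InfiniteProducts.
Variables (R : realType) (p : nat -> R -> R[i]) (s : nat -> R).
Hypothesis s_ge0 : forall n, 0 <= s n.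
Hypothesis p_maj : forall n, (0 < n)%N -> majorized (p n) (s n).
Let sigma N := \sum_(1 <= n < N.+1) s n.
Hypothesis s_cvg : cvgn sigma.
Implicit Types (j N K : nat) (y : R).

Definition partial_prod j y N : R[i] := \prod_(1 <= n < N.+1) p (j + n)%N y.

(** The exponent of the tail of the product after its first j factors. *)
Definition tail_sum j : R := limn sigma - sigma j.

Definition inf_prod j y : R[i] := limn (partial_prod j y).

Let sigma_le j N : (j <= N)%N -> sigma j <= sigma N.
Proof.
have /nondecreasing_seqP h : forall n, sigma n <= sigma n.+1.
  by move=> n; rewrite /sigma [leRHS]big_nat_recr//= lerDl.
exact: h.
Qed.

Let sigma_lim j : sigma j <= limn sigma.
Proof. by apply: nondecreasing_cvgn_le => // a b; exact: sigma_le. Qed.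

Lemma tail_sum_ge0 j : 0 <= tail_sum j.
Proof. by rewrite subr_ge0. Qed.

Lemma tail_sum_cvg : tail_sum j @[j --> \oo] --> 0.
Proof.
rewrite -[0](subrr (limn sigma)); apply: cvgB => //; exact: cvg_cst.
Qed.

Lemma partial_prodS j y N :
  partial_prod j y N.+1 = partial_prod j y N * p (j + N.+1)%N y.
Proof. by rewrite /partial_prod big_nat_recr. Qed.

Lemma partial_prodD j y N K :
  partial_prod j y (N + K) = partial_prod j y N * partial_prod (j + N) y K.
Proof.
elim: K => [|K ih]; first by rewrite addn0 /partial_prod [in X in _ * X]big_geq// mulr1.
by rewrite addnS !partial_prodS ih -mulrA -[(j + N + K.+1)%N]addnA !addnS.
Qed.

Lemma partial_prod_majorized j N :
  majorized (fun y => partial_prod j y N) (tail_sum j).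
Proof.
suff h : majorized (fun y => partial_prod j y N) (sigma (j + N) - sigma j).
  by apply: (majorized_le _ _ h); rewrite ?subr_ge0 ?sigma_le ?leq_addr// lerB.
elim: N => [|N ih].
  rewrite addn0 subrr (_ : (fun y => _) = fun=> 1); first exact: majorized1.
  by apply/funext => y; rewrite /partial_prod big_geq.
rewrite addnS {1}/sigma big_nat_recr//= -/(sigma _) addrAC.
under eq_fun do rewrite partial_prodS.
apply: majorizedM => //; first by rewrite subr_ge0 sigma_le// leq_addr.
by rewrite addnS; exact: p_maj.
Qed.

(** The difference is the first N factors times (the next K factors - 1); both
    are controlled by their majorants. *)
Lemma partial_prod_cauchy j N K y :
  normc (partial_prod j y (N + K) - partial_prod j y N) <=
  expR (tail_sum j * `|y|) * (expR (tail_sum (j + N) * `|y|) - 1).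
Proof.
rewrite partial_prodD -{2}[partial_prod j y N]mulr1 -mulrBr normcM.
apply: ler_pM; rewrite ?normc_ge0//.
  exact: majorized_bound (tail_sum_ge0 _) (partial_prod_majorized _ _).
exact: majorized_near1 (tail_sum_ge0 _) (partial_prod_majorized _ _).
Qed.

Lemma prod_tail_small j (A e : R) : 0 < e -> exists N, forall N', (N <= N')%N ->
  expR (tail_sum j * A) * (expR (tail_sum (j + N') * A) - 1) <= e.
Proof.
move=> e0.
have : expR (tail_sum j * A) * (expR (tail_sum (j + N) * A) - 1) @[N --> \oo] --> 0.
  rewrite -[0](mulr0 (expR (tail_sum j * A))); apply: cvgM; first exact: cvg_cst.
  rewrite -[X in _ --> X](subrr 1); apply: cvgB; last exact: cvg_cst.
  rewrite -[X in _ --> X]expR0.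
  apply: (@continuous_cvg _ _ _ _ _ (fun N => tail_sum (j + N) * A) (@expR R)).
    exact: continuous_expR.
  rewrite -[X in _ --> X](mul0r A); apply: cvgM; last exact: cvg_cst.
  rewrite (_ : (fun N => tail_sum (j + N)) = (fun N => tail_sum (N + j))).
    by rewrite cvg_shiftn; exact: tail_sum_cvg.
  by apply/funext => N; rewrite addnC.
move=> /cvgrPdist_lt/(_ _ e0)[N _ hN]; exists N => N' /hN.
by rewrite sub0r normrN => /ltW; apply: le_trans; exact: ler_norm.
Qed.

Lemma partial_prod_cvg j y : partial_prod j y @ \oo --> inf_prod j y.
Proof.
apply: complex_cauchy_cvg => e e0.
have [N hN] := prod_tail_small j `|y| e0; exists N => n.
by rewrite (le_trans (partial_prod_cauchy _ _ _ _))// hN.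
Qed.

Lemma inf_prod_tail j N y : normc (inf_prod j y - partial_prod j y N) <=
  expR (tail_sum j * `|y|) * (expR (tail_sum (j + N) * `|y|) - 1).
Proof.
apply: (@normc_lim_le _ _ _ _ _ N (@partial_prod_cvg j y)) => n Nn.
by rewrite -(subnKC Nn); exact: partial_prod_cauchy.
Qed.

Lemma inf_prod_split j N y :
  inf_prod j y = partial_prod j y N * inf_prod (j + N) y.
Proof.
apply: (@cvg_complex_unique _ (fun K => partial_prod j y (N + K))).
  rewrite (_ : (fun K => _) = (fun K => partial_prod j y (K + N))).
    by rewrite cvg_shiftn; exact: partial_prod_cvg.
  by apply/funext => K; rewrite addnC.
rewrite (_ : (fun K => _) = (fun K => partial_prod j y N * partial_prod (j + N) y K)).
  by apply: cvg_complexM; [exact: cvg_cst|exact: partial_prod_cvg].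
by apply/funext => K; rewrite partial_prodD.
Qed.

Lemma inf_prodS j y : inf_prod j y = p j.+1 y * inf_prod j.+1 y.
Proof.
by rewrite (inf_prod_split _ 1) /partial_prod big_nat1 addn1.
Qed.

Lemma inf_prod_majorized j : majorized (inf_prod j) (tail_sum j).
Proof.
apply: majorized_limit => A e e0.
have [N hN] := prod_tail_small j `|A| e0.
exists (fun y => partial_prod j y N); first exact: partial_prod_majorized.
move=> y yA; have yA' : `|y| <= `|A| by rewrite (le_trans yA)// ler_norm.
rewrite (le_trans (inf_prod_tail _ N _))// (le_trans _ (hN _ (leqnn N)))//.
have ts i : tail_sum i * `|y| <= tail_sum i * `|A|.
  by rewrite ler_wpM2l// tail_sum_ge0.
apply: ler_pM; rewrite ?expR_ge0 ?ler_expR ?lerB ?ler_expR//.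
by rewrite subr_ge0 -expR0 ler_expR mulr_ge0// tail_sum_ge0.
Qed.

(** On a bounded set the tail of the product is close to one, so that the
    product can only vanish where one of finitely many factors does. *)
Lemma inf_prod_zero j y : inf_prod j y = 0 -> exists2 n, (j < n)%N & p n y = 0.
Proof.
have h2 : (0 : R) < 2^-1 by rewrite invr_gt0.
have [N hN] : exists N, expR (tail_sum N * `|y|) - 1 < 1 /\ (j <= N)%N.
  have : expR (tail_sum N * `|y|) @[N --> \oo] --> (1 : R).
    rewrite -[X in _ --> X]expR0.
    apply: (@continuous_cvg _ _ _ _ _ (fun N => tail_sum N * `|y|) (@expR R)).
      exact: continuous_expR.
    rewrite -[X in _ --> X](mul0r `|y|); apply: cvgM; last exact: cvg_cst.
    exact: tail_sum_cvg.
  move=> /cvgrPdist_lt/(_ _ ltr01)[N _ hN]; exists (maxn N j).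
  split; last exact: leq_maxr.
  have := hN _ (leq_maxl N j); rewrite distrC; apply: le_lt_trans.
  exact: ler_norm.
case: hN => hN jN.
rewrite (inf_prod_split _ (N - j)) subnKC// => /eqP.
rewrite mulf_eq0 => /orP[|/eqP h0]; last first.
  have := majorized_near1 y (tail_sum_ge0 N) (inf_prod_majorized N).
  by rewrite h0 sub0r normcN normc1 => /le_lt_trans/(_ hN); rewrite ltxx.
rewrite prodf_seq_eq0 => /hasP[n]; rewrite mem_index_iota => /andP[n1 _] /= /eqP pn.
by exists (j + n)%N => //; rewrite -addn1 leq_add2l.
Qed.

End InfiniteProducts.

(** * The completed Lebesgue measure and affine maps *)

Section CompletedLebesgue.
Variable R : realType.
Local Open Scope ereal_scope.
Notation borel := (measurableTypeR R).
Notation T := (lebesgueType R).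
Notation mu := (@completed_lebesgue_measure R).

Lemma borel_lebesgue (A : set R) :
  (measurable : set (set borel)) A -> (measurable : set (set T)) A.
Proof. by move=> mA; exact: sub_caratheodory. Qed.

Lemma leb_borel (A : set R) : mu A = lebesgue_measure A.
Proof. by []. Qed.

(** Up to a null set a Lebesgue measurable set is Borel, and on Borel sets a
    measure is determined by its values on intervals. *)
Lemma lebesgue_split (A : set R) : (measurable : set (set T)) A ->
  exists X N : set R, [/\ (measurable : set (set borel)) X,
    (@lebesgue_measure R).-negligible N & A = X `|` N].
Proof.
rewrite -[X in X A](@completed_caratheodory_measurable R).
rewrite g_sigma_completed_algebra_genE => -[X mX [N nN] <-].
by exists X, N.
Qed.

(** The infinite cases agree because fine sends both infinities to zero. *)
Lemma fineZB (k : R) (P Q : \bar R) : (0 < k)%R ->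
  fine (k%:E * P - k%:E * Q) = (k * fine (P - Q))%R.
Proof.
move=> k0.
have ky : k%:E * +oo = +oo :> \bar R by rewrite gt0_muley// lte_fin.
have kNy : k%:E * -oo = -oo :> \bar R by rewrite gt0_muleNy// lte_fin.
case: P Q => [P| |] [Q| |]; rewrite ?ky ?kNy.
- by rewrite -!EFinM -!EFinB /= mulrBr.
all: by rewrite /= mulr0.
Qed.

Section Affine.
Variables (c t : R).
Hypothesis c0 : (c != 0)%R.
Let h (x : R) : R := (c * x + t)%R.

Let h_cont : continuous h.
Proof.
by move=> x; apply: (@cvgD _ _ _ _ _ (fun x => c * x)%R);
  [exact: mulrl_continuous|exact: cvg_cst].
Qed.

Let h_borel : measurable_fun [set: borel] (h : borel -> borel).
Proof. exact: continuous_measurable_fun. Qed.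

Let cn0 : (0 <= `|c|)%R. Proof. by []. Qed.

Let push : {measure set borel -> \bar R}.
Proof.
by unshelve refine [the {measure set borel -> \bar R} of
  pushforward (@lebesgue_measure R) (h : borel -> borel)]; exact: h_borel.
Defined.

(** The pushforward scaled by |c| has the measure of intervals of Lebesgue
    measure. *)
Lemma lebesgue_measure_affine (A : set R) : (measurable : set (set borel)) A ->
  lebesgue_measure (h @^-1` A) = (`|c|^-1)%:E * lebesgue_measure A.
Proof.
move=> mA.
suff -> : lebesgue_measure A = (`|c|)%:E * lebesgue_measure (h @^-1` A).
  by rewrite muleA -EFinM mulVf ?normr_eq0// mul1e.
rewrite -[RHS]/(mscale (NngNum cn0) push A).
apply: lebesgue_measure_unique => // _ [[a b]] /= _ <-.
rewrite /mscale/= /pushforward.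
have [c_gt0|c_lt0] := ltrP 0 c.
  have -> : h @^-1` `]a, b] = `]((a - t) / c)%R, ((b - t) / c)%R]%classic.
    apply/seteqP; split => x /=; rewrite !in_itv/= /h.
      by rewrite ltr_pdivrMr// ler_pdivlMr// (mulrC x) ltrBlDr lerBrDr.
    by rewrite ltr_pdivrMr// ler_pdivlMr// (mulrC x) ltrBlDr lerBrDr.
  rewrite !lebesgue_measure_itv/= !lte_fin ltr_pM2r ?invr_gt0// ltrD2r.
  case: ifP => _; last by rewrite mule0.
  rewrite -!EFinB -EFinM ger0_norm 1?ltW//; congr (_%:E).
  by field; rewrite gt_eqF.
have {}c_lt0 : (c < 0)%R by rewrite lt_neqAle c0.
have -> : h @^-1` `]a, b] = `[((b - t) / c)%R, ((a - t) / c)%R[%classic.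
  apply/seteqP; split => x /=; rewrite !in_itv/= /h.
    by rewrite ler_ndivrMr// ltr_ndivlMr// (mulrC x) ltrBlDr lerBrDr andbC.
  by rewrite ler_ndivrMr// ltr_ndivlMr// (mulrC x) ltrBlDr lerBrDr andbC.
rewrite !lebesgue_measure_itv/= !lte_fin ltr_nM2r ?invr_lt0// ltrD2r.
case: ifP => _; last by rewrite mule0.
rewrite -!EFinB -EFinM ltr0_norm//; congr (_%:E).
by field; rewrite lt_eqF.
Qed.

Lemma negligible_affine (N : set R) : (@lebesgue_measure R).-negligible N ->
  (@lebesgue_measure R).-negligible (h @^-1` N).
Proof.
move=> [B [mB B0 NB]]; exists (h @^-1` B); split.
- by rewrite -[X in measurable X]setTI; exact: h_borel.
- by rewrite lebesgue_measure_affine// B0 mule0.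
- by move=> x /NB.
Qed.

Lemma lebesgue_affine_measurable : measurable_fun [set: T] (h : T -> T).
Proof.
move=> _ A mA; rewrite setTI.
have [X [N [mX nN ->]]] := lebesgue_split mA.
rewrite preimage_setU; apply: measurableU.
  by apply: borel_lebesgue; rewrite -[X in measurable X]setTI; exact: h_borel.
have [B [mB B0 NB]] := negligible_affine nN.
apply: negligible_sub_caratheodory; exists B; split=> //.
exact: borel_lebesgue.
Qed.

Lemma leb_affine (A : set R) : (measurable : set (set T)) A ->
  mu (h @^-1` A) = (`|c|^-1)%:E * mu A.
Proof.
move=> mA; have [X [N [mX [B [mB B0 NB]] AE]]] := lebesgue_split mA.
have mhX : (measurable : set (set borel)) (h @^-1` X).
  by rewrite -[X in measurable X]setTI; exact: h_borel.
have mhA : (measurable : set (set T)) (h @^-1` A).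
  by rewrite -[X in measurable X]setTI; exact: lebesgue_affine_measurable.
have negE (Y Z W : set R) : (measurable : set (set T)) Y ->
    (measurable : set (set borel)) Z -> (measurable : set (set borel)) W ->
    Z `<=` Y -> Y `<=` Z `|` W -> lebesgue_measure W = 0 ->
    mu Y = lebesgue_measure Z.
  move=> mY mZ mW ZY YZW W0; apply/eqP; rewrite eq_le; apply/andP; split.
    apply: (@le_trans _ _ (mu (Z `|` W))).
      by apply: le_measure; rewrite ?inE//; apply: borel_lebesgue; exact: measurableU.
    rewrite (le_trans (@measureU2 _ _ _ mu Z W _ _))//; try exact: borel_lebesgue.
    by rewrite [X in _ + X](_ : _ = 0)// adde0.
  by rewrite -leb_borel; apply: le_measure; rewrite ?inE//; exact: borel_lebesgue.
rewrite (negE A X B)//; last by move=> x; rewrite AE => -[|/NB]; [left|right].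
  rewrite (negE (h @^-1` A) (h @^-1` X) (h @^-1` B))//.
  - exact: lebesgue_measure_affine.
  - by rewrite -[X in measurable X]setTI; exact: h_borel.
  - by rewrite AE => x; left.
  - by rewrite AE => x [|/NB]; [left|right].
  - by rewrite lebesgue_measure_affine// B0 mule0.
by rewrite AE => x; left.
Qed.

Lemma ge0_integral_affine (f : R -> \bar R) :
  measurable_fun [set: T] f -> (forall x, 0 <= f x) ->
  \int[mu]_x f (c * x + t)%R = (`|c|^-1)%:E * \int[mu]_x f x.
Proof.
move=> mf f0.
have ic0 : (0 <= `|c|^-1)%R by rewrite invr_ge0.
have := @ge0_integral_pushforward _ _ T T R h lebesgue_affine_measurable mu
  setT f measurableT mf (fun x _ => f0 x).
rewrite preimage_setT => <-.
rewrite -(ge0_integral_mscale mu measurableT (NngNum ic0))//.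
apply: eq_measure_integral => [|mh A mA _]; first exact: lebesgue_affine_measurable.
exact: leb_affine.
Qed.

Lemma Rintegral_affine (f : R -> R) : measurable_fun [set: T] f ->
  (\int[mu]_x f (c * x + t) = `|c|^-1 * \int[mu]_x f x)%R.
Proof.
move=> mf; rewrite /Rintegral.
have mf' : measurable_fun [set: T] (EFin \o f) by exact/measurable_EFinP.
set P := \int[mu]_x (EFin \o f)^\+ x; set Q := \int[mu]_x (EFin \o f)^\- x.
have fPQ : \int[mu]_x (f x)%:E = P - Q by exact: integralE.
have hP : \int[mu]_x ((EFin \o f)^\+ \o h) x = (`|c|^-1)%:E * P.
  have := @ge0_integral_affine (EFin \o f)^\+ (measurable_funepos mf').
  by apply => x; exact: funepos_ge0.
have hQ : \int[mu]_x ((EFin \o f)^\- \o h) x = (`|c|^-1)%:E * Q.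
  have := @ge0_integral_affine (EFin \o f)^\- (measurable_funeneg mf').
  by apply => x; exact: funeneg_ge0.
have hPQ : \int[mu]_x (f (c * x + t)%R)%:E = (`|c|^-1)%:E * P - (`|c|^-1)%:E * Q.
  rewrite -hP -hQ -funepos_comp -funeneg_comp; exact: integralE.
rewrite fPQ hPQ; clearbody P Q.
by rewrite fineZB// invr_gt0 normr_gt0.
Qed.

End Affine.

End CompletedLebesgue.

(** * Integration of real functions *)

Section RealIntegrals.
Variable R : realType.
Notation T := (lebesgueType R).
Notation mu := (@completed_lebesgue_measure R).
Implicit Types (F G : R -> R) (A c t : R).

Definition lmeasurable F : Prop := measurable_fun [set: T] (F : T -> R).
Definition lintegrable F : Prop := mu.-integrable [set: T] (fun x => (F x)%:E).

Lemma lintegrable_measurable F : lintegrable F -> lmeasurable F.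
Proof. by move=> /measurable_int /measurable_EFinP. Qed.

Lemma continuous_lmeasurable F : continuous F -> lmeasurable F.
Proof.
move=> cF _ B mB; apply: borel_lebesgue.
exact: (continuous_measurable_fun cF).
Qed.

Lemma lmeasurable_affine F c t : c != 0 -> lmeasurable F ->
  lmeasurable (fun x => F (c * x + t)).
Proof.
move=> c0 mF; apply: (measurableT_comp mF).
exact: lebesgue_affine_measurable.
Qed.

Lemma lmeasurable_continuous_comp F G : continuous G -> lmeasurable F ->
  lmeasurable (fun x => G (F x)).
Proof.
move=> cG mF; have mG := continuous_measurable_fun cG.
exact: (measurableT_comp mG mF).
Qed.

Lemma lmeasurableM F G : lmeasurable F -> lmeasurable G ->
  lmeasurable (fun x => F x * G x).
Proof. by move=> mF mG; exact: (@measurable_funM _ T R setT F G mF mG). Qed.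

Lemma lmeasurableD F G : lmeasurable F -> lmeasurable G ->
  lmeasurable (fun x => F x + G x).
Proof. by move=> mF mG; exact: (@measurable_funD _ T R setT F G mF mG). Qed.

Lemma lmeasurableB F G : lmeasurable F -> lmeasurable G ->
  lmeasurable (fun x => F x - G x).
Proof. by move=> mF mG; exact: (@measurable_funB _ T R setT F G mF mG). Qed.

Lemma lintegrable_le F G : lmeasurable F -> lintegrable G ->
  (forall x, `|F x| <= G x) -> lintegrable F.
Proof.
move=> mF iG FG.
have mF' : measurable_fun [set: T] (fun x => (F x)%:E) by exact/measurable_EFinP.
have FG' (x : T) : [set: T] x -> (`|(F x)%:E| <= `|(G x)%:E|)%E.
  by move=> _; rewrite /= lee_fin (le_trans (FG x))// ler_norm.
exact: (@le_integrable _ T R mu setT measurableT _ _ mF' FG' iG).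
Qed.

Lemma lintegrableD F G : lintegrable F -> lintegrable G ->
  lintegrable (fun x => F x + G x).
Proof. by move=> iF iG; exact: (integrableD measurableT iF iG). Qed.

Lemma lintegrableZ F k : lintegrable F -> lintegrable (fun x => k * F x).
Proof. by move=> iF; exact: (integrableZl measurableT k iF). Qed.

Lemma lintegrable_affine F c t : c != 0 -> lintegrable F ->
  lintegrable (fun x => F (c * x + t)).
Proof.
move=> c0 iF; have mF := lintegrable_measurable iF.
apply/integrableP; split.
  exact/measurable_EFinP/lmeasurable_affine.
have mF' : measurable_fun [set: T] (fun x => `|(F x)%:E|%E).
  by apply: (measurableT_comp (@abse_measurable R setT)); exact/measurable_EFinP.
have E := @ge0_integral_affine R c t c0 _ mF' (fun x => abse_ge0 _).
apply: (@le_lt_trans _ _ ((`|c|^-1)%:E * \int[mu]_x `|(F x)%:E|)%E).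
  by rewrite -E.
case/integrableP : iF => _ /= h.
by rewrite lte_mul_pinfty// lee_fin invr_ge0.
Qed.

Lemma itvcc_measurable A : measurable (`[- A, A]%classic : set T).
Proof. by apply: borel_lebesgue; exact: measurable_itv. Qed.

Lemma lintegrable_indic A : lintegrable (\1_(`[- A, A]%classic : set R)).
Proof.
have mA := itvcc_measurable A; apply/integrableP; split.
  exact/measurable_EFinP/measurable_indic.
rewrite (eq_integral (fun x : T => (\1_(`[- A, A]) x)%:E)); last first.
  by move=> x _; rewrite gee0_abs// lee_fin.
have : (lebesgue_measure (`[(- A)%R, A]%classic : set R) < +oo)%E.
  by rewrite lebesgue_measure_itv/=; case: ifP => _; rewrite ltry.
by apply: le_lt_trans; rewrite integral_indic// setIT; exact: lexx.
Qed.

Lemma indic_itvE A (x : R) :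
  \1_(`[- A, A]%classic : set R) x = (`|x| <= A)%R%:R :> R.
Proof. by rewrite indicE mem_setE in_itv/= ler_norml. Qed.

Definition loc_integrable F : Prop := lmeasurable F /\
  forall A, lintegrable (fun x => (`|x| <= A)%R%:R * F x).

Lemma lmeasurable_cut F A : lmeasurable F ->
  lmeasurable (fun x => (`|x| <= A)%R%:R * F x).
Proof.
move=> mF; apply: lmeasurableM mF.
have := lintegrable_measurable (lintegrable_indic A).
by rewrite (_ : \1_(_) = fun x => (`|x| <= A)%R%:R)//; apply/funext => x; rewrite indic_itvE.
Qed.

Lemma loc_integrable_le F G : lmeasurable F -> loc_integrable G ->
  (forall x, `|F x| <= G x) -> loc_integrable F.
Proof.
move=> mF [mG iG] FG; split=> // A; apply: (lintegrable_le _ (iG A)).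
  exact: lmeasurable_cut.
by move=> x; rewrite normrM normr_nat ler_wpM2l.
Qed.

Lemma loc_integrableD F G : loc_integrable F -> loc_integrable G ->
  loc_integrable (fun x => F x + G x).
Proof.
move=> [mF iF] [mG iG]; split=> [|A]; first exact: lmeasurableD.
by under eq_fun do rewrite mulrDr; exact: lintegrableD.
Qed.

Lemma loc_integrable_affine F c t : c != 0 -> loc_integrable F ->
  loc_integrable (fun x => F (c * x + t)).
Proof.
move=> c0 [mF iF]; split=> [|A]; first exact: lmeasurable_affine.
pose B := `|c| * A + `|t|.
have i1 : lintegrable (fun x => `|(`|x| <= B)%R%:R * F x|).
  by have := integrable_norm (iF B).
apply: (lintegrable_le _ (lintegrable_affine t c0 i1)).
  by apply: lmeasurable_cut; exact: lmeasurable_affine.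
move=> x; rewrite !normrM !normr_nat ler_wpM2r// ler_nat.
have [xA|//] := lerP `|x| A.
rewrite (_ : _ <= B)// /B (le_trans (ler_normD _ _))// lerD2r normrM.
by rewrite ler_wpM2l.
Qed.

Lemma loc_integrable_bounded_mul F G : loc_integrable F -> lmeasurable G ->
  (forall A, exists M, forall x, `|x| <= A -> `|G x| <= M) ->
  loc_integrable (fun x => F x * G x).
Proof.
move=> [mF iF] mG bG; split=> [|A]; first exact: lmeasurableM.
have [M GM] := bG A.
have i1 : lintegrable (fun x => `|M| * `|(`|x| <= A)%R%:R * F x|).
  by apply: lintegrableZ; have := integrable_norm (iF A).
apply: (lintegrable_le _ i1).
  by apply: lmeasurable_cut; exact: lmeasurableM.
move=> x; rewrite mulrA normrM mulrC.
have [xA|_] := lerP `|x| A; last by rewrite !mul0r normr0 !mulr0.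
by rewrite ler_wpM2r// (le_trans (GM _ xA))// ler_norm.
Qed.

End RealIntegrals.

Section AlmostEverywhere.
Variable R : realType.
Notation mu := (@completed_lebesgue_measure R).
Implicit Types P Q : R -> Prop.

(** A null set of the completed measure lies in a Borel null set. *)
Lemma ae_lebP P : {ae mu, forall x : R, P x} <->
  (@lebesgue_measure R).-negligible (~` [set x | P x]).
Proof.
split=> [[A [mA A0 PA]]|[A [mA A0 PA]]]; last first.
  by exists A; split=> //; exact: borel_lebesgue.
have [X [N [mX [B [mB B0 NB]] AE]]] := lebesgue_split mA.
exists (X `|` B); split.
- exact: measurableU.
- have XA : (mu X <= mu A)%E.
    apply: le_measure; rewrite ?inE//; first exact: borel_lebesgue.
    by rewrite AE; left.
  apply: null_set_setU => //; apply/eqP; rewrite eq_le measure_ge0 andbT.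
  by rewrite A0 in XA; exact: XA.
- by move=> x /PA; rewrite AE => -[|/NB]; [left|right].
Qed.

Lemma ae_leb_imp P Q : (forall x, P x -> Q x) ->
  {ae mu, forall x : R, P x} -> {ae mu, forall x : R, Q x}.
Proof.
move=> PQ /ae_lebP h; apply/ae_lebP; by apply: negligibleS h => x /= nQ /PQ.
Qed.

Lemma ae_leb_and P Q : {ae mu, forall x : R, P x} ->
  {ae mu, forall x : R, Q x} -> {ae mu, forall x : R, P x /\ Q x}.
Proof.
move=> /ae_lebP hP /ae_lebP hQ; apply/ae_lebP.
apply: negligibleS (negligibleU hP hQ) => x /= /not_andP[] ?;
  by [left|right].
Qed.

Lemma ae_leb_affine P (c t : R) : c != 0 ->
  {ae mu, forall x : R, P x} -> {ae mu, forall x : R, P (c * x + t)}.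
Proof.
move=> c0 /ae_lebP h; apply/ae_lebP.
exact: (negligible_affine t c0 h).
Qed.

Lemma ae_leb_all P : (forall x, P x) -> {ae mu, forall x : R, P x}.
Proof.
move=> h; apply/ae_lebP; rewrite (_ : ~` _ = set0); first exact: negligible_set0.
by apply/seteqP; split => x //=; apply; exact: h.
Qed.

End AlmostEverywhere.

(** * Integration of complex functions *)

Section ComplexIntegrals.
Variable R : realType.
Notation T := (lebesgueType R).
Notation mu := (@completed_lebesgue_measure R).
Implicit Types (f g h : R -> R[i]) (F G : R -> R) (z : R[i]) (A c t : R).

Lemma cmeasurable_cst z : cmeasurable (fun=> z : R[i]).
Proof. by split; exact: measurable_cst. Qed.

Lemma cmeasurableD f g : cmeasurable f -> cmeasurable g ->
  cmeasurable (fun x => f x + g x).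
Proof.
move=> [fR fI] [gR gI]; split.
- by under eq_fun do rewrite cReD; exact: lmeasurableD.
- by under eq_fun do rewrite cImD; exact: lmeasurableD.
Qed.

Lemma cmeasurableM f g : cmeasurable f -> cmeasurable g ->
  cmeasurable (fun x => f x * g x).
Proof.
move=> [fR fI] [gR gI]; split.
- by under eq_fun do rewrite cReM; apply: lmeasurableB; exact: lmeasurableM.
- by under eq_fun do rewrite cImM; apply: lmeasurableD; exact: lmeasurableM.
Qed.

Lemma cmeasurableJ f : cmeasurable f -> cmeasurable (fun x => (f x)^*%C).
Proof.
move=> [fR fI]; split; first by under eq_fun do rewrite cReJ.
by under eq_fun do rewrite cImJ; exact: measurableT_comp.
Qed.

Lemma cmeasurable_real F : lmeasurable F -> cmeasurable (fun x => (F x)%:C%C).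
Proof. by move=> mF; split => //; exact: measurable_cst. Qed.

Lemma cmeasurable_continuous f : ccontinuous f -> cmeasurable f.
Proof. by move=> [fR fI]; split; exact: continuous_lmeasurable. Qed.

Lemma cmeasurable_sum I (r : seq I) (P : pred I) (F : I -> R -> R[i]) :
  (forall i, P i -> cmeasurable (F i)) ->
  cmeasurable (fun x => \sum_(i <- r | P i) F i x).
Proof.
move=> mF; elim: r => [|i r ih].
  by under eq_fun do rewrite big_nil; exact: cmeasurable_cst.
under eq_fun do rewrite big_cons.
have [Pi|_] := boolP (P i); last exact: ih.
by apply: cmeasurableD; [exact: mF|exact: ih].
Qed.

Lemma cmeasurable_affine f c t : c != 0 -> cmeasurable f ->
  cmeasurable (fun x => f (c * x + t)).
Proof.
by move=> c0 [fR fI]; split; [exact: (lmeasurable_affine t c0 fR)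
                             |exact: (lmeasurable_affine t c0 fI)].
Qed.

Lemma normc_sqr_measurable f : cmeasurable f ->
  lmeasurable (fun x => normc (f x) ^+ 2).
Proof.
move=> [fR fI]; rewrite /lmeasurable; under eq_fun do rewrite normcE2 !expr2.
by apply: lmeasurableD; exact: lmeasurableM.
Qed.

Lemma normc_measurable f : cmeasurable f -> lmeasurable (fun x => normc (f x)).
Proof.
move=> /normc_sqr_measurable mf.
have := lmeasurable_continuous_comp (@sqrt_continuous R) mf.
rewrite (_ : (fun x => Num.sqrt _) = fun x => normc (f x))//.
by apply/funext => x; rewrite sqrtr_sqr ger0_norm// normc_ge0.
Qed.

Definition cintegrable f : Prop :=
  cmeasurable f /\ lintegrable (fun x => normc (f x)).

Lemma cintegrable_le f F : cmeasurable f -> lintegrable F ->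
  (forall x, normc (f x) <= F x) -> cintegrable f.
Proof.
move=> mf iF fF; split=> //; apply: (lintegrable_le _ iF).
  exact: normc_measurable.
by move=> x; rewrite ger0_norm ?normc_ge0.
Qed.

Lemma cintegrable_Re f : cintegrable f -> lintegrable (fun x => complex.Re (f x)).
Proof.
move=> [mf nf]; apply: (lintegrable_le _ nf); first by case: mf.
by move=> x; exact: Re_le_normc.
Qed.

Lemma cintegrable_Im f : cintegrable f -> lintegrable (fun x => complex.Im (f x)).
Proof.
move=> [mf nf]; apply: (lintegrable_le _ nf); first by case: mf.
by move=> x; exact: Im_le_normc.
Qed.

Lemma cintegrableD f g : cintegrable f -> cintegrable g ->
  cintegrable (fun x => f x + g x).
Proof.
move=> [mf nf] [mg ng]; apply: (cintegrable_le _ (lintegrableD nf ng)).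
  exact: cmeasurableD.
by move=> x; exact: le_normcD.
Qed.

Lemma cintegrableZ z f : cintegrable f -> cintegrable (fun x => z * f x).
Proof.
move=> [mf nf]; apply: (cintegrable_le _ (lintegrableZ (normc z) nf)).
  by apply: cmeasurableM => //; exact: cmeasurable_cst.
by move=> x; rewrite normcM.
Qed.

Lemma cintegrableJ f : cintegrable f -> cintegrable (fun x => (f x)^*%C).
Proof.
move=> [mf nf]; split; first exact: cmeasurableJ.
by under eq_fun do rewrite normc_conj.
Qed.

Lemma cintegrable0 : cintegrable (fun=> 0 : R[i]).
Proof.
split; first exact: cmeasurable_cst.
by under eq_fun do rewrite normc0; exact: integrable0.
Qed.

Lemma cintegrable_sum I (r : seq I) (P : pred I) (F : I -> R -> R[i]) :
  (forall i, P i -> cintegrable (F i)) ->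
  cintegrable (fun x => \sum_(i <- r | P i) F i x).
Proof.
move=> iF; elim: r => [|i r ih].
  by under eq_fun do rewrite big_nil; exact: cintegrable0.
under eq_fun do rewrite big_cons.
have [Pi|_] := boolP (P i); last exact: ih.
by apply: cintegrableD; [exact: iF|exact: ih].
Qed.

Lemma cintegrable_affine f c t : c != 0 -> cintegrable f ->
  cintegrable (fun x => f (c * x + t)).
Proof.
move=> c0 [mf nf]; split; first exact: cmeasurable_affine.
exact: (lintegrable_affine t c0 nf).
Qed.

Lemma cintegralD f g : cintegrable f -> cintegrable g ->
  cintegral (fun x => f x + g x) = cintegral f + cintegral g.
Proof.
move=> fi gi; rewrite /cintegral.
under [X in Complex X _]eq_Rintegral do rewrite cReD.
under [X in Complex _ X]eq_Rintegral do rewrite cImD.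
by rewrite !RintegralD//; (exact: cintegrable_Re || exact: cintegrable_Im).
Qed.

Lemma cintegralZ z f : cintegrable f ->
  cintegral (fun x => z * f x) = z * cintegral f.
Proof.
move=> fi; have Ri := cintegrable_Re fi; have Ii := cintegrable_Im fi.
rewrite /cintegral.
under [X in Complex X _]eq_Rintegral do rewrite cReM.
under [X in Complex _ X]eq_Rintegral do rewrite cImM.
rewrite RintegralB//; [|exact: lintegrableZ|exact: lintegrableZ].
rewrite RintegralD//; [|exact: lintegrableZ|exact: lintegrableZ].
by rewrite !RintegralZl//; case: (z).
Qed.

Lemma cintegralN f : cintegrable f -> cintegral (fun x => - f x) = - cintegral f.
Proof.
move=> fi; rewrite -mulN1r -cintegralZ//; congr cintegral; apply/funext => x.
by rewrite mulN1r.
Qed.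

Lemma cintegrableN f : cintegrable f -> cintegrable (fun x => - f x).
Proof.
move=> /(cintegrableZ (-1)); rewrite (_ : (fun x => -1 * f x) = fun x => - f x)//.
by apply/funext => x; rewrite mulN1r.
Qed.

Lemma cintegralB f g : cintegrable f -> cintegrable g ->
  cintegral (fun x => f x - g x) = cintegral f - cintegral g.
Proof.
move=> fi gi; have gN := cintegrableN gi.
by rewrite (cintegralD fi gN) (cintegralN gi).
Qed.

Lemma cintegralJ f : cintegrable f ->
  cintegral (fun x => (f x)^*%C) = (cintegral f)^*%C.
Proof.
move=> fi; have Ii := cintegrable_Im fi; rewrite /cintegral /=.
under [X in Complex X _]eq_Rintegral do rewrite cReJ.
under [X in Complex _ X]eq_Rintegral do rewrite cImJ -mulN1r.
by rewrite RintegralZl// mulN1r.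
Qed.

Lemma cintegral0 : cintegral (fun=> 0 : R[i]) = 0.
Proof. by rewrite /cintegral /= /Rintegral !integral0. Qed.

Lemma cintegral_sum I (r : seq I) (P : pred I) (F : I -> R -> R[i]) :
  (forall i, P i -> cintegrable (F i)) ->
  cintegral (fun x => \sum_(i <- r | P i) F i x) =
  \sum_(i <- r | P i) cintegral (F i).
Proof.
move=> iF; elim: r => [|i r ih].
  by rewrite big_nil; under eq_fun do rewrite big_nil; exact: cintegral0.
rewrite big_cons; under eq_fun do rewrite big_cons.
have [Pi|_] := boolP (P i); last exact: ih.
rewrite -ih cintegralD; [by []|exact: iF|exact: cintegrable_sum].
Qed.

Lemma cintegral_affine f c t : c != 0 -> cmeasurable f ->
  cintegral (fun x => f (c * x + t)) = (`|c|^-1)%:C%C * cintegral f.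
Proof.
move=> c0 [mR mI]; rewrite /cintegral.
rewrite (@Rintegral_affine _ c t c0 (fun x => complex.Re (f x)))//.
rewrite (@Rintegral_affine _ c t c0 (fun x => complex.Im (f x)))//.
by apply/eqP; rewrite eq_complex/= !mul0r subr0 addr0 !eqxx.
Qed.

Lemma cintegral_shift f t : cmeasurable f ->
  cintegral (fun x => f (x + t)) = cintegral f.
Proof.
move=> mf; rewrite -[RHS]mul1r -[X in X * _](_ : (`|1 : R|^-1)%:C%C = 1); last first.
  by rewrite normr1 invr1.
rewrite -(cintegral_affine t (oner_neq0 R) mf).
by congr cintegral; apply/funext => x; rewrite mul1r.
Qed.

Lemma cintegral_ae f g : cmeasurable f -> cmeasurable g ->
  {ae mu, forall x, f x = g x} -> cintegral f = cintegral g.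
Proof.
move=> [fR fI] [gR gI] fg; rewrite /cintegral /Rintegral.
have aeE (F G : R -> R) : lmeasurable F -> lmeasurable G ->
    {ae mu, forall x, F x = G x} ->
    (\int[mu]_x (F x)%:E = \int[mu]_x (G x)%:E)%E.
  move=> /measurable_EFinP mF /measurable_EFinP mG FG.
  apply: (@ae_eq_integral _ T R mu setT _ _ measurableT mF mG).
  by apply: (ae_leb_imp _ FG) => x FGx _ /=; rewrite FGx.
rewrite (aeE (fun x => complex.Re (f x)) (fun x => complex.Re (g x)) fR gR).
  rewrite (aeE (fun x => complex.Im (f x)) (fun x => complex.Im (g x)) fI gI)//.
  by apply: ae_leb_imp fg => x ->.
by apply: ae_leb_imp fg => x ->.
Qed.

(** The constant 2, from splitting into real and imaginary parts, is harmless
    here and spares the rotation argument that gives 1. *)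
Lemma normc_cintegral f : cintegrable f ->
  normc (cintegral f) <= 2 * \int[mu]_x normc (f x).
Proof.
move=> fi; rewrite (le_trans (normc_le_ReIm _))//= mulr_natl mulr2n.
case: (fi) => mf nf.
apply: lerD; rewrite (le_trans (le_normr_Rintegral _ _))//.
- exact: cintegrable_Re.
- apply: le_Rintegral => //; last by move=> x _; exact: Re_le_normc.
  by have := integrable_norm (cintegrable_Re fi).
- exact: cintegrable_Im.
- apply: le_Rintegral => //; last by move=> x _; exact: Im_le_normc.
  by have := integrable_norm (cintegrable_Im fi).
Qed.

Lemma real_dominated (F_ : nat -> R -> R) F G :
  (forall n, lmeasurable (F_ n)) -> lmeasurable F ->
  {ae mu, forall x : R, F_ ^~ x @ \oo --> F x} -> lintegrable G ->
  (forall n x, `|F_ n x| <= G x) ->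
  \int[mu]_x F_ n x @[n --> \oo] --> \int[mu]_x F x.
Proof.
move=> mF_ mF FF iG FG.
have := @dominated_convergence _ T R mu setT measurableT
  (fun n x => (F_ n x)%:E) (fun x => (F x)%:E) (fun x => (G x)%:E).
case.
- by move=> n; apply/measurable_EFinP; exact: mF_.
- exact/measurable_EFinP.
- apply: (ae_leb_imp _ FF) => x Fx _; apply: cvg_EFin; last exact: Fx.
  by near=> n.
- exact: iG.
- by apply: aeW => x n _; rewrite lee_fin; exact: FG.
move=> iF _ h; apply: fine_cvg.
rewrite fineK; [exact: h|exact: (integrable_fin_num measurableT iF)].
Unshelve. all: by end_near. Qed.

Lemma cdominated (f_ : nat -> R -> R[i]) f G :
  (forall n, cmeasurable (f_ n)) -> cmeasurable f ->
  (forall x, normc (f_ n x - f x) @[n --> \oo] --> (0 : R)) -> lintegrable G ->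
  (forall n x, normc (f_ n x) <= G x) ->
  cintegral (f_ n) @[n --> \oo] --> cintegral f.
Proof.
move=> mf_ [mR mI] ff iG fG; apply: complex_cvg_ReIm => /=.
- apply: (@real_dominated (fun n x => complex.Re (f_ n x)) _ G) => //.
  + by move=> n; case: (mf_ n).
  + apply: ae_leb_all => x; apply/subr_cvg0; apply/cvgr0Pnorm_lt => e e0.
    move/cvgr0Pnorm_lt : (ff x) => /(_ _ e0); apply: filterS => n.
    rewrite ger0_norm ?normc_ge0// => /(le_lt_trans _); apply.
    by rewrite -cReN -cReD Re_le_normc.
  + by move=> n x; rewrite (le_trans (Re_le_normc _)).
- apply: (@real_dominated (fun n x => complex.Im (f_ n x)) _ G) => //.
  + by move=> n; case: (mf_ n).
  + apply: ae_leb_all => x; apply/subr_cvg0; apply/cvgr0Pnorm_lt => e e0.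
    move/cvgr0Pnorm_lt : (ff x) => /(_ _ e0); apply: filterS => n.
    rewrite ger0_norm ?normc_ge0// => /(le_lt_trans _); apply.
    by rewrite -cImN -cImD Im_le_normc.
  + by move=> n x; rewrite (le_trans (Im_le_normc _)).
Qed.

End ComplexIntegrals.

(** * Square integrable functions *)

Section SquareIntegrable.
Variable R : realType.
Notation T := (lebesgueType R).
Notation mu := (@completed_lebesgue_measure R).
Implicit Types (f g h u v : R -> R[i]) (z : R[i]).

Definition sqint f : Prop :=
  cmeasurable f /\ lintegrable (fun x => normc (f x) ^+ 2).

Definition ip f g : R[i] := cintegral (fun x => f x * (g x)^*%C).

Definition sqnorm f : R := \int[mu]_x (normc (f x) ^+ 2).

Lemma sqint_le f (F : R -> R) : cmeasurable f -> lintegrable F ->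
  (forall x, normc (f x) ^+ 2 <= F x) -> sqint f.
Proof.
move=> mf iF fF; split=> //; apply: (lintegrable_le _ iF).
  exact: normc_sqr_measurable.
by move=> x; rewrite ger0_norm ?sqr_ge0.
Qed.

Lemma sqintD f g : sqint f -> sqint g -> sqint (fun x => f x + g x).
Proof.
move=> [mf nf] [mg ng].
apply: (sqint_le _ (lintegrableD (lintegrableZ 2 nf) (lintegrableZ 2 ng))).
  exact: cmeasurableD.
by move=> x; exact: normc_sqrD.
Qed.

Lemma sqintZ z f : sqint f -> sqint (fun x => z * f x).
Proof.
move=> [mf nf]; apply: (sqint_le _ (lintegrableZ (normc z ^+ 2) nf)).
  by apply: cmeasurableM; [exact: cmeasurable_cst|exact: mf].
by move=> x; rewrite normcM exprMn.
Qed.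

Lemma sqintN f : sqint f -> sqint (fun x => - f x).
Proof.
move=> /(sqintZ (-1)); rewrite (_ : (fun x => -1 * f x) = fun x => - f x)//.
by apply/funext => x; rewrite mulN1r.
Qed.

Lemma sqintB f g : sqint f -> sqint g -> sqint (fun x => f x - g x).
Proof. by move=> sf sg; exact: (sqintD sf (sqintN sg)). Qed.

Lemma sqint0 : sqint (fun=> 0 : R[i]).
Proof.
split; first exact: cmeasurable_cst.
by under eq_fun do rewrite normc0 expr0n; exact: integrable0.
Qed.

Lemma sqint_sum I (r : seq I) (F : I -> R -> R[i]) :
  (forall i, sqint (F i)) -> sqint (fun x => \sum_(i <- r) F i x).
Proof.
move=> iF; elim: r => [|i r ih].
  by under eq_fun do rewrite big_nil; exact: sqint0.
by under eq_fun do rewrite big_cons; exact: (sqintD (iF i) ih).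
Qed.

Lemma sqint_mulJ f g : sqint f -> sqint g ->
  cintegrable (fun x => f x * (g x)^*%C).
Proof.
move=> [mf nf] [mg ng]; apply: (cintegrable_le _ (lintegrableD nf ng)).
  exact: (cmeasurableM mf (cmeasurableJ mg)).
by move=> x; rewrite -(normc_conj (g x)) normcM_le.
Qed.

Lemma sqnorm_ge0 f : 0 <= sqnorm f.
Proof. by apply: Rintegral_ge0 => x _; exact: sqr_ge0. Qed.

Lemma ip_sqnorm f : ip f f = (sqnorm f)%:C%C.
Proof.
rewrite /ip /cintegral /sqnorm; apply/eqP; rewrite eq_complex /=; apply/andP; split.
  by apply/eqP/eq_Rintegral => x _; rewrite normc_mulJ.
apply/eqP; rewrite (@eq_Rintegral _ T R mu setT (fun=> 0)).
  by rewrite Rintegral_cst// mul0r.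
by move=> x _; rewrite normc_mulJ.
Qed.

Lemma ipDl f g h : sqint f -> sqint g -> sqint h ->
  ip (fun x => f x + g x) h = ip f h + ip g h.
Proof.
move=> sf sg sh; rewrite /ip -(cintegralD (sqint_mulJ sf sh) (sqint_mulJ sg sh)).
by congr cintegral; apply/funext => x; rewrite mulrDl.
Qed.

Lemma ipZl z f h : sqint f -> sqint h ->
  ip (fun x => z * f x) h = z * ip f h.
Proof.
move=> sf sh; rewrite /ip -(cintegralZ z (sqint_mulJ sf sh)).
by congr cintegral; apply/funext => x; rewrite mulrA.
Qed.

Lemma ipC f g : sqint f -> sqint g -> ip g f = (ip f g)^*%C.
Proof.
move=> sf sg; rewrite /ip -(cintegralJ (sqint_mulJ sf sg)).
by congr cintegral; apply/funext => x; rewrite conjcM conjcK mulrC.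
Qed.

Lemma ip_suml I (r : seq I) (F : I -> R -> R[i]) h : (forall i, sqint (F i)) ->
  sqint h -> ip (fun x => \sum_(i <- r) F i x) h = \sum_(i <- r) ip (F i) h.
Proof.
move=> sF sh; elim: r => [|i r ih].
  rewrite big_nil /ip; under eq_fun do rewrite big_nil mul0r.
  exact: cintegral0.
rewrite big_cons -ih -(ipDl (sF i) (sqint_sum r sF) sh); congr (ip _ h).
by apply/funext => x; rewrite big_cons.
Qed.

Lemma ipBl f g h : sqint f -> sqint g -> sqint h ->
  ip (fun x => f x - g x) h = ip f h - ip g h.
Proof.
move=> sf sg sh; rewrite (ipDl sf (sqintN sg) sh); congr (_ + _).
rewrite -mulN1r -(ipZl (-1) sg sh); congr (ip _ h).
by apply/funext => x; rewrite mulN1r.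
Qed.

(** A substitute for the Cauchy-Schwarz inequality that suffices for limits
    along which both norms tend to zero. *)
Lemma normc_ip f g : sqint f -> sqint g ->
  normc (ip f g) <= 2 * (sqnorm f + sqnorm g).
Proof.
move=> sf sg; rewrite (le_trans (normc_cintegral (sqint_mulJ sf sg)))//.
rewrite ler_pM2l// /sqnorm -RintegralD//; [|by case: sf|by case: sg].
apply: le_Rintegral => //.
- by case: (sqint_mulJ sf sg).
- by case: sf => mf nf; case: sg => mg ng; exact: lintegrableD.
- by move=> x _; rewrite -(normc_conj (g x)) normcM_le.
Qed.

Lemma sqnormD f g : sqint f -> sqint g ->
  sqnorm (fun x => f x + g x) <= 2 * sqnorm f + 2 * sqnorm g.
Proof.
move=> sf sg; have [mf nf] := sf; have [mg ng] := sg.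
rewrite /sqnorm -!RintegralZl// -RintegralD//; try exact: lintegrableZ.
apply: le_Rintegral => //.
- by case: (sqintD sf sg).
- exact: (lintegrableD (lintegrableZ 2 nf) (lintegrableZ 2 ng)).
- by move=> x _; exact: normc_sqrD.
Qed.

Lemma sqnormZ z f : sqint f -> sqnorm (fun x => z * f x) = normc z ^+ 2 * sqnorm f.
Proof.
move=> [mf nf]; rewrite /sqnorm -RintegralZl//.
by apply: eq_Rintegral => x _; rewrite normcM exprMn.
Qed.

End SquareIntegrable.

Section ConjugateSums.
Variable R : realType.

Lemma conjcB (z w : R[i]) : (z - w)^*%C = z^*%C - w^*%C.
Proof. exact: rmorphB. Qed.

Lemma conjc_sum I (r : seq I) (P : pred I) (F : I -> R[i]) :
  (\sum_(i <- r | P i) F i)^*%C = \sum_(i <- r | P i) (F i)^*%C.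
Proof. exact: rmorph_sum. Qed.

End ConjugateSums.

(** * Fourier coefficients on one period *)

Section FourierCell.
Variable R : realType.
Notation T := (lebesgueType R).
Notation mu := (@completed_lebesgue_measure R).
Implicit Types (f g u v : R -> R[i]) (x t : R) (k l : int) (N M : nat).

(** The sums over these frequencies are the partial sums of sumZ, yet they are
    sums over a duplicate-free sequence and can be compared and reindexed. *)
Definition freqs N : seq int :=
  [seq n%:Z | n <- iota 0 N] ++ [seq (- n.+1%:Z)%R | n <- iota 0 N].

Lemma mem_freqs N k : (k \in freqs N) = (- N%:Z <= k < N%:Z)%R.
Proof.
rewrite mem_cat; apply/orP/idP => [[|]/mapP[n]|].
- by rewrite mem_iota => /andP[_ nN] ->; lia.
- by rewrite mem_iota => /andP[_ nN] ->; lia.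
- case: k => n kN; [left|right]; apply/mapP; exists n; rewrite ?mem_iota//; lia.
Qed.

Lemma freqs_uniq N : uniq (freqs N).
Proof.
rewrite cat_uniq !map_inj_uniq ?iota_uniq/= ?andbT; first last.
- by move=> a b [].
- by move=> a b /oppr_inj[].
apply/hasPn => k /mapP[n _ ->]; apply/negP => /mapP[m _]; lia.
Qed.

Lemma big_freqs N (F : int -> R[i]) :
  \sum_(k <- freqs N) F k = \sum_(0 <= n < N) (F n%:Z + F (- n.+1%:Z)).
Proof. by rewrite big_cat !big_map/= big_split /index_iota subn0. Qed.

(** Functions on the circle are represented by functions on the line supported
    in the cell [0, 2 pi[. *)
Definition cellb x : bool := (0 <= x) && (x < 2 * pi).
Definition cell x : R[i] := (cellb x)%:R.

Lemma cell_indic x : cell x = (\1_(`[0, 2 * pi[%classic : set R) x)%:C%C.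
Proof. by rewrite indicE mem_setE in_itv/= -/(cellb x) /cell rmorph_nat. Qed.

Lemma cell_sqr x : cell x * cell x = cell x.
Proof. by rewrite /cell; case: cellb; rewrite ?mulr1 ?mulr0. Qed.

Lemma cellJ x : (cell x)^*%C = cell x.
Proof. by rewrite /cell conjc_nat. Qed.

Lemma lintegrable_cell : lintegrable (fun x => (cellb x)%:R : R).
Proof.
have mA : measurable (`[0, 2 * pi[%classic : set T).
  by apply: borel_lebesgue; exact: measurable_itv.
have -> : (fun x => (cellb x)%:R : R) = \1_(`[0, 2 * pi[%classic : set R).
  by apply/funext => x; rewrite indicE mem_setE in_itv.
apply/integrableP; split; first exact/measurable_EFinP/measurable_indic.
have : (lebesgue_measure (`[0%R, (2 * pi)%R[%classic : set R) < +oo)%E.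
  by rewrite lebesgue_measure_itv/=; case: ifP => _; rewrite ltry.
rewrite (eq_integral (fun x : T => (\1_(`[0%R, (2 * pi)%R[%classic : set R) x)%:E)); last first.
  by move=> x _; rewrite gee0_abs// lee_fin.
by apply: le_lt_trans; rewrite integral_indic// setIT; exact: lexx.
Qed.

Lemma cmeasurable_cell : cmeasurable cell.
Proof.
have := cmeasurable_real (lintegrable_measurable lintegrable_cell).
rewrite (_ : (fun x => _) = cell)//.
by apply/funext => x; rewrite rmorph_nat.
Qed.

Lemma cell_bounded_sqint f (B : R) : cmeasurable f ->
  (forall x, cellb x -> normc (f x) <= B) -> sqint (fun x => cell x * f x).
Proof.
move=> mf fB; apply: (sqint_le _ (lintegrableZ (B ^+ 2) lintegrable_cell)).
  exact: (cmeasurableM cmeasurable_cell mf).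
move=> x; rewrite normcM normc_nat; have := fB x; case: (cellb x) => h.
  have {}h := h isT; rewrite mul1r mulr1; apply: lerXn2r; rewrite ?nnegrE//.
    exact: normc_ge0.
  exact: le_trans (normc_ge0 _) h.
by rewrite mul0r mulr0 expr0n.
Qed.

Definition cell_expi k x : R[i] := cell x * expi (k%:~R * x).

Lemma cmeasurable_expi (c : R) : cmeasurable (fun x => expi (c * x)).
Proof. exact/cmeasurable_continuous/ccontinuous_expi_lin. Qed.

Lemma sqint_cell_expi k : sqint (cell_expi k).
Proof.
apply: (@cell_bounded_sqint _ 1); first exact: cmeasurable_expi.
by move=> x _; rewrite normc_expi.
Qed.

Lemma cell_bounded_cintegrable f (B : R) : cmeasurable f ->
  (forall x, normc (f x) <= B) -> cintegrable (fun x => cell x * f x).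
Proof.
move=> mf fB; apply: (cintegrable_le _ (lintegrableZ B lintegrable_cell)).
  exact: (cmeasurableM cmeasurable_cell mf).
move=> x; rewrite normcM normc_nat; case: (cellb x).
  by rewrite mul1r mulr1.
by rewrite mul0r mulr0.
Qed.

Lemma cintegral_cell : cintegral cell = (2 * pi)%:C%C.
Proof.
have pi0 : (0 : R) <= 2 * pi by rewrite mulr_ge0// pi_ge0.
have mA : measurable (`[0, 2 * pi[%classic : set T).
  by apply: borel_lebesgue; exact: measurable_itv.
rewrite /cintegral; apply/eqP; rewrite eq_complex /=; apply/andP; split; last first.
  rewrite (@eq_Rintegral _ T R mu setT (fun=> 0)).
    by rewrite Rintegral_cst// mul0r.
  by move=> x _; rewrite cell_indic.
rewrite (@eq_Rintegral _ T R mu setT (\1_(`[0, 2 * pi[%classic : set R))); last first.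
  by move=> x _; rewrite cell_indic.
rewrite /Rintegral integral_indic// setIT.
rewrite -[X in fine X]/(lebesgue_measure (`[0%R, (2 * pi)%R[%classic : set R)).
rewrite lebesgue_measure_itv/= lte_fin; case: ltP => /= [_|h]; first by rewrite subr0.
by rewrite eq_le pi0 h.
Qed.

Lemma cell_split t x : 0 <= t <= 2 * pi ->
  cell (x - t) = cell x * (t <= x)%R%:R + cell (x - 2 * pi) * (x - 2 * pi < t)%R%:R.
Proof.
move=> /andP[t0 tp]; rewrite /cell /cellb -!natrM -natrD; congr (_%:R).
rewrite !subr_ge0 !ltrBlDr (addrC t) [(2 * pi <= x)]leNgt.
case: (ltrP x (2 * pi)) => h1; case: (lerP t x) => h2; case: (lerP 0 x) => h3;
case: (ltrP x (2 * pi + t)) => h4; case: (ltrP x (2 * pi + 2 * pi)) => h5 //=;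
  exfalso; lra.
Qed.

(** For k <> 0 a translation by pi / |k| changes the sign of the integrand and,
    by periodicity, preserves the integral over a period. *)
Lemma cintegral_cell_expi k :
  cintegral (fun x => cell x * expi (k%:~R * x)) = ((k == 0)%:R * (2 * pi))%:C%C.
Proof.
have [->|k0] := eqVneq k 0.
  rewrite mul1r -cintegral_cell; congr cintegral; apply/funext => x.
  by rewrite mul0r expi0 mulr1.
rewrite mul0r; set I := cintegral _.
pose h x : R[i] := expi (k%:~R * x).
have mh : cmeasurable h by exact: cmeasurable_expi.
have kr0 : (k%:~R : R) != 0 by rewrite intr_eq0.
pose t : R := pi / `|k%:~R|.
have k1 : 1 <= `|k%:~R : R|.
  by rewrite -intr_norm -[1]/(1%:~R) ler_int; lia.
have t0 : 0 <= t by rewrite divr_ge0// pi_ge0.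
have tp : t <= 2 * pi.
  rewrite ler_pdivrMr ?(lt_le_trans ltr01 k1)//.
  by have := pi_ge0 R; nra.
have ht x : h (x + t) = - h x.
  rewrite /h mulrDr expiD; have [kp|kn] := ltrP 0 (k%:~R : R).
    have -> : k%:~R * t = pi by rewrite /t gtr0_norm//; field.
    rewrite [X in _ * X](_ : _ = -1) ?mulrN1//.
    by apply/eqP; rewrite eq_complex /= cospi sinpi !eqxx oppr0 eqxx.
  have {}kn : (k%:~R : R) < 0 by rewrite lt_neqAle kr0.
  have -> : k%:~R * t = - pi by rewrite /t ltr0_norm//; field.
  rewrite [X in _ * X](_ : _ = -1) ?mulrN1//.
  by apply/eqP; rewrite eq_complex /= cosN sinN cospi sinpi ?oppr0 !eqxx ?oppr0 ?eqxx.
have mind (P : pred R) : measurable ([set x | P x] : set (measurableTypeR R)) ->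
    cmeasurable (fun x => (P x)%:R : R[i]).
  move=> mP; have mP' : measurable ([set x | P x] : set T) by exact: borel_lebesgue.
  have mI : lmeasurable (\1_([set x | P x]) : R -> R) by exact: measurable_indic.
  have := cmeasurable_real mI.
  rewrite (_ : (fun x => _) = (fun x => (P x)%:R : R[i]))//.
  by apply/funext => x; rewrite indicE mem_setE rmorph_nat.
have m1 : cmeasurable (fun x => (t <= x)%R%:R : R[i]).
  apply: mind; rewrite (_ : [set x | _] = `[t, +oo[%classic); first exact: measurable_itv.
  by apply/seteqP; split => x /=; rewrite in_itv/= andbT.
have m2 : cmeasurable (fun x => (x < t)%R%:R : R[i]).
  apply: mind; rewrite (_ : [set x | _] = `]-oo, t[%classic); first exact: measurable_itv.
  by apply/seteqP; split => x /=; rewrite in_itv.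
have b1 x : normc ((t <= x)%R%:R * h x) <= 1.
  by rewrite normcM normc_nat normc_expi mulr1 lern1 leq_b1.
have b2 x : normc ((x < t)%R%:R * h x) <= 1.
  by rewrite normcM normc_nat normc_expi mulr1 lern1 leq_b1.
have i1 := cell_bounded_cintegrable (cmeasurableM m1 mh) b1.
have i2 := cell_bounded_cintegrable (cmeasurableM m2 mh) b2.
have i0 : cintegrable (fun x => cell x * h x).
  by apply: (@cell_bounded_cintegrable _ 1 mh) => x; rewrite normc_expi.
have hper x : h (x - 2 * pi) = h x.
  rewrite /h mulrBr (_ : k%:~R * x - _ = k%:~R * x + 2 * pi * (- k)%:~R).
    by rewrite expiDz.
  by rewrite mulrNz; ring.
have key : I = cintegral (fun x => cell x * h (x + t)).
  have mc : cmeasurable (fun x => cell (x - t) * h x).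
    apply: cmeasurableM mh.
    have := cmeasurable_affine (- t) (oner_neq0 R) cmeasurable_cell.
    by under eq_fun do rewrite mul1r.
  rewrite -[RHS](_ : cintegral (fun x => (fun y => cell (y - t) * h y) (x + t)) = _); last first.
    by congr cintegral; apply/funext => x /=; rewrite addrK.
  rewrite (cintegral_shift t mc).
  transitivity (cintegral (fun x => cell x * ((t <= x)%R%:R * h x)) +
     cintegral (fun x => cell x * ((x < t)%R%:R * h x))).
    rewrite -(cintegralD i1 i2); congr cintegral; apply/funext => x.
    rewrite -mulrDr -mulrDl -/(h x); congr (_ * _); rewrite leNgt.
    by case: (_ < _); rewrite ?addr0 ?add0r mul1r.
  rewrite -(cintegral_shift (- (2 * pi)) (proj1 i2)).
  have i3 : cintegrable (fun x => (fun y => cell y * ((y < t)%R%:R * h y)) (x - 2 * pi)).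
    have := cintegrable_affine (- (2 * pi)) (oner_neq0 R) i2.
    by under eq_fun do rewrite mul1r.
  rewrite -(cintegralD i1 i3); congr cintegral; apply/funext => x.
  by rewrite (cell_split x (introT andP (conj t0 tp))) hper; ring.
have : I = - I.
  rewrite {1}key -(cintegralN i0); congr cintegral; apply/funext => x.
  by rewrite ht mulrN.
move=> /eqP; rewrite -subr_eq0 opprK -mulr2n mulrn_eq0/= => /eqP->.
by rewrite rmorph0.
Qed.

Lemma ip_cell_expi k l : ip (cell_expi k) (cell_expi l) = ((k == l)%:R * (2 * pi))%:C%C.
Proof.
rewrite -subr_eq0 -cintegral_cell_expi; congr cintegral; apply/funext => x.
rewrite /cell_expi conjcM cellJ mulrACA cell_sqr -expiN -expiD; congr (_ * expi _).
by rewrite intrB mulrBl.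
Qed.

Definition supp_cell u : Prop := forall x, u x = u x * cell x.

Definition fcoef u k : R[i] := cintegral (fun x => u x * expi (- (k%:~R * x))).

Lemma ip_fcoef u k : supp_cell u -> ip u (cell_expi k) = fcoef u k.
Proof.
move=> su; congr cintegral; apply/funext => x.
by rewrite /cell_expi conjcM cellJ expiN mulrA -su.
Qed.

Definition cell_sum (c : int -> R[i]) N x : R[i] := \sum_(k <- freqs N) c k * cell_expi k x.

Lemma sqint_cell_sum c N : sqint (cell_sum c N).
Proof. by apply: sqint_sum => k; exact: (sqintZ (c k) (sqint_cell_expi k)). Qed.

Lemma ip_cell_sum c N u : sqint u ->
  ip (cell_sum c N) u = \sum_(k <- freqs N) c k * ip (cell_expi k) u.
Proof.
move=> su; rewrite (ip_suml _ (fun k => sqintZ (c k) (sqint_cell_expi k)) su).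
by apply: eq_bigr => k _; rewrite (ipZl (c k) (sqint_cell_expi k) su).
Qed.

Definition fourier_sum u N := cell_sum (fun k => fcoef u k / (2 * pi)%:C%C) N.

Let pi2 : (2 * pi)%:C%C != 0 :> R[i].
Proof.
by rewrite (inj_eq (@complexI R) _ 0) mulf_neq0// gt_eqF// pi_gt0.
Qed.

Lemma fourier_rest_orth u N k : sqint u -> supp_cell u -> k \in freqs N ->
  ip (fun x => u x - fourier_sum u N x) (cell_expi k) = 0.
Proof.
move=> su cu kN.
rewrite (ipBl su (sqint_cell_sum _ _) (sqint_cell_expi k)) (ip_fcoef k cu).
rewrite (ip_cell_sum _ _ (sqint_cell_expi k)) (bigD1_seq k kN (freqs_uniq N))/=.
rewrite ip_cell_expi eqxx mul1r divfK// big1 ?addr0 ?subrr// => l lk.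
by rewrite ip_cell_expi (negbTE lk) mul0r mulr0.
Qed.

Lemma sqint_rest u N : sqint u -> sqint (fun x => u x - fourier_sum u N x).
Proof. by move=> su; exact: (sqintB su (sqint_cell_sum _ _)). Qed.

Lemma fourier_rest_orth_sum u N c : sqint u -> supp_cell u ->
  ip (cell_sum c N) (fun x => u x - fourier_sum u N x) = 0.
Proof.
move=> su cu; rewrite (ip_cell_sum _ _ (sqint_rest N su)) big_seq big1// => k kN.
rewrite (ipC (sqint_rest N su) (sqint_cell_expi k)) (fourier_rest_orth su cu kN).
by rewrite conjc0 mulr0.
Qed.

(** Both Fourier sums are orthogonal to both remainders, so that the inner
    product of u and v differs from that of their projections by that of their
    remainders; Parseval follows once the remainders tend to zero. *)
Lemma fourier_ip u v N : sqint u -> supp_cell u -> sqint v -> supp_cell v ->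
  ip u v - (\sum_(k <- freqs N) fcoef u k * (fcoef v k)^*%C) / (2 * pi)%:C%C =
  ip (fun x => u x - fourier_sum u N x) (fun x => v x - fourier_sum v N x).
Proof.
move=> su cu sv cv; have sru := sqint_rest N su; have srv := sqint_rest N sv.
have sfu := sqint_cell_sum (fun k => fcoef u k / (2 * pi)%:C%C) N.
rewrite (ipBl su sfu srv) (fourier_rest_orth_sum _ _ sv cv) subr0.
rewrite (ipC srv su).
have sfv := sqint_cell_sum (fun k => fcoef v k / (2 * pi)%:C%C) N.
rewrite (ipBl sv sfv su) conjcB -(ipC sv su); congr (_ - _).
rewrite (ip_cell_sum _ _ su) conjc_sum mulr_suml; apply: eq_bigr => k _.
rewrite (ipC su (sqint_cell_expi k)) (ip_fcoef k cu).
rewrite -[RHS]/((fcoef v k / (2 * pi)%:C%C * (fcoef u k)^*%C)^*%C).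
by rewrite !conjcM conjcK conjc_inv conjc_real; ring.
Qed.

Lemma bessel u N : sqint u -> supp_cell u ->
  \sum_(k <- freqs N) normc (fcoef u k) ^+ 2 <= 2 * pi * sqnorm u.
Proof.
move=> su cu; have := fourier_ip N su cu su cu; rewrite !ip_sqnorm.
have -> : \sum_(k <- freqs N) fcoef u k * (fcoef u k)^*%C =
   (\sum_(k <- freqs N) normc (fcoef u k) ^+ 2)%:C%C.
  by rewrite rmorph_sum; apply: eq_bigr => k _; rewrite normc_mulJ.
rewrite -fmorphV -rmorphM -rmorphB => /(@complexI R) h.
have p0 : 0 < 2 * pi :> R by rewrite mulr_gt0// pi_gt0.
have := sqnorm_ge0 (fun x => u x - fourier_sum u N x); rewrite -h subr_ge0.
by rewrite ler_pdivrMr// mulrC.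
Qed.

(** Pythagoras: the Fourier sum is the orthogonal projection. *)
Lemma fourier_best u N c : sqint u -> supp_cell u ->
  sqnorm (fun x => u x - fourier_sum u N x) <=
  sqnorm (fun x => u x - cell_sum c N x).
Proof.
move=> su cu; pose w x := u x - fourier_sum u N x.
pose e k := fcoef u k / (2 * pi)%:C%C - c k.
have sw : sqint w := sqint_rest N su.
have sq := sqint_cell_sum e N.
have -> : (fun x => u x - cell_sum c N x) = (fun x => w x + cell_sum e N x).
  apply/funext => x; rewrite /w /fourier_sum /cell_sum -addrA; congr (_ + _).
  rewrite [X in _ + X](_ : _ = \sum_(k <- freqs N) fcoef u k / (2 * pi)%:C%C * cell_expi k x
      - \sum_(k <- freqs N) c k * cell_expi k x).
    by rewrite addrA addNr add0r.
  by rewrite -sumrB; apply: eq_bigr => k _; rewrite mulrBl.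
have h0 : ip (cell_sum e N) w = 0 by exact: fourier_rest_orth_sum.
have h1 : ip w (cell_sum e N) = 0 by rewrite (ipC sq sw) h0 conjc0.
rewrite -lecR -!ip_sqnorm (ipDl sw sq (sqintD sw sq)).
rewrite (ipC (sqintD sw sq) sw) (ipC (sqintD sw sq) sq).
rewrite !(ipDl sw sq) // h0 h1 addr0 add0r -(ipC sw sw) -(ipC sq sq) lerDl.
by rewrite ip_sqnorm ler0c sqnorm_ge0.
Qed.

End FourierCell.

(** * Completeness of the exponentials *)

Section Completeness.
Variable R : realType.
Notation T := (lebesgueType R).
Notation mu := (@completed_lebesgue_measure R).
Implicit Types (f g u v : R -> R[i]) (x t : R) (k l : int) (N M : nat).

(** Approximation with all large numbers of frequencies, rather than with some,
    lets the approximations of finitely many functions be added. *)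
Definition approximable u : Prop := sqint u /\ forall e, 0 < e ->
  exists N0, forall N, (N0 <= N)%N -> exists c,
    sqnorm (fun x => u x - cell_sum c N x) <= e.

Lemma approximable_closed u : sqint u ->
  (forall e, 0 < e -> exists2 v, approximable v & sqnorm (fun x => u x - v x) <= e) ->
  approximable u.
Proof.
move=> su h; split=> // e e0; have e4 : 0 < e / 4 by rewrite divr_gt0.
have [v [sv av] uv] := h _ e4; have [N0 hN] := av _ e4.
exists N0 => N /hN[c hc]; exists c.
rewrite (_ : (fun x => _) = fun x => (u x - v x) + (v x - cell_sum c N x)); last first.
  by apply/funext => x; rewrite subrKA.
have := sqnormD (sqintB su sv) (sqintB sv (sqint_cell_sum c N)).
move=> /le_trans; apply; lra.
Qed.

Lemma cell_sumD c c' N x :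
  cell_sum (fun k => c k + c' k) N x = cell_sum c N x + cell_sum c' N x :> R[i].
Proof. by rewrite /cell_sum -big_split; apply: eq_bigr => k _; rewrite mulrDl. Qed.

Lemma cell_sumZ z c N x :
  cell_sum (fun k => z * c k) N x = z * cell_sum c N x :> R[i].
Proof. by rewrite /cell_sum mulr_sumr; apply: eq_bigr => k _; rewrite mulrA. Qed.

Lemma approximableD u v : approximable u -> approximable v ->
  approximable (fun x => u x + v x).
Proof.
move=> [su au] [sv av]; split; first exact: sqintD.
move=> e e0; have e4 : 0 < e / 4 by rewrite divr_gt0.
have [N0 hN0] := au _ e4; have [N1 hN1] := av _ e4.
exists (maxn N0 N1) => N; rewrite geq_max => /andP[/hN0[c hc] /hN1[c' hc']].
exists (fun k => c k + c' k).
rewrite (_ : (fun x => _) = fun x => (u x - cell_sum c N x) + (v x - cell_sum c' N x)).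
  have := sqnormD (sqintB su (sqint_cell_sum c N)) (sqintB sv (sqint_cell_sum c' N)).
  by move=> /le_trans; apply; lra.
by apply/funext => x; rewrite cell_sumD; ring.
Qed.

Lemma approximableZ z u : approximable u -> approximable (fun x => z * u x).
Proof.
move=> [su au]; split; first exact: sqintZ.
move=> e e0; have z0 : 0 < normc z ^+ 2 + 1 by rewrite ltr_wpDl ?sqr_ge0.
have [N0 hN0] := au _ (divr_gt0 e0 z0); exists N0 => N /hN0[c hc].
exists (fun k => z * c k).
rewrite (_ : (fun x => _) = fun x => z * (u x - cell_sum c N x)).
  rewrite (sqnormZ z (sqintB su (sqint_cell_sum c N))).
  rewrite (le_trans (ler_wpM2l (sqr_ge0 _) hc))//.
  by rewrite mulrCA ger_pMr// ler_pdivrMr// mul1r lerDl.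
by apply/funext => x; rewrite cell_sumZ mulrBr.
Qed.

Lemma approximable0 : approximable (fun=> 0 : R[i]).
Proof.
split; first exact: sqint0.
move=> e e0; exists 0%N => N _; exists (fun=> 0).
rewrite (_ : (fun x => _) = fun=> 0); last first.
  by apply/funext => x; rewrite /cell_sum big1 ?subr0// => k _; rewrite mul0r.
rewrite /sqnorm normc0 expr0n /= Rintegral_cst//.
by rewrite mul0r ltW.
Qed.

Lemma approximable_sum I (r : seq I) (F : I -> R -> R[i]) :
  (forall i, approximable (F i)) -> approximable (fun x => \sum_(i <- r) F i x).
Proof.
move=> aF; elim: r => [|i r ih].
  by under eq_fun do rewrite big_nil; exact: approximable0.
by under eq_fun do rewrite big_cons; exact: (approximableD (aF i) ih).
Qed.

Lemma approximable_cell_expi k : approximable (@cell_expi R k).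
Proof.
split; first exact: sqint_cell_expi.
move=> e e0; exists `|k|%N.+1 => N kN; exists (fun l => (l == k)%:R).
rewrite (_ : (fun x => _) = fun=> 0); last first.
  apply/funext => x; rewrite /cell_sum (bigD1_seq k) ?freqs_uniq ?mem_freqs//=; last lia.
  rewrite eqxx mul1r big1 ?addr0 ?subrr// => l /negbTE ->.
  by rewrite mul0r.
rewrite /sqnorm normc0 expr0n /= Rintegral_cst//.
by rewrite mul0r ltW.
Qed.

(** A Fejer mean is a trigonometric polynomial, being a combination of translates
    of the squared modulus of a Dirichlet kernel. *)
Lemma approximable_fejer (F : R -> R[i]) M :
  approximable (fun x => cell x * fejer_mean F M x).
Proof.
pose z := (M%:R ^- 2 : R)%:C%C.
rewrite (_ : (fun x => _) = fun x => z * (\sum_(m <- enum 'I_M) F (node M m) *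
  \sum_(i <- enum 'I_M) \sum_(j <- enum 'I_M)
     expi (- ((i%:Z - j%:Z)%:~R * node M m)) * cell_expi (i%:Z - j%:Z) x)).
  apply: approximableZ; apply: approximable_sum => m; apply: approximableZ.
  apply: approximable_sum => i; apply: approximable_sum => j; apply: approximableZ.
  exact: approximable_cell_expi.
apply/funext => x; rewrite /fejer_mean mulrCA; congr (_ * _).
rewrite mulr_sumr big_enum /=; apply: eq_bigr => m _.
rewrite mulrCA dirichlet_sqr; congr (_ * _).
rewrite mulr_sumr big_enum /=; apply: eq_bigr => i _.
rewrite mulr_sumr big_enum /=; apply: eq_bigr => j _.
by rewrite /cell_expi mulrCA -expiD; congr (_ * expi _); ring.
Qed.

Lemma cvg0_sqr (w : nat -> R) : w @ \oo --> 0 -> w n ^+ 2 @[n --> \oo] --> 0.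
Proof.
move=> h; have hh : (fun n => w n * w n) @ \oo --> 0 * (0 : R) by exact: cvgM.
by rewrite mulr0 in hh; exact: hh.
Qed.

Lemma ae_neq (a : R) : {ae mu, forall x : R, x <> a}.
Proof.
apply/ae_lebP; rewrite (_ : ~` _ = [set a]); last first.
  by apply/seteqP; split => x /=; [move/contrapT|move=> -> /(_ erefl)].
by exists [set a]; split; [exact: measurable_set1|exact: lebesgue_measure_set1|].
Qed.

(** The representative of x modulo 2 pi in the cell. *)
Definition cell_mod x : R := x - 2 * pi * (Num.floor (x / (2 * pi)))%:~R.

Lemma cell_mod_id x : 0 <= x < 2 * pi -> cell_mod x = x.
Proof.
move=> /andP[x0 xp]; have p0 : 0 < 2 * pi :> R by rewrite mulr_gt0// pi_gt0.
rewrite /cell_mod (_ : Num.floor _ = 0) ?mulr0 ?subr0//.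
apply: floor_def; rewrite add0r divr_ge0//= ?ltr_pdivrMr ?mul1r//.
exact: ltW.
Qed.

Lemma cell_modDz x (n : int) : cell_mod (x + 2 * pi * n%:~R) = cell_mod x.
Proof.
have p0 : 2 * pi != 0 :> R by rewrite mulf_neq0// gt_eqF// pi_gt0.
have -> : cell_mod (x + 2 * pi * n%:~R) =
    x + 2 * pi * n%:~R - 2 * pi * (Num.floor (x / (2 * pi)) + n)%:~R.
  congr (_ - _ * (_)%:~R).
  rewrite (_ : (x + _) / _ = x / (2 * pi) + n%:~R); last first.
    by rewrite mulrDl; congr (_ + _); rewrite mulrAC divff// mul1r.
  by rewrite floorDrz ?intr_int// intrKfloor.
by rewrite /cell_mod intrD; ring.
Qed.

(** The periodic extension of g may jump at the multiples of 2 pi, but Fejer means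
    still converge at the other points and stay bounded by one, which is enough
    for dominated convergence. *)
Lemma approximable_continuous (g : R -> R) : continuous g ->
  (forall x, 0 <= g x <= 1) -> approximable (fun x => cell x * (g x)%:C%C).
Proof.
move=> gc g01; pose F x : R[i] := (g (cell_mod x))%:C%C.
have gB x : normc ((g x)%:C%C : R[i]) <= 1.
  by rewrite normc_real; have /andP[h1 h2] := g01 x; rewrite ger0_norm.
have mg : cmeasurable (fun x => (g x)%:C%C : R[i]).
  exact/cmeasurable_continuous/ccontinuous_real.
have su : sqint (fun x => cell x * (g x)%:C%C).
  by apply: (@cell_bounded_sqint _ _ 1 mg) => x _; exact: gB.
apply: approximable_closed => // e e0.
pose v n x := cell x * fejer_mean F n.+1 x.
have av n : approximable (v n) by exact: approximable_fejer.
suff : sqnorm (fun x => cell x * (g x)%:C%C - v n x) @[n --> \oo] --> (0 : R).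
  move=> /cvgrPdist_lt/(_ _ e0)[n _ /(_ n (leqnn n))].
  rewrite /= sub0r normrN ger0_norm ?sqnorm_ge0// => h.
  by exists (v n) => //; exact: ltW.
have -> : (0 : R) = \int[mu]_x 0 by rewrite Rintegral_cst// mul0r.
apply: (@real_dominated R _ (fun=> 0) (fun x => 4 * (cellb x)%:R)).
- by move=> n; apply: normc_sqr_measurable; case: (sqintB su (proj1 (av n))).
- exact: measurable_cst.
- apply: ae_leb_imp (@ae_neq 0) => x x0.
  have [cx|cx] := boolP (cellb x); last first.
    rewrite (_ : (fun n => _) = fun=> 0); first exact: cvg_cst.
    by apply/funext => n; rewrite /v /cell (negbTE cx) !mul0r subrr normc0 expr0n.
  have /andP[x_ge0 xp] := cx; have x_gt0 : 0 < x by rewrite lt_neqAle x_ge0 andbT eq_sym; exact/eqP.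
  have Fx : F x = (g x)%:C%C by rewrite /F cell_mod_id// x_ge0.
  have : normc (fejer_mean F n.+1 x - F x) @[n --> \oo] --> (0 : R).
    rewrite (cvg_shiftS (fun n => normc (fejer_mean F n x - F x))).
    apply: (@fejer_mean_cvg R F 1).
    - by move=> y n; rewrite /F cell_modDz.
    - by move=> y; exact: gB.
    - move=> d d0; have /cvgrPdist_lt/(_ _ d0)/nbhs_ballP[r /= r0 hr] := gc x.
      exists (Num.min r (Num.min x (2 * pi - x))).
        by rewrite !lt_min r0 x_gt0 subr_gt0.
      move=> y; rewrite !lt_min => /andP[yr /andP[yx yp]].
      have yc : 0 <= y < 2 * pi by move: yx yp; rewrite !ltr_norml; lra.
      change (normc ((g (cell_mod y))%:C%C - (g (cell_mod x))%:C%C : R[i]) < d).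
      rewrite (cell_mod_id yc) (cell_mod_id (introT andP (conj x_ge0 xp))).
      rewrite -rmorphB normc_real distrC; apply: hr.
      by rewrite /ball/= distrC.
  move=> h; rewrite (_ : (fun n => _) = fun n => normc (fejer_mean F n.+1 x - F x) ^+ 2).
    exact: cvg0_sqr.
  by apply/funext => n; rewrite /v /cell cx !mul1r -Fx (normcBC (F x)).
- exact: (lintegrableZ 4 (@lintegrable_cell R)).
- move=> n x; rewrite ger0_norm ?sqr_ge0// /v -mulrBr normcM normc_nat.
  case: (cellb x); last by rewrite mul0r mulr0 expr0n.
  rewrite mul1r mulr1 (_ : 4 = 2 ^+ 2 :> R); last by rewrite expr2 -natrM.
  apply: lerXn2r; rewrite ?nnegrE ?normc_ge0//.
  rewrite (le_trans (normcB _ _))// -[2]/(1 + 1) lerD//.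
  by apply: normc_fejer_mean => // y; exact: gB.
Unshelve. all: by end_near. Qed.

Lemma borel_ge0_integral (f : R -> \bar R) :
  measurable_fun [set: measurableTypeR R] f -> (forall x, (0 <= f x)%E) ->
  (\int[mu]_x f x = \int[@lebesgue_measure R]_x f x)%E.
Proof.
move=> mf f0.
have mid : measurable_fun [set: T] (idfun : T -> measurableTypeR R).
  by move=> _ A mA; rewrite setTI; exact: borel_lebesgue.
have := @ge0_integral_pushforward _ _ T (measurableTypeR R) R _ mid mu
  setT f measurableT mf (fun x _ => f0 x).
by rewrite preimage_setT => <-; exact: eq_measure_integral.
Qed.

(** Continuous functions approximate an indicator in the mean; clipped to
    [0, 1], they also do so in the quadratic mean. *)
Lemma approximable_borel (X : set R) :
  measurable (X : set (measurableTypeR R)) ->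
  approximable (fun x => cell x * (\1_X x)%:C%C).
Proof.
move=> mX; pose I : set (measurableTypeR R) := `[0, 2 * pi[%classic.
have mI : measurable I by exact: measurable_itv.
have muI : (lebesgue_measure I < +oo)%E.
  by rewrite lebesgue_measure_itv/=; case: ifP => _; rewrite ltry.
have iX : (@lebesgue_measure R).-integrable I (EFin \o \1_X).
  apply: measurable_bounded_integrable => //.
  exists 1; split=> // y y1 x _ /=.
  by rewrite ger0_norm// (le_trans _ (ltW y1))// indicE lern1 leq_b1.
have [g_ [gc gi glim]] := approximation_continuous_integrable mI muI iX.
have mXT : measurable (X : set T) by exact: borel_lebesgue.
have mX1 : lmeasurable (\1_X : R -> R) by exact: measurable_indic.
have su : sqint (fun x => cell x * (\1_X x)%:C%C : R[i]).
  apply: (@cell_bounded_sqint _ _ 1 (cmeasurable_real mX1)) => x _.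
  by rewrite normc_real indicE ger0_norm// lern1 leq_b1.
apply: approximable_closed => // e e0.
(* for a difference in [-1, 1] the square is at most the absolute value *)
pose h n x := Num.min (Num.max (g_ n x) 0) 1.
have h01 n x : 0 <= h n x <= 1 by rewrite /h le_min le_max lexx orbT ler01/= ge_min lexx orbT.
have hc n : continuous (h n).
  move=> x; apply: (@continuous_min _ _ (fun x => Num.max (g_ n x) 0) (fun=> 1)).
    apply: (@continuous_max _ _ (g_ n) (fun=> 0)); [exact: gc|exact: cvg_cst].
  exact: cvg_cst.
have ah n := approximable_continuous (hc n) (h01 n).
pose G n x : R := (cellb x)%:R * `|\1_X x - g_ n x|.
have mG n : measurable_fun [set: measurableTypeR R] (G n).
  apply: measurable_funM.
    rewrite (_ : (fun x => _) = \1_I); first exact: measurable_indic.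
    by apply/funext => x; rewrite indicE mem_setE in_itv.
  apply: measurableT_comp => //; apply: measurable_funB; first exact: measurable_indic.
  exact: continuous_measurable_fun.
have GE n : (\int[mu]_x (G n x)%:E =
    \int[@lebesgue_measure R]_(z in I) `|(\1_X z - g_ n z)%:E|)%E.
  rewrite borel_ge0_integral; first last.
  - by move=> x; rewrite lee_fin mulr_ge0.
  - exact/measurable_EFinP.
  rewrite [RHS]integral_mkcond; apply: eq_integral => x _.
  rewrite /G patchE mem_setE in_itv/= -/(cellb x); case: (cellb x).
    by rewrite mul1r.
  by rewrite mul0r.
have [n hn] : exists n, (\int[mu]_x (G n x)%:E < e%:E)%E.
  have /fine_cvgP[_ /cvgrPdist_lt/(_ _ e0)[n1 _ hn1]] := glim.
  have /fine_cvgP[[n2 _ hn2] _] := glim.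
  exists (maxn n1 n2); rewrite GE -[X in (X < _)%E]fineK; last exact: (hn2 _ (leq_maxr _ _)).
  rewrite lte_fin; have := hn1 _ (leq_maxl n1 n2); rewrite /= sub0r normrN.
  exact: le_lt_trans (ler_norm _).
exists (fun x => cell x * (h n x)%:C%C) => //.
have [mr nr] := sqintB su (proj1 (ah n)).
rewrite -lee_fin /sqnorm /Rintegral fineK; last exact: (integrable_fin_num measurableT nr).
apply: (le_trans _ (ltW hn)); apply: (@ge0_le_integral _ T R mu setT measurableT).
- by move=> x _; rewrite lee_fin sqr_ge0.
- by case/integrableP : nr.
- apply/measurable_EFinP => _ B mB; apply: borel_lebesgue; exact: mG.
- move=> x _; rewrite lee_fin /G -mulrBr normcM normc_nat -rmorphB normc_real exprMn.
  case: (cellb x); last by rewrite expr0n !mul0r.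
  rewrite expr1n !mul1r; have /andP[h0 h1] := h01 n x.
  have i01 : (\1_X x : R) = 0 \/ (\1_X x : R) = 1.
    have [xX|xX] := pselect (X x); [right|left]; rewrite indicE.
      by rewrite mem_set.
    by rewrite memNset.
  move: (\1_X x : R) i01 => z i01.
  apply: (@le_trans _ _ `|z - h n x|).
    rewrite expr2; apply: ler_piMl; first exact: normr_ge0.
    by rewrite ler_norml; case: i01 => zE; rewrite zE; apply/andP; split; lra.
  have a1 := ler_norm (z - g_ n x); have a2 := lerNnormlW (lexx `|z - g_ n x|).
  have a3 := normr_ge0 (z - g_ n x); move: (`|z - g_ n x|) a1 a2 a3 => a a1 a2 a3.
  rewrite /h ler_norml; apply/andP; split; case: (lerP (g_ n x) 0) => h2;
    case: (lerP _ 1) => h3; case: i01 => zE; lra.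
Qed.

End Completeness.

(** * Parseval's identity on one period *)

Section Parseval.
Import finmap HBNNSimple.
Variable R : realType.
Notation T := (lebesgueType R).
Notation mu := (@completed_lebesgue_measure R).
Implicit Types (f g u v : R -> R[i]) (x t : R) (k l : int) (N M : nat).

Lemma sqnorm_ae0 f : sqint f -> {ae mu, forall x : R, f x = 0} -> sqnorm f = 0.
Proof.
move=> sf f0; apply: (@complexI R); rewrite -ip_sqnorm.
have m0 : cmeasurable (fun=> 0 : R[i]) by exact: cmeasurable_cst.
rewrite /ip (cintegral_ae (proj1 (sqint_mulJ sf sf)) m0); first exact: cintegral0.
by apply: ae_leb_imp f0 => x ->; rewrite mul0r.
Qed.

Lemma sqint_cell_bounded_real (h : R -> R) : lmeasurable h ->
  lintegrable (fun x => (cellb x)%:R * h x ^+ 2) ->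
  sqint (fun x => cell x * (h x)%:C%C).
Proof.
move=> mh ih; apply: (sqint_le _ ih).
  exact: (cmeasurableM (@cmeasurable_cell R) (cmeasurable_real mh)).
move=> x; rewrite normcM normc_nat normc_real exprMn real_normK ?num_real//.
by case: (cellb x); rewrite ?expr1n ?expr0n.
Qed.

Lemma approximable_lebesgue (A : set R) : measurable (A : set T) ->
  approximable (fun x => cell x * (\1_A x)%:C%C).
Proof.
move=> mA; have [X [N [mX nN AE]]] := lebesgue_split mA.
have aX := approximable_borel mX.
have mA1 : lmeasurable (\1_A : R -> R) by exact: measurable_indic.
have sA : sqint (fun x => cell x * (\1_A x)%:C%C : R[i]).
  apply: (@cell_bounded_sqint _ _ 1 (cmeasurable_real mA1)) => x _.
  by rewrite normc_real indicE ger0_norm// lern1 leq_b1.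
apply: (approximable_closed sA) => e e0.
exists (fun x => cell x * (\1_X x)%:C%C) => //.
rewrite (sqnorm_ae0 (sqintB sA (proj1 aX))) ?ltW//.
apply/ae_lebP; apply: negligibleS nN => x /= h; apply: contrapT => nx.
apply: h; rewrite -mulrBr -rmorphB !indicE AE.
have [xX|xX] := pselect (X x); first by rewrite !mem_set ?subrr ?mulr0//; left.
by rewrite !memNset ?subrr ?mulr0// => -[].
Qed.

(** By simple functions increasing to h and dominated convergence. *)
Lemma approximable_nonneg (h : R -> R) : lmeasurable h -> (forall x, 0 <= h x) ->
  lintegrable (fun x => (cellb x)%:R * h x ^+ 2) ->
  approximable (fun x => cell x * (h x)%:C%C).
Proof.
move=> mh h0 ih; have sh := sqint_cell_bounded_real mh ih.
have mh' : measurable_fun [set: T] (fun x => (h x)%:E) by exact/measurable_EFinP.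
pose sn n : {nnsfun T >-> R} := nnsfun_approx measurableT mh' n.
pose s n : R -> R := fun x : T => sn n x.
have as_ n : approximable (fun x => cell x * (s n x)%:C%C).
  rewrite (_ : (fun x => _) = fun x => \sum_(y <- fset_set (range (sn n)))
      y%:C%C * (cell x * (\1_(sn n @^-1` [set y]) x)%:C%C)).
    apply: approximable_sum => y; apply: approximableZ; apply: approximable_lebesgue.
    exact: measurable_sfunP.
  apply/funext => x; rewrite /s {1}(fimfunE (sn n) x) fsbig_finite//=.
  rewrite rmorph_sum mulr_sumr; apply: eq_bigr => y _.
  by rewrite rmorphM mulrCA.
have sh_cvg x : s n x @[n --> \oo] --> h x.
  have := @cvg_nnsfun_approx _ _ _ _ measurableT _ mh' (fun y _ => h0 y) x I.
  by move=> /fine_cvgP[_]; exact.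
have sh_le n x : 0 <= s n x <= h x.
  rewrite {1}/s fun_ge0 /= -(cvg_lim (@Rhausdorff R) (@sh_cvg x)).
  apply: nondecreasing_cvgn_le; last by apply/cvg_ex; exists (h x); exact: sh_cvg.
  by move=> a b ab; have /lefP := nd_nnsfun_approx measurableT mh' ab; exact.
apply: (approximable_closed sh) => e e0.
suff : sqnorm (fun x => cell x * (h x)%:C%C - cell x * (s n x)%:C%C) @[n --> \oo]
    --> (0 : R).
  move=> /cvgrPdist_lt/(_ _ e0)[n _ /(_ n (leqnn n))].
  rewrite /= sub0r normrN ger0_norm ?sqnorm_ge0// => hn.
  by exists (fun x => cell x * (s n x)%:C%C) => //; exact: ltW.
have -> : (0 : R) = \int[mu]_x 0 by rewrite Rintegral_cst// mul0r.
have E n x : normc (cell x * (h x)%:C%C - cell x * (s n x)%:C%C) ^+ 2 =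
    (cellb x)%:R * (h x - s n x) ^+ 2.
  rewrite -mulrBr -rmorphB normcM normc_nat normc_real exprMn real_normK ?num_real//.
  by case: (cellb x); rewrite ?expr1n ?expr0n.
apply: (@real_dominated R _ (fun=> 0) (fun x => (cellb x)%:R * h x ^+ 2)).
- by move=> n; apply: normc_sqr_measurable; case: (sqintB sh (proj1 (as_ n))).
- exact: measurable_cst.
- apply: ae_leb_all => x; under eq_fun do rewrite E.
  have hx : (fun n => h x - s n x) @ \oo --> (0 : R).
    by rewrite -[X in _ --> X](subrr (h x)); apply: cvgB (sh_cvg x); exact: cvg_cst.
  have c0 : (cellb x)%:R @[n --> \oo] --> ((cellb x)%:R : R) by exact: cvg_cst.
  have hh : (fun n => (cellb x)%:R * (h x - s n x) ^+ 2) @ \oo --> (cellb x)%:R * (0 : R).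
    by apply: cvgM c0 (cvg0_sqr hx).
  by rewrite mulr0 in hh.
- exact: ih.
- move=> n x; rewrite E.
  have nn : 0 <= (cellb x)%:R * (h x - s n x) ^+ 2.
    by apply: mulr_ge0 => //; exact: sqr_ge0.
  rewrite (ger0_norm nn); apply: ler_wpM2l => //.
  have /andP[s0 s1] := sh_le n x; apply: lerXn2r; rewrite ?nnegrE ?subr_ge0//.
  by rewrite gerBl.
Qed.

(** From nonnegative functions by splitting real and imaginary parts into
    positive and negative parts. *)
Lemma approximable_sqint u : sqint u -> supp_cell u -> approximable u.
Proof.
move=> su cu; have [[mR mI] nu] := su.
have part (h : R -> R) : lmeasurable h -> (forall x, `|h x| <= normc (u x)) ->
    approximable (fun x => cell x * (Num.max (h x) 0)%:C%C).
  move=> mh hu.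
  have mp : lmeasurable (fun x => Num.max (h x) 0).
    apply: (@lmeasurable_continuous_comp R h (fun y => Num.max y 0)) => //.
    by move=> y; apply: (@continuous_max _ _ id (fun=> 0)); [exact: cvg_id|exact: cvg_cst].
  have bp x : 0 <= Num.max (h x) 0 <= normc (u x).
    rewrite le_max lexx orbT /= ge_max normc_ge0 andbT.
    exact: le_trans (ler_norm _) (hu x).
  apply: (approximable_nonneg mp); first by move=> x; case/andP: (bp x).
  apply: (lintegrable_le _ nu).
    exact: (lmeasurableM (lintegrable_measurable (@lintegrable_cell R)) (lmeasurableM mp mp)).
  move=> x; rewrite ger0_norm; last by rewrite mulr_ge0// sqr_ge0.
  case: (cellb x); last by rewrite mul0r sqr_ge0.
  have /andP[b0 b1] := bp x.
  by rewrite mul1r lerXn2r// nnegrE normc_ge0.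
have mN (h : R -> R) : lmeasurable h -> lmeasurable (fun x => - h x).
  move=> mh; have := lmeasurableB (@measurable_cst _ _ T R setT 0 : lmeasurable (fun=> 0)) mh.
  by rewrite (_ : (fun x => 0 - h x) = fun x => - h x)//; apply/funext => x; rewrite sub0r.
have a1 := part _ mR (fun x => Re_le_normc (u x)).
have a3 := part _ mI (fun x => Im_le_normc (u x)).
have a2 : approximable (fun x => cell x * (Num.max (- complex.Re (u x)) 0)%:C%C).
  by apply: part => [|x]; [exact: mN|rewrite normrN Re_le_normc].
have a4 : approximable (fun x => cell x * (Num.max (- complex.Im (u x)) 0)%:C%C).
  by apply: part => [|x]; [exact: mN|rewrite normrN Im_le_normc].
have := approximableD (approximableD a1 (approximableZ (-1) a2))
  (approximableZ 'i%C (approximableD a3 (approximableZ (-1) a4))).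
rewrite (_ : (fun x => _) = u)//; apply/funext => x.
have posneg (y : R) : Num.max y 0 - Num.max (- y) 0 = y.
  by case: (lerP y 0) => y0; case: (lerP (- y) 0) => y1; lra.
rewrite [RHS](cu x) !mulN1r -!mulrBr -!rmorphB !posneg mulrCA -mulrDr mulrC.
by congr (_ * _); rewrite [RHS]complexE.
Qed.

Lemma fourier_rest_cvg u : sqint u -> supp_cell u ->
  sqnorm (fun x => u x - fourier_sum u N x) @[N --> \oo] --> (0 : R).
Proof.
move=> su cu; have [_ au] := approximable_sqint su cu.
apply/cvgrPdist_lt => e e0; have e2 : 0 < e / 2 by rewrite divr_gt0.
have [N0 hN] := au _ e2; exists N0 => // N /= /hN[c hc].
rewrite sub0r normrN ger0_norm ?sqnorm_ge0//.
rewrite (le_lt_trans (fourier_best N c su cu))// (le_lt_trans hc)//.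
by rewrite gtr_pMr// invf_lt1// ltr1n.
Qed.

Lemma parseval_cell u v : sqint u -> supp_cell u -> sqint v -> supp_cell v ->
  \sum_(k <- freqs N) fcoef u k * (fcoef v k)^*%C @[N --> \oo] -->
  (2 * pi)%:C%C * ip u v.
Proof.
move=> su cu sv cv; apply/cvg_complexP.
have pi2 : (2 * pi)%:C%C != 0 :> R[i].
  by rewrite (inj_eq (@complexI R) _ 0) mulf_neq0// gt_eqF// pi_gt0.
pose w N := 2 * pi * (2 * (sqnorm (fun x => u x - fourier_sum u N x) +
   sqnorm (fun x => v x - fourier_sum v N x))).
apply: (@squeeze_cvgr _ _ _ _ (fun=> 0) w).
- near=> N; rewrite normc_ge0/= normcBC.
  have := fourier_ip N su cu sv cv; set S := \sum_(k <- _) _ => h.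
  have -> : (2 * pi)%:C%C * ip u v - S = (2 * pi)%:C%C *
      ip (fun x => u x - fourier_sum u N x) (fun x => v x - fourier_sum v N x).
    by rewrite -h mulrBr [X in _ = _ - X]mulrCA divff// mulr1.
  rewrite normcM normc_real ger0_norm ?mulr_ge0 ?pi_ge0// ler_wpM2l ?mulr_ge0 ?pi_ge0//.
  exact: normc_ip (sqint_rest N su) (sqint_rest N sv).
- exact: cvg_cst.
- have h : (fun N => 2 * pi * (2 * (sqnorm (fun x => u x - fourier_sum u N x) +
      sqnorm (fun x => v x - fourier_sum v N x)))) @ \oo --> 2 * pi * (2 * (0 + 0) : R).
    apply: cvgM; first exact: cvg_cst.
    apply: cvgM; first exact: cvg_cst.
    by apply: cvgD; exact: fourier_rest_cvg.
  by rewrite addr0 !mulr0 in h.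
Unshelve. all: by end_near. Qed.

(** The finite sums over frequencies below are compared through the finitely many
    frequencies that contribute. *)
Lemma big_uniq_supp (I : eqType) (V : nmodType) (s1 s2 : seq I) (F : I -> V) :
  uniq s1 -> uniq s2 ->
  (forall i, F i != 0 -> (i \in s1) && (i \in s2)) ->
  \sum_(i <- s1) F i = \sum_(i <- s2) F i.
Proof.
move=> u1 u2 h; rewrite [LHS](bigID (fun i => F i != 0)) [RHS](bigID (fun i => F i != 0))/=.
rewrite [X in _ + X]big1 ?[X in _ = _ + X]big1 ?addr0; first last.
- by move=> i; rewrite negbK => /eqP.
- by move=> i; rewrite negbK => /eqP.
rewrite -!(big_filter _ (fun i => F i != 0)); apply: perm_big.
apply: uniq_perm; rewrite ?filter_uniq// => i; rewrite !mem_filter.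
by case: (boolP (F i != 0)) => //= /h/andP[-> ->].
Qed.

Lemma ler_sum_uniq_sub (I : eqType) (s1 s2 : seq I) (F : I -> R) :
  uniq s1 -> uniq s2 -> {subset s1 <= s2} -> (forall i, 0 <= F i) ->
  \sum_(i <- s1) F i <= \sum_(i <- s2) F i.
Proof.
move=> u1 u2 s12 F0; rewrite [leRHS](bigID (mem s1))/=.
have p : perm_eq [seq i <- s2 | mem s1 i] s1.
  apply: uniq_perm; rewrite ?filter_uniq// => i; rewrite mem_filter/= andb_idr//.
  exact: s12.
rewrite -(big_filter _ (mem s1)) (perm_big _ p) /= lerDl.
by apply: sumr_ge0 => i _; exact: F0.
Qed.

Lemma abs_summable_bound (w : int -> R[i]) (B : R) :
  (forall N, \sum_(k <- freqs N) normc (w k) <= B) -> abs_summable w.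
Proof.
move=> wB; rewrite /abs_summable /summable.
apply: (@le_lt_trans _ _ B%:E); last exact: ltry.
apply: ub_ereal_sup => _ /= [A [fA _] <-]; rewrite fsbig_finite//=.
pose N := (\max_(k <- fset_set A) `|k|.+1)%N.
rewrite (eq_bigr (fun k => (normc (w k))%:E)); last first.
  by move=> k _; rewrite /= ger0_norm ?normc_ge0.
rewrite sumEFin lee_fin; apply: le_trans (wB N); apply: ler_sum_uniq_sub.
- exact: fset_uniq.
- exact: freqs_uniq.
- move=> k kA; rewrite mem_freqs; have : (`|k|.+1 <= N)%N.
    exact: (@leq_bigmax_seq _ _ xpredT (fun k : int => `|k|.+1) k kA isT).
  lia.
- by move=> k; exact: normc_ge0.
Qed.

Lemma sumZ_freqs (w : int -> R[i]) (l : R[i]) :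
  \sum_(k <- freqs N) w k @[N --> \oo] --> l -> sumZ w = l.
Proof.
move=> h; apply: limc_unique; rewrite (_ : (fun N => _) = fun N => \sum_(k <- freqs N) w k)//.
by apply/funext => N; rewrite big_freqs.
Qed.

Lemma parseval_summable u v : sqint u -> supp_cell u -> sqint v -> supp_cell v ->
  exists B, forall N,
    \sum_(k <- freqs N) normc (fcoef u k * (fcoef v k)^*%C) <= B.
Proof.
move=> su cu sv cv; exists (2 * pi * sqnorm u + 2 * pi * sqnorm v) => N.
apply: le_trans (lerD (bessel N su cu) (bessel N sv cv)); rewrite -big_split.
apply: ler_sum => k _; have := normcM_le (fcoef u k) ((fcoef v k)^*%C).
by rewrite normc_conj.
Qed.

End Parseval.

(** * Parseval's identity for compactly supported functions *)

Section LineParseval.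
Variable R : realType.
Notation T := (lebesgueType R).
Notation mu := (@completed_lebesgue_measure R).
Implicit Types (f g h u v : R -> R[i]) (x t A : R) (k l : int) (N M K : nat).

Lemma cellb_shift x (m : int) :
  cellb (x - 2 * pi * m%:~R) = (m == Num.floor (x / (2 * pi))).
Proof.
have p0 : 0 < 2 * pi :> R by rewrite mulr_gt0// pi_gt0.
rewrite eq_sym floor_eq /cellb subr_ge0 ltrBlDr ler_pdivlMr// ltr_pdivrMr//.
rewrite [(m + 1)%:~R]intrD (_ : (m%:~R + 1) * _ = 2 * pi + 2 * pi * m%:~R); last by ring.
by rewrite (mulrC m%:~R).
Qed.

Lemma cell_cover x M : `|x| < 2 * pi * M%:R ->
  \sum_(m <- freqs M) cell (x - 2 * pi * m%:~R) = 1 :> R[i].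
Proof.
move=> xM; have p0 : 0 < 2 * pi :> R by rewrite mulr_gt0// pi_gt0.
pose n := Num.floor (x / (2 * pi)).
have nM : n \in freqs M.
  rewrite mem_freqs; move: xM; rewrite ltr_norml => /andP[x1 x2].
  apply/andP; split.
    by rewrite /n floor_ge_int mulrNz ler_pdivlMr// mulNr mulrC ltW.
  rewrite -(ltr_int R); apply: le_lt_trans (floor_le _) _.
  by rewrite ltr_pdivrMr// mulrC.
rewrite (bigD1_seq n nM (freqs_uniq M))/= /cell cellb_shift eqxx big1 ?addr0// => m mn.
by rewrite cellb_shift -/n (negbTE mn).
Qed.

Lemma cmeasurable_shift h t : cmeasurable h -> cmeasurable (fun x => h (x + t)).
Proof.
move=> mh; have := cmeasurable_affine t (oner_neq0 R) mh.
by under eq_fun do rewrite mul1r.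
Qed.

Lemma cintegrable_shift h t : cintegrable h -> cintegrable (fun x => h (x + t)).
Proof.
move=> mh; have := cintegrable_affine t (oner_neq0 R) mh.
by under eq_fun do rewrite mul1r.
Qed.

Lemma sqint_shift h t : sqint h -> sqint (fun x => h (x + t)).
Proof.
move=> [mh ih]; split; first exact: cmeasurable_shift.
have := lintegrable_affine t (oner_neq0 R) ih.
by under eq_fun do rewrite mul1r.
Qed.

Lemma cintegrable_cell h : cintegrable h -> cintegrable (fun x => cell x * h x).
Proof.
move=> [mh ih]; apply: (cintegrable_le _ ih).
  exact: (cmeasurableM (@cmeasurable_cell R) mh).
move=> x; rewrite normcM normc_nat; case: (cellb x); rewrite ?mul1r//.
by rewrite mul0r normc_ge0.
Qed.

Lemma sqint_cell h : sqint h -> sqint (fun x => cell x * h x).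
Proof.
move=> [mh ih]; apply: (sqint_le _ ih).
  exact: (cmeasurableM (@cmeasurable_cell R) mh).
move=> x; rewrite normcM normc_nat; case: (cellb x); rewrite ?mul1r//.
by rewrite mul0r expr0n sqr_ge0.
Qed.

(** The translates of the cell tile the support of h. *)
Lemma unfold_cells h M : cintegrable h ->
  (forall x, 2 * pi * M%:R <= `|x| -> h x = 0) ->
  \sum_(m <- freqs M) cintegral (fun x => cell x * h (x + 2 * pi * m%:~R)) =
  cintegral h.
Proof.
move=> ih h0.
have ic m : cintegrable (fun x => cell (x - 2 * pi * m%:~R) * h x).
  have := cintegrable_shift (- (2 * pi * m%:~R))
    (cintegrable_cell (cintegrable_shift (2 * pi * m%:~R) ih)).
  by under eq_fun do rewrite subrK.
transitivity (\sum_(m <- freqs M) cintegral (fun x => cell (x - 2 * pi * m%:~R) * h x)).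
  apply: eq_bigr => m _; rewrite -(cintegral_shift (2 * pi * m%:~R) (proj1 (ic m))).
  by congr cintegral; apply/funext => x; rewrite addrK.
rewrite -cintegral_sum//; congr cintegral; apply/funext => x.
rewrite -mulr_suml; have [xM|xM] := ltrP `|x| (2 * pi * M%:R).
  by rewrite cell_cover// mul1r.
by rewrite h0// mulr0.
Qed.

Definition periodize M u x : R[i] :=
  \sum_(m <- freqs M) cell x * u (x + 2 * pi * m%:~R).

Definition bsupp A u : Prop := forall x, A < `|x| -> u x = 0.

Lemma sqint_periodize M u : sqint u -> sqint (periodize M u).
Proof.
by move=> su; apply: sqint_sum => m; exact: (sqint_cell (sqint_shift _ su)).
Qed.

Lemma supp_periodize M u : supp_cell (periodize M u).
Proof.
move=> x; rewrite /periodize mulr_suml; apply: eq_bigr => m _.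
by rewrite [RHS]mulrAC cell_sqr.
Qed.

Lemma cintegrable_bsupp A u : sqint u -> bsupp A u -> cintegrable u.
Proof.
move=> [mu_ iu] uA.
have i1 := @lintegrable_indic R A.
apply: (cintegrable_le mu_ (lintegrableD i1 iu)) => x.
rewrite indic_itvE; have [xA|xA] := lerP `|x| A; last first.
  by rewrite uA// normc0 expr0n addr0.
by have := sqr_ge0 (normc (u x) - 1); have := sqr_ge0 (normc (u x)); rewrite /=; nra.
Qed.

Lemma cintegrable_mul_expi u (c : R) : cintegrable u ->
  cintegrable (fun x => u x * expi (c * x)).
Proof.
move=> [mu_ iu]; apply: (cintegrable_le _ iu).
  exact: (cmeasurableM mu_ (@cmeasurable_expi R c)).
by move=> x; rewrite normcM normc_expi mulr1.
Qed.

(** Integer frequencies do not see translations by 2 pi. *)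
Lemma fcoef_periodize A M u k : sqint u -> bsupp A u -> A < 2 * pi * M%:R ->
  fcoef (periodize M u) k = fcoef u k.
Proof.
move=> su uA AM; have iu := cintegrable_bsupp su uA.
pose h x := u x * expi (- k%:~R * x).
have ih : cintegrable h := cintegrable_mul_expi _ iu.
have h0 x : 2 * pi * M%:R <= `|x| -> h x = 0.
  by move=> xM; rewrite /h uA ?mul0r// (lt_le_trans AM).
rewrite /fcoef.
rewrite [RHS](_ : _ = cintegral h); last first.
  by congr cintegral; apply/funext => x; rewrite /h mulNr.
rewrite -(unfold_cells ih h0) -cintegral_sum.
  congr cintegral; apply/funext => x; rewrite /periodize mulr_suml.
  apply: eq_bigr => m _; rewrite -mulrA /h.
  rewrite (_ : - k%:~R * _ = - (k%:~R * x) + 2 * pi * (- (k * m))%:~R) ?expiDz//.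
  by rewrite mulrNz intrM; ring.
by move=> m _; exact: (cintegrable_cell (cintegrable_shift _ ih)).
Qed.

(** Expanding both periodizations gives a double sum over cells (m, n); with
    j = n - m, the sum over m unfolds the cell to the line. *)
Lemma ip_periodize A M K u v : sqint u -> sqint v -> bsupp A u -> bsupp A v ->
  A < 2 * pi * M%:R -> (2 * M <= K)%N ->
  ip (periodize M u) (periodize M v) =
  \sum_(j <- freqs K) cintegral (fun x => u x * (v (x + 2 * pi * j%:~R))^*%C).
Proof.
move=> su sv uA vA AM MK.
have sum_ m : sqint (fun x => cell x * u (x + 2 * pi * m%:~R)).
  exact: (sqint_cell (sqint_shift _ su)).
have svm m : sqint (fun x => cell x * v (x + 2 * pi * m%:~R)).
  exact: (sqint_cell (sqint_shift _ sv)).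
pose G (j : int) x := u x * (v (x + 2 * pi * j%:~R))^*%C.
have iG j : cintegrable (G j) := sqint_mulJ su (sqint_shift _ sv).
pose I m j := cintegral (fun x => cell x * G j (x + 2 * pi * m%:~R)).
have I0 m j : m \in freqs M -> I m j != 0 -> (m + j)%R \in freqs M.
  move=> mM; apply: contraR => mjM; rewrite /I; apply/eqP.
  rewrite -(@cintegral0 R); congr cintegral; apply/funext => x.
  have [cx|cx] := boolP (cellb x); last by rewrite /cell (negbTE cx) mul0r.
  rewrite /G (vA (x + 2 * pi * m%:~R + 2 * pi * j%:~R)) ?conjc0 ?mulr0//.
  apply: (lt_le_trans AM); rewrite -addrA -mulrDr -intrD.
  move: mjM cx; rewrite mem_freqs negb_and -!ltNge /cellb => mj /andP[x0 xp].
  have pp := pi_gt0 R; have [mj1|mj1] : (m + j + 1 <= - M%:Z)%R \/ (M%:Z <= m + j)%R.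
    by case/orP: mj => ?; [left|right]; lia.
    have {}mj1 : (m + j)%:~R + 1 <= - M%:R :> R.
      by rewrite -[1]/(1%:~R) -intrD -[M%:R]/(M%:Z%:~R) -mulrNz ler_int.
    by rewrite ler_normr; apply/orP; right; nra.
  have {}mj1 : M%:R <= (m + j)%:~R :> R by rewrite -[M%:R]/(M%:Z%:~R) ler_int.
  by rewrite ler_normr; apply/orP; left; nra.
transitivity (\sum_(m <- freqs M) \sum_(n <- freqs M) I m (n - m)%R).
  rewrite (ip_suml _ sum_ (sqint_periodize M sv)); apply: eq_bigr => m _.
  rewrite (ipC (sqint_periodize M sv) (sum_ m)) (ip_suml _ svm (sum_ m)) conjc_sum.
  apply: eq_bigr => n _; rewrite -(ipC (svm n) (sum_ m)) /ip /I.
  congr cintegral; apply/funext => x.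
  rewrite /G conjcM cellJ mulrACA cell_sqr -[in RHS]addrA -mulrDr -intrD.
  by rewrite (addrC m) subrK.
transitivity (\sum_(m <- freqs M) \sum_(j <- freqs K) I m j).
  rewrite big_seq [RHS]big_seq; apply: eq_bigr => m mM.
  rewrite -(big_map (fun n => n - m)%R xpredT (I m)); apply: big_uniq_supp.
  - by rewrite map_inj_uniq ?freqs_uniq// => a b /addIr.
  - exact: freqs_uniq.
  - move=> j /(I0 _ _ mM) mj; apply/andP; split.
      by apply/mapP; exists (m + j)%R => //; lia.
    by move: mj mM; rewrite !mem_freqs; lia.
rewrite exchange_big; apply: eq_bigr => j _; apply: unfold_cells; first exact: iG.
by move=> x xM; rewrite /G uA ?mul0r// (lt_le_trans AM).
Qed.

Lemma parseval_line A M K u v : sqint u -> sqint v -> bsupp A u -> bsupp A v ->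
  A < 2 * pi * M%:R -> (2 * M <= K)%N ->
  (exists B, forall N,
    \sum_(k <- freqs N) normc (fcoef u k * (fcoef v k)^*%C) <= B) /\
  \sum_(k <- freqs N) fcoef u k * (fcoef v k)^*%C @[N --> \oo] -->
  (2 * pi)%:C%C *
    \sum_(j <- freqs K) cintegral (fun x => u x * (v (x + 2 * pi * j%:~R))^*%C).
Proof.
move=> su sv uA vA AM MK.
have pu := sqint_periodize M su; have pv := sqint_periodize M sv.
have cu := @supp_periodize M u; have cv := @supp_periodize M v.
have eu k := fcoef_periodize k su uA AM; have ev k := fcoef_periodize k sv vA AM.
split.
  have [B hB] := parseval_summable pu cu pv cv; exists B => N.
  by have := hB N; under eq_bigr do rewrite eu ev.
rewrite -(ip_periodize su sv uA vA AM MK).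
have := parseval_cell pu cu pv cv; rewrite (_ : (fun N => _) = fun N =>
  \sum_(k <- freqs N) fcoef u k * (fcoef v k)^*%C)//.
by apply/funext => N; apply: eq_bigr => k _; rewrite eu ev.
Qed.

End LineParseval.

(** * Frame coefficients as Fourier coefficients *)

Section FrameSum.
Variable R : realType.
Notation T := (lebesgueType R).
Notation mu := (@completed_lebesgue_measure R).
Implicit Types (f g h u v phi tphi : R -> R[i]) (x t A lam : R) (k l : int).

Lemma L2loc_loc_integrable h : L2loc h <->
  cmeasurable h /\ loc_integrable (fun x => normc (h x) ^+ 2).
Proof.
have cut (A : R) : (\int[mu]_x `|((`|x| <= A)%R%:R * normc (h x) ^+ 2)%:E| =
    \int[mu]_(x in (`[(- A)%R, A]%classic : set T)) (normc (h x) ^+ 2)%:E)%E.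
  rewrite [RHS]integral_mkcond; apply: eq_integral => x _.
  rewrite patchE mem_setE in_itv/= -ler_norml ger0_norm; last first.
    by apply: mulr_ge0 => //; exact: sqr_ge0.
  by case: (_ <= _); rewrite ?mul1r ?mul0r.
split=> [[mh ih]|[mh [_ ih]]]; split=> //.
  split=> [|A]; first exact: normc_sqr_measurable.
  apply/integrableP; split.
    exact/measurable_EFinP/lmeasurable_cut/normc_sqr_measurable.
  by rewrite cut; exact: (ih _ (@segment_compact _ _ _)).
move=> K cK; have [M [_ KM]] := compact_bounded cK.
pose A := `|M| + 1.
have KA : K `<=` `[- A, A]%classic.
  move=> x Kx /=; rewrite in_itv/= -ler_norml; apply: (KM A) => //.
  by rewrite /A (le_lt_trans (ler_norm _))// ltrDl.
have mh2 : measurable_fun [set: T] (fun x => (normc (h x) ^+ 2)%:E).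
  exact/measurable_EFinP/normc_sqr_measurable.
have mK : measurable (K : set T) by apply: borel_lebesgue; exact: compact_measurable.
have mA := @itvcc_measurable R A.
apply: (@le_lt_trans _ _ (\int[mu]_(x in (`[(- A)%R, A]%classic : set T)) (normc (h x) ^+ 2)%:E)%E).
  apply: (@ge0_subset_integral _ T R mu _ _ mK mA) => //.
  - exact: (measurable_funS measurableT _ mh2).
  - by move=> x _; rewrite lee_fin sqr_ge0.
by rewrite -cut; case/integrableP : (ih A).
Qed.

(** What the frame expansion requires of f and g. *)
Definition bounded_supported f A : Prop :=
  [/\ cmeasurable f, bsupp A f & exists B, forall x, normc (f x) <= B].

(** After dilation, the frame coefficients of f against phi are the Fourier
    coefficients of this function. *)
Lemma sqint_window f phi lam A : lam != 0 -> 0 <= A -> bounded_supported f A ->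
  L2loc phi -> sqint (fun x => (f (x / lam))^*%C * phi x).
Proof.
move=> l0 A0 [mf fA [B fB]] /L2loc_loc_integrable[mphi [_ iphi]].
have mfl : cmeasurable (fun x => f (x / lam)).
  have li0 : lam^-1 != 0 by rewrite invr_neq0.
  have := cmeasurable_affine 0 li0 mf.
  by under eq_fun do rewrite addr0 mulrC.
apply: (sqint_le _ (lintegrableZ (B ^+ 2) (iphi (A * `|lam|)))).
  exact: (cmeasurableM (cmeasurableJ mfl) mphi).
move=> x; rewrite normcM normc_conj exprMn.
have [xA|xA] := lerP `|x| (A * `|lam|).
  rewrite mul1r ler_wpM2r ?sqr_ge0// lerXn2r ?nnegrE ?normc_ge0//.
  exact: le_trans (normc_ge0 _) (fB 0).
rewrite fA ?normc0 ?expr0n ?mul0r ?mulr0//.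
by rewrite normrM normfV ltr_pdivlMr// normr_gt0.
Qed.

Lemma bsupp_window f phi lam A : lam != 0 -> bsupp A f ->
  bsupp (A * `|lam|) (fun x => (f (x / lam))^*%C * phi x).
Proof.
move=> l0 fA x xA; rewrite fA ?conjc0 ?mul0r//.
by rewrite normrM normfV ltr_pdivlMr// normr_gt0.
Qed.

(** The j-th term of the periodized inner product: f meets the translate of g by
    2 pi j / lam. *)
Definition overlap f g lam phi tphi (j : int) : R[i] :=
  cintegral (fun x => f x * (phi (lam * x))^*%C *
    ((g (x + 2 * pi * j%:~R / lam))^*%C * tphi (lam * x + 2 * pi * j%:~R))).

Lemma frame_term_fcoef f g lam phi tphi A k : lam != 0 -> 0 <= A ->
  bounded_supported f A -> bounded_supported g A -> L2loc phi -> L2loc tphi ->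
  frame_term f g lam phi tphi k = (`|lam|^-1)%:C%C *
   (fcoef (fun x => (f (x / lam))^*%C * phi x) k *
    (fcoef (fun x => (g (x / lam))^*%C * tphi x) k)^*%C)^*%C.
Proof.
move=> l0 A0 bf bg Lphi Ltphi.
have ln0 : `|lam| != 0 by rewrite normr_eq0.
have lamK x : lam * x / lam = x by rewrite mulrAC divff// mul1r.
pose u x := (f (x / lam))^*%C * phi x; pose v x := (g (x / lam))^*%C * tphi x.
have su : sqint u := sqint_window l0 A0 bf Lphi.
have sv : sqint v := sqint_window l0 A0 bg Ltphi.
have iu := cintegrable_bsupp su (bsupp_window phi l0 (let: And3 _ b _ := bf in b)).
have iv := cintegrable_bsupp sv (bsupp_window tphi l0 (let: And3 _ b _ := bg in b)).
pose q : R[i] := (Num.sqrt `|lam|)%:C%C.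
have qJ : q^*%C = q by exact: conjc_real.
have iuk := cintegrable_mul_expi (- k%:~R) iu.
have ivk := cintegrable_mul_expi (- k%:~R) iv.
have P1 : pairing f (dilmod lam k phi) = (`|lam|^-1)%:C%C * q * (fcoef u k)^*%C.
  pose F x := q * (u x * expi (- k%:~R * x))^*%C.
  have iF : cintegrable F := cintegrableZ q (cintegrableJ iuk).
  rewrite /pairing (_ : cintegral _ = cintegral (fun x => F (lam * x + 0))).
    rewrite (cintegral_affine 0 l0 (proj1 iF)) (cintegralZ q (cintegrableJ iuk)).
    rewrite (cintegralJ iuk) mulrA; congr (_ * _ ^*%C).
    by congr cintegral; apply/funext => x; rewrite mulNr.
  congr cintegral; apply/funext => x; rewrite addr0 /F /u /dilmod.
  rewrite lamK !conjcM conjcK qJ mulNr.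
  by rewrite (mulrA k%:~R); ring.
have P2 : pairing (dilmod lam k tphi) g = (`|lam|^-1)%:C%C * q * fcoef v k.
  pose F x := q * (v x * expi (- k%:~R * x)).
  have iF : cintegrable F := cintegrableZ q ivk.
  rewrite /pairing (_ : cintegral _ = cintegral (fun x => F (lam * x + 0))).
    rewrite (cintegral_affine 0 l0 (proj1 iF)) (cintegralZ q ivk) mulrA.
    by congr (_ * cintegral _); apply/funext => x; rewrite mulNr.
  congr cintegral; apply/funext => x; rewrite addr0 /F /v /dilmod.
  rewrite lamK mulNr.
  by rewrite (mulrA k%:~R); ring.
rewrite /frame_term P1 P2 conjcM conjcK -/u -/v.
have qq : q * q = (`|lam|)%:C%C by rewrite -rmorphM -expr2 sqr_sqrtr.
transitivity ((`|lam|^-1)%:C%C * ((`|lam|^-1)%:C%C * (q * q)) *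
  ((fcoef u k)^*%C * fcoef v k)); first by ring.
by rewrite qq -rmorphM mulVf// mulr1.
Qed.

(** The frame coefficients are Fourier coefficients at integer frequencies, hence
    those of a periodization; Parseval turns their sum into finitely many
    overlap integrals. *)
Lemma frame_sum f g lam phi tphi A M K : lam != 0 -> 0 <= A ->
  bounded_supported f A -> bounded_supported g A -> L2loc phi -> L2loc tphi ->
  A * `|lam| < 2 * pi * M%:R -> (2 * M <= K)%N ->
  abs_summable (frame_term f g lam phi tphi) /\
  sumZ (frame_term f g lam phi tphi) =
    (2 * pi)%:C%C * \sum_(j <- freqs K) overlap f g lam phi tphi j.
Proof.
move=> l0 A0 bf bg Lphi Ltphi AM MK.
pose u x := (f (x / lam))^*%C * phi x; pose v x := (g (x / lam))^*%C * tphi x.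
have su : sqint u := sqint_window l0 A0 bf Lphi.
have sv : sqint v := sqint_window l0 A0 bg Ltphi.
have uA := bsupp_window phi l0 (let: And3 _ b _ := bf in b).
have vA := bsupp_window tphi l0 (let: And3 _ b _ := bg in b).
have tE k := frame_term_fcoef k l0 A0 bf bg Lphi Ltphi.
have lamK x : lam * x / lam = x by rewrite mulrAC divff// mul1r.
have [[B hB] hlim] := parseval_line su sv uA vA AM MK.
split.
  apply: (@abs_summable_bound R _ (`|lam|^-1 * B)) => N.
  under eq_bigr do rewrite tE normcM normc_conj.
  rewrite -mulr_sumr normc_real ger0_norm ?invr_ge0// ler_wpM2l ?invr_ge0//.
apply: sumZ_freqs.
set S := _ * _ in hlim.
have -> : (2 * pi)%:C%C * \sum_(j <- freqs K) overlap f g lam phi tphi j =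
    (`|lam|^-1)%:C%C * S^*%C.
  rewrite /S conjcM conjc_real mulrCA; congr (_ * _).
  rewrite conjc_sum mulr_sumr; apply: eq_bigr => j _.
  have iG := sqint_mulJ su (sqint_shift (2 * pi * j%:~R) sv).
  rewrite -(cintegralJ iG) -(cintegral_affine 0 l0 (proj1 (cintegrableJ iG))).
  congr cintegral; apply/funext => x; rewrite addr0 conjcM conjcK /u /v conjcM conjcK.
  by rewrite [in RHS](mulrDl (lam * x)) lamK.
apply/cvg_complexP.
rewrite (_ : (fun N => _) = fun N => `|lam|^-1 *
  normc (\sum_(k <- freqs N) fcoef u k * (fcoef v k)^*%C - S)).
  have h : (fun N => `|lam|^-1 *
      normc (\sum_(k <- freqs N) fcoef u k * (fcoef v k)^*%C - S)) @ \oo --> `|lam|^-1 * 0.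
    by apply: cvgM; [exact: cvg_cst|exact/cvg_complexP].
  by rewrite mulr0 in h.
apply/funext => N; under eq_bigr do rewrite tE.
rewrite -mulr_sumr -mulrBr -conjc_sum -conjcB normcM normc_conj normc_real.
by rewrite ger0_norm ?invr_ge0.
Qed.

End FrameSum.

(** * Smooth real functions *)

Section Smooth.
Variable R : realType.
Implicit Types (f g : R -> R) (x : R) (n m k : nat) (c : nat -> R).

(** Smooth functions are handled through this recursive form of
    differentiability up to order n: unlike a statement on the n-th
    derivative, it makes closure under products and compositions immediate by
    induction on n, without any Leibniz or Faa di Bruno formula. *)
Fixpoint cn n f : Prop := if n is m.+1 then
  exists f', (forall x, is_derive x 1 f (f' x)) /\ cn m f' else True.

Definition smooth f := forall n, cn n f.

Lemma cnS n f : cn n.+1 f -> cn n f.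
Proof.
elim: n f => // n IH f [f' [df cf]]; exists f'; split => //.
by apply: IH.
Qed.

Lemma cn_derivable n f x : cn n.+1 f -> derivable (derive1n n f) x 1.
Proof.
elim: n f => [|n IH] f [f' [df cf]]; first exact: ex_derive.
rewrite derive1Sn; have -> : f^`()%classic = f'; last exact: IH.
by apply/funext => y; rewrite derive1E derive_val.
Qed.

Lemma smoothP f :
  smooth f <-> forall n x, derivable (derive1n n f) x 1.
Proof.
split=> [sf n x|df n]; first exact: cn_derivable.
suff H m : cn n (derive1n m f) by exact: (H 0%N).
elim: n m => // n IH m; exists (derive1n m.+1 f); split => // x.
by apply: DeriveDef => //; rewrite derive1nS derive1E.
Qed.

Lemma cn_cst n (a : R) : cn n (fun=> a).
Proof. by elim: n a => // n IH a; exists (fun=> 0); split => // x; exact: is_derive_cst. Qed.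

Lemma cn_id n : cn n (fun x => x).
Proof.
case: n => // n; exists (fun=> 1); split; last exact: cn_cst.
by move=> x; exact: is_derive_id.
Qed.

Lemma cnD n f g : cn n f -> cn n g -> cn n (fun x => f x + g x).
Proof.
elim: n f g => // n IH f g [f' [df cf]] [g' [dg cg]].
exists (fun x => f' x + g' x); split; last exact: IH.
by move=> x; have := is_deriveD (df x) (dg x).
Qed.

Lemma cnM n f g : cn n f -> cn n g -> cn n (fun x => f x * g x).
Proof.
elim: n f g => // n IH f g fn gn.
have [f' [df cf]] := fn; have [g' [dg cg]] := gn.
exists (fun x => f x * g' x + g x * f' x); split.
  by move=> x; have := is_deriveM (df x) (dg x).
by apply: cnD; apply: IH => //; exact: cnS.
Qed.

Lemma cn_comp n f g : cn n f -> cn n g -> cn n (fun x => f (g x)).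
Proof.
elim: n f g => // n IH f g [f' [df cf]] gn; have [g' [dg cg]] := gn.
exists (fun x => f' (g x) * g' x); split.
  by move=> x; exact: is_derive1_comp (df (g x)) (dg x).
by apply: cnM => //; apply: IH => //; exact: cnS.
Qed.

Lemma cnV n f : (forall x, f x != 0) -> cn n f -> cn n (fun x => (f x)^-1).
Proof.
move=> f0; elim: n => // n IH fn; have [f' [df cf]] := fn.
exists (fun x => - 1 * ((f x)^-1 * (f x)^-1) * f' x); split.
  move=> x; have := is_deriveV (f0 x) (df x).
  by rewrite -exprVn expr2 mulN1r.
have i := IH (cnS fn).
by do 2! (apply: cnM => //); [exact: cn_cst|exact: cnM].
Qed.

Lemma cn_derive n f f' : (forall x, is_derive x 1 f (f' x)) -> cn n f' -> cn n f.
Proof. by move=> df cf; apply: cnS; exists f'. Qed.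

(** Quadratic flatness at the origin makes the difference quotients vanish. *)
Lemma is_derive_flat0 f C : f 0 = 0 -> (forall x, `|x| <= 1 -> `|f x| <= C * x ^+ 2) ->
  is_derive (0 : R) 1 f 0.
Proof.
move=> f0 fC.
have C0 : 0 <= C by have := fC 1; rewrite normr1 lexx expr1n mulr1 => /(_ isT); apply: le_trans.
suff h : h^-1 *: ((f \o shift 0) (h *: 1) - f 0) @[h --> (0 : R)^'] --> (0 : R).
  apply: DeriveDef; first by apply/cvg_ex; exists 0.
  by rewrite /derive; apply/cvg_lim.
apply/cvgrPdist_le => e e0; near=> h.
have h0 : h != 0 by near: h; exact: nbhs_dnbhs_neq.
have hs : `|h| <= Num.min 1 (e / (C + 1)).
  near: h; apply: dnbhs0_le; rewrite lt_min ltr01/= divr_gt0// ltr_wpDl//.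
move: hs; rewrite le_min => /andP[h1 he].
rewrite /= f0 subr0 sub0r normrN addr0 /GRing.scale/= mulr1 normrM normfV.
rewrite ler_pdivrMl ?normr_gt0// (le_trans (fC _ h1))//.
rewrite -real_normK ?num_real// expr2 mulrCA ler_wpM2l//.
move: he; rewrite ler_pdivlMr ?ltr_wpDl// => he; apply: le_trans he.
by rewrite mulrC ler_wpM2l// lerDl.
Unshelve. all: by end_near. Qed.

(** The flat function exp(-1/x) alone is not stable under differentiation;
    the family obtained with the factors x^-k is, up to linear
    combinations. *)
Definition flat k x : R := if 0 < x then x^-1 ^+ k * expR (- x^-1) else 0.

Lemma flat_bound k x : `|flat k x| <= (k.+2`!)%:R * x ^+ 2.
Proof.
rewrite /flat; case: ifP => x0; last by rewrite normr0 mulr_ge0 ?ler0n ?sqr_ge0.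
have y0 : 0 < x^-1 by rewrite invr_gt0.
rewrite ger0_norm ?mulr_ge0 ?expR_ge0 ?exprn_ge0 ?(ltW y0)//.
rewrite expRN ler_pdivrMr ?expR_gt0//.
have h := expR_ge1Dxn k.+1 (ltW y0).
have F0 : 0 < (k.+2)`!%:R :> R by rewrite ltr0n fact_gt0.
have -> : x^-1 ^+ k = x ^+ 2 * x^-1 ^+ k.+2.
  by rewrite -[k.+2]addn2 exprD [x^-1 ^+ 2]exprVn; field; rewrite gt_eqF.
rewrite [leRHS](_ : _ = x ^+ 2 * ((k.+2)`!%:R * expR x^-1)); last by ring.
rewrite ler_wpM2l ?sqr_ge0// -ler_pdivrMl// mulrC.
by apply: le_trans h; rewrite lerDr.
Qed.

Lemma is_derive_flat k x :
  is_derive x 1 (flat k) (- k%:R * flat k.+1 x + flat k.+2 x).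
Proof.
have [x0|x0|->] := ltgtP x 0.
- apply: (@near_eq_is_derive _ _ _ (fun=> 0)).
    near=> y; rewrite /flat; case: ifP => // y0.
    suff : y < 0 by rewrite ltNge ltW.
    by near: y; exact: lt_nbhsl.
  by rewrite /flat ltNge (ltW x0)/= mulr0 addr0; exact: is_derive_cst.
- apply: (@near_eq_is_derive _ _ _ (fun y : R => y^-1 ^+ k * expR (- y^-1))).
    near=> y; rewrite /flat; case: ifP => // /negP[].
    by near: y; exact: lt_nbhsr.
  rewrite /flat x0.
  have dV : is_derive x 1 (fun y : R => y^-1) (- x ^- 2).
    have := is_deriveV (lt0r_neq0 x0) (is_derive_id x 1).
    by rewrite /GRing.scale/= mulr1.
  have dN := is_deriveN dV.
  have dE : is_derive x 1 (fun y : R => expR (- y^-1)) (expR (- x^-1) * x ^- 2).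
    have := @is_derive1_comp _ expR (fun y : R => - y^-1) x _ _
      (is_derive_expR (- x^-1)) dN.
    by rewrite opprK.
  have dX := is_deriveX k dV.
  have := is_deriveM dX dE.
  rewrite [X in is_derive _ _ X](_ : _ = fun y : R => y^-1 ^+ k * expR (- y^-1)); last first.
    by apply/funext => y; rewrite !fctE.
  set D := (X in is_derive _ _ _ X -> _) => hD.
  suff <- : D = - k%:R * (x^-1 ^+ k.+1 * expR (- x^-1)) + x^-1 ^+ k.+2 * expR (- x^-1) by [].
  rewrite /D !fctE /GRing.scale/= -exprVn.
  case: (k) => [|m]; first by rewrite !expr0; ring.
  by rewrite /= !exprS; ring.
- rewrite /flat ltxx mulr0 addr0.
  apply: (@is_derive_flat0 _ (k.+2`!)%:R); first by rewrite /flat ltxx.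
  by move=> y _; exact: flat_bound.
Unshelve. all: by end_near. Qed.

Lemma cn_flat n k : cn n (flat k).
Proof.
elim: n k => // n IH k; eexists; split; first exact: is_derive_flat.
by apply: cnD => //; apply: cnM => //; exact: cn_cst.
Qed.

(** The usual transition function, 0 on the left of 0 and 1 on the right of 1. *)
Definition step x : R := flat 0 x / (flat 0 x + flat 0 (1 - x)).

Lemma flat_ge0 k x : 0 <= flat k x.
Proof.
rewrite /flat; case: ifP => // x0.
by rewrite mulr_ge0 ?expR_ge0 ?exprn_ge0 ?invr_ge0 ?(ltW x0).
Qed.

Lemma flat_gt0 k x : 0 < x -> 0 < flat k x.
Proof.
by move=> x0; rewrite /flat x0 mulr_gt0 ?expR_gt0 ?exprn_gt0 ?invr_gt0.
Qed.

Lemma step_den x : 0 < flat 0 x + flat 0 (1 - x).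
Proof.
have [x0|x0] := ltP 0 x; first by rewrite ltr_pwDl ?flat_gt0 ?flat_ge0.
by rewrite ltr_wpDl ?flat_gt0 ?flat_ge0//; lra.
Qed.

Lemma smooth_step : smooth step.
Proof.
move=> n; apply: cnM; first exact: cn_flat.
apply: (cnV (fun x => lt0r_neq0 (step_den x))).
apply: cnD; first exact: cn_flat.
apply: (cn_comp (cn_flat n 0)).
apply: cnD; first exact: cn_cst.
apply: (@cn_derive n _ (fun=> -1)); last exact: cn_cst.
Qed.

Lemma step_ge0 x : 0 <= step x.
Proof. by rewrite /step divr_ge0 ?flat_ge0// ltW// step_den. Qed.

Lemma step_le1 x : step x <= 1.
Proof. by rewrite /step ler_pdivrMr ?step_den// mul1r lerDl flat_ge0. Qed.

Lemma step_eq0 x : x <= 0 -> step x = 0.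
Proof. by move=> x0; rewrite /step {1}/flat ltNge x0/= mul0r. Qed.

Lemma step_eq1 x : 1 <= x -> step x = 1.
Proof.
move=> x1; rewrite /step; have -> : flat 0 (1 - x) = 0.
  by rewrite /flat subr_gt0 ltNge x1.
by rewrite addr0 divff// gt_eqF// flat_gt0//; lra.
Qed.

(** The coefficients of an entire function, by the root test. *)
Definition entire c := forall rho, 0 < rho ->
  exists B, forall m, `|c m| * rho ^+ m <= B.

(** The factor m + 1 <= 2 ^ (m + 1) is absorbed by doubling the radius. *)
Lemma entire_diffs c : entire c -> entire (pseries_diffs c).
Proof.
move=> ec rho rho0; have [|B hB] := ec (2 * rho); first by rewrite mulr_gt0.
exists (B / rho) => m; rewrite /pseries_diffs normrM ler_pdivlMr// -mulrA -exprSr.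
rewrite ger0_norm ?ler0n//; apply: le_trans (hB m.+1).
rewrite exprMn [leRHS](_ : _ = 2 ^+ m.+1 * (`|c m.+1| * rho ^+ m.+1)); last by ring.
rewrite -mulrA ler_wpM2r ?mulr_ge0 ?exprn_ge0 ?(ltW rho0)// -natrX ler_nat.
exact: ltnW (ltn_expl _ _).
Qed.

Lemma entire_summable c x : entire c -> cvgn (series (fun m => `|c m| * `|x| ^+ m)).
Proof.
move=> ec; have [|B hB] := ec (2 * `|x| + 1); first by rewrite ltr_wpDl ?mulr_ge0.
have B0 : 0 <= B by apply: le_trans (hB 0%N); rewrite mulr_ge0.
apply: (@series_le_cvg _ _ (geometric B 2^-1)).
- by move=> m; rewrite mulr_ge0 ?exprn_ge0.
- by move=> m; rewrite /geometric/= mulr_ge0 ?exprn_ge0 ?invr_ge0.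
- move=> m; rewrite /geometric/= exprVn ler_pdivlMr ?exprn_gt0//.
  apply: le_trans (hB m); rewrite -mulrA ler_wpM2l// -exprMn lerXn2r ?nnegrE ?addr_ge0 ?mulr_ge0//.
  by rewrite mulrC lerDl.
- apply: (@is_cvg_geometric_series R B 2^-1).
  by rewrite ger0_norm ?invr_ge0// invf_lt1 ?ltr1n.
Qed.

Lemma entire_cvg c x : entire c -> cvgn (pseries c x).
Proof.
move=> ec; apply: normed_cvg; rewrite /normed_series_of /=.
under eq_fun do rewrite normrM normrX.
exact: entire_summable.
Qed.

(** Termwise differentiation stays in the class, so induction applies. *)
Lemma smooth_entire c : entire c -> smooth (fun x => limn (pseries c x)).
Proof.
move=> + n; elim: n c => // n IH c ec.
exists (fun x => limn (pseries (pseries_diffs c) x)); split; last first.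
  by apply: IH; exact: entire_diffs.
have ec1 := entire_diffs ec; have ec2 := entire_diffs ec1.
move=> x; apply: (@pseries_snd_diffs _ _ (`|x| + 1)); do ?exact: entire_cvg.
by rewrite [ltRHS]ger0_norm ?addr_ge0// ltrDl.
Qed.
End Smooth.

(** * Test functions *)

Section TestFunctions.
Variable R : realType.
Implicit Types (f : R -> R[i]) (g : R -> R) (x A a b : R) (n : nat).

Lemma smoothM g1 g2 : @smooth R g1 -> smooth g2 -> smooth (fun x => g1 x * g2 x).
Proof. by move=> s1 s2 n; exact: cnM. Qed.

Lemma smooth_cst a : smooth (fun=> a).
Proof. by move=> n; exact: cn_cst. Qed.

Lemma smooth_affine g a b : smooth g -> smooth (fun x => g (a * x + b)).
Proof.
move=> sg n; apply: (cn_comp (sg n)).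
by apply: cnD; [apply: cnM; [exact: cn_cst|exact: cn_id]|exact: cn_cst].
Qed.

Lemma smooth_continuous g : smooth g -> continuous g.
Proof.
move=> /smoothP/(_ 0%N) dg x; apply: differentiable_continuous.
by apply/derivable1_diffP; exact: dg.
Qed.

Lemma test_smooth f : test_function f ->
  smooth (fun x => complex.Re (f x)) /\ smooth (fun x => complex.Im (f x)).
Proof. by move=> [fR fI _]; split; apply/smoothP. Qed.

Lemma test_continuous f : test_function f -> ccontinuous f.
Proof. by move=> /test_smooth[fR fI]; split; exact: smooth_continuous. Qed.

Lemma continuous_bounded g A : continuous g ->
  exists B, forall x, `|x| <= A -> `|g x| <= B.
Proof.
move=> cg; have : compact (g @` `[- A, A]%classic).
  apply: continuous_compact; last exact: segment_compact.
  exact: continuous_subspaceT.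
move=> /compact_bounded[M [_ hM]]; exists (M + 1) => x xA.
apply: (hM (M + 1)); first by rewrite ltrDl.
by exists x => //=; rewrite in_itv/= -ler_norml.
Qed.

Lemma ccontinuous_bounded f A : ccontinuous f ->
  exists B, forall x, `|x| <= A -> normc (f x) <= B.
Proof.
move=> [fR fI]; have [B hB] := continuous_bounded A fR.
have [C hC] := continuous_bounded A fI.
exists (B + C) => x xA; apply: le_trans (normc_le_ReIm _) _.
by rewrite lerD ?hB ?hC.
Qed.

Lemma test_bounded_supported f : test_function f ->
  exists2 A, 0 <= A & bounded_supported f A.
Proof.
move=> tf; have cf := test_continuous tf; have [_ _ /compact_bounded[M [_ hM]]] := tf.
have sA : bsupp (`|M| + 1) f.
  move=> x Ax; apply/eqP; apply/negPn/negP => fx0.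
  move: Ax; rewrite ltNge; move/negP; apply.
  apply: (hM (`|M| + 1)); last exact: subset_closure.
  by rewrite (le_lt_trans (ler_norm _))// ltrDl.
exists (`|M| + 1); first by rewrite addr_ge0.
have [B hB] := ccontinuous_bounded (`|M| + 1) cf.
split => //; first exact: cmeasurable_continuous.
exists `|B| => x; have [xA|xA] := leP `|x| (`|M| + 1).
  exact: le_trans (hB x xA) (ler_norm _).
by rewrite sA// normc0.
Qed.

(** A bounded support has compact closure. *)
Lemma test_intro f A : smooth (fun x => complex.Re (f x)) ->
  smooth (fun x => complex.Im (f x)) -> bsupp A f -> test_function f.
Proof.
move=> /smoothP sR /smoothP sI sA; split => //.
apply: (@subclosed_compact _ _ `[- A, A]%classic).
- exact: closed_closure.
- exact: segment_compact.
- rewrite [X in _ `<=` X](closure_id _).1; last exact: itv_closed.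
  apply: closure_subset => x /= fx0; rewrite in_itv/= -ler_norml leNgt.
  by apply/negP => /sA fx; rewrite fx eqxx in fx0.
Qed.

Lemma test_mul_smooth f g : test_function f -> smooth g ->
  test_function (fun x => f x * (g x)%:C%C).
Proof.
move=> tf sg; have [sR sI] := test_smooth tf.
have [A _ [_ sA _]] := test_bounded_supported tf.
apply: (@test_intro _ A); last by move=> x /sA ->; rewrite mul0r.
  under eq_fun do rewrite cReM /= mulr0 subr0; exact: smoothM.
under eq_fun do rewrite cImM /= mulr0 add0r; exact: smoothM.
Qed.

Lemma test_mul f1 f2 : test_function f1 -> test_function f2 ->
  test_function (fun x => f1 x * f2 x).
Proof.
move=> t1 t2; have [sR1 sI1] := test_smooth t1; have [sR2 sI2] := test_smooth t2.
have [A _ [_ sA _]] := test_bounded_supported t1.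
apply: (@test_intro _ A); last by move=> x /sA ->; rewrite mul0r.
  under eq_fun do rewrite cReM -mulN1r mulrA.
  by move=> n; do ![apply: cnD|apply: cnM]; rewrite //; exact: cn_cst.
under eq_fun do rewrite cImM.
by move=> n; do ![apply: cnD|apply: cnM].
Qed.

Lemma test_conj f : test_function f -> test_function (fun x => (f x)^*%C).
Proof.
move=> tf; have [sR sI] := test_smooth tf.
have [A _ [_ sA _]] := test_bounded_supported tf.
apply: (@test_intro _ A); last by move=> x /sA ->; rewrite conjc0.
  by under eq_fun do rewrite cReJ.
under eq_fun do rewrite cImJ -mulN1r.
by apply: smoothM => //; exact: smooth_cst.
Qed.

Lemma test_real g A : smooth g -> (forall x, A < `|x| -> g x = 0) ->
  test_function (fun x => (g x)%:C%C).
Proof.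
by move=> sg sA; apply: (@test_intro _ A) => //=; [exact: smooth_cst|move=> x /sA ->].
Qed.

(** A smooth bump converging pointwise, as n grows, to the indicator of ]a, b[. *)
Definition hat n a b x : R := step (n%:R * (x - a)) * step (n%:R * (b - x)).

Lemma smooth_hat n a b : smooth (hat n a b).
Proof.
rewrite /hat; apply: smoothM.
  have -> : (fun x => step (n%:R * (x - a))) = (fun x => step (n%:R * x + - (n%:R * a))).
    by apply/funext => x; rewrite mulrBr.
  by apply: smooth_affine; exact: smooth_step.
have -> : (fun x => step (n%:R * (b - x))) = (fun x => step ((- n%:R) * x + n%:R * b)).
  by apply/funext => x; congr step; ring.
by apply: smooth_affine; exact: smooth_step.
Qed.

Lemma hat_ge0 n a b x : 0 <= hat n a b x.
Proof. by rewrite mulr_ge0 ?step_ge0. Qed.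

Lemma hat_le1 n a b x : hat n a b x <= 1.
Proof. by rewrite mulr_ile1 ?step_ge0 ?step_le1. Qed.

Lemma hat_out n a b x : ~~ (a < x < b) -> hat n a b x = 0.
Proof.
rewrite negb_and -!leNgt /hat => /orP[xa|bx].
  by rewrite step_eq0 ?mul0r// mulr_ge0_le0// subr_le0.
by rewrite mulrC step_eq0 ?mul0r// mulr_ge0_le0// subr_le0.
Qed.

Lemma hat_eq1 n a b x : 1 <= n%:R * (x - a) -> 1 <= n%:R * (b - x) ->
  hat n a b x = 1.
Proof. by move=> xa bx; rewrite /hat !step_eq1// mulr1. Qed.

Lemma hat_in a b x : a < x < b -> exists N, forall n, (N <= n)%N -> hat n a b x = 1.
Proof.
move=> /andP[ax xb]; pose m := Num.min (x - a) (b - x).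
have m0 : 0 < m by rewrite lt_min !subr_gt0 ax.
exists (Num.truncn m^-1).+1 => n Nn.
have h : 1 <= n%:R * m.
  rewrite -ler_pdivrMr// div1r; apply: le_trans (ltW (truncnS_gt _)) _.
  by rewrite ler_nat.
by apply: hat_eq1; apply: le_trans h _; rewrite ler_wpM2l// ge_min lexx ?orbT.
Qed.

Lemma test_hat n a b : test_function (fun x => (hat n a b x)%:C%C).
Proof.
apply: (@test_real _ (Num.max `|a| `|b|)); first exact: smooth_hat.
move=> x; rewrite gt_max => /andP[ax bx]; apply: hat_out.
apply/negP => /andP[h1 h2]; move: ax bx.
by case: (ger0P x) => hx; case: (ger0P a) => ha; case: (ger0P b) => hb; lra.
Qed.
End TestFunctions.

(** * A gliding hump argument *)

Section GlidingHump.

Lemma geometric_tail (R : realType) (b M : nat) :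
  \sum_(0 <= m < M) 2^-1 ^+ m * (b <= m)%N%:R
    <= 2 * 2^-1 ^+ b - 2 * 2^-1 ^+ maxn M b :> R.
Proof.
elim: M => [|M IH]; first by rewrite big_nil max0n subrr.
rewrite big_nat_recr//=; have [bM|Mb] := leqP b M.
  move: IH; rewrite (maxn_idPl bM) (maxn_idPl (leqW bM)) mulr1 exprS; lra.
by rewrite mulr0 addr0 (maxn_idPr Mb); move: IH; rewrite (maxn_idPr (ltnW Mb)).
Qed.

Variables (R : realType) (t : nat -> nat -> R) (A : R) (L : nat -> nat) (T : nat -> R).
Hypothesis A0 : 0 <= A.
Hypothesis tT : forall J m, `|t J m| <= T m.
Hypothesis tL : forall J m, `|t J m| <= 2 ^+ L J * A ^+ m.
Hypothesis t_bounded : forall c, entire c ->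
  exists B, forall J, `|limn (series (fun m => c m * t J m))| <= B.

(** The bases grow, so that a series with coefficients base_i ^ -m_i is entire,
    and dominate 2A, so that such a series tested against t_J has a tail
    dominated by a geometric series. *)
Let base i : R := (i + (Num.truncn A).*2.+2)%:R.

Let base_ge1 i : 1 <= base i.
Proof. by rewrite /base ler1n addnS. Qed.

Let base_gt0 i : 0 < base i.
Proof. exact: lt_le_trans ltr01 (base_ge1 i). Qed.

Let base_A i : 2 * A <= base i.
Proof.
rewrite /base natrD ler_wpDl// -doubleS -mul2n natrM ler_wpM2l//.
exact: ltW (truncnS_gt _).
Qed.

Section Hump.
Variable F : nat -> nat -> nat * nat.
Hypothesis F_ge : forall i M, (M <= (F i M).2)%N.
Hypothesis F_large : forall i M,
  (i.+2%:R + \sum_(0 <= m < M) T m) * base i ^+ (F i M).2 <= `|t (F i M).1 (F i M).2|.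

(** The choice F i M of a row J and a column m >= M where t exceeds any given
    geometric bound is iterated. The bound mbar_i on the next column lies beyond
    the previous columns and beyond L of the previous rows, which makes the
    later terms negligible on these rows. *)
Let Fixpoint mbar i : nat :=
  if i is k.+1 then ((F k (mbar k)).2 + (L (F k (mbar k)).1)).+1 else 0.
Let mm i := (F i (mbar i)).2.
Let jj i := (F i (mbar i)).1.

Let mbarS i : mbar i.+1 = (mm i + L (jj i)).+1.
Proof. by []. Qed.

Let mbar_mm i : (mbar i <= mm i)%N.
Proof. exact: F_ge. Qed.

Let mbar_le i k : (i <= k)%N -> (mbar i <= mbar k)%N.
Proof.
elim: k => [|k IH]; first by rewrite leqn0 => /eqP ->.
rewrite leq_eqVlt => /orP[/eqP -> //|]; rewrite ltnS => /IH h.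
by rewrite mbarS (leq_trans h)// (leq_trans (mbar_mm k))// leqW// leq_addr.
Qed.

Let mm_lt i k : (i < k)%N -> (mm i < mbar k)%N.
Proof. by move=> ik; apply: leq_trans (mbar_le ik); rewrite mbarS ltnS leq_addr. Qed.

Let mm_inj i k : mm i = mm k -> i = k.
Proof.
move=> e; have [ik|ki|//] := ltngtP i k.
  by have := leq_trans (mm_lt ik) (mbar_mm k); rewrite e ltnn.
by have := leq_trans (mm_lt ki) (mbar_mm i); rewrite e ltnn.
Qed.

Let c (m : nat) : R :=
  if pselect (exists i, mm i == m) is left e then (base (xchoose e))^-1 ^+ m else 0.

Let cE i : c (mm i) = (base i)^-1 ^+ mm i.
Proof.
rewrite /c; case: pselect => [e|[]]; last by exists i.
by have /eqP/mm_inj -> := xchooseP e.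
Qed.

Let cP m : (exists2 i, m = mm i & c m = (base i)^-1 ^+ m) \/
  (forall i, m <> mm i) /\ c m = 0.
Proof.
have [[i /eqP e]|h] := pselect (exists i, mm i == m); [left|right].
  by exists i => //; rewrite -e cE.
split; first by move=> i e; apply: h; exists i; rewrite e.
by rewrite /c; case: pselect.
Qed.

Let c_ge0 m : 0 <= c m.
Proof. by case: (cP m) => [[i _ ->]|[_ ->//]]; rewrite exprn_ge0// invr_ge0 ltW. Qed.

Let c_le1 m : c m <= 1.
Proof.
case: (cP m) => [[i _ ->]|[_ ->//]].
by rewrite exprn_ile1 ?invr_ge0 ?(ltW (base_gt0 i))// invf_le1.
Qed.

Let cA m : c m * A ^+ m <= 2^-1 ^+ m.
Proof.
case: (cP m) => [[i _ ->]|[_ ->]]; last by rewrite mul0r exprn_ge0// invr_ge0.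
rewrite -exprMn lerXn2r ?nnegrE ?mulr_ge0 ?invr_ge0 ?(ltW (base_gt0 i))//.
by rewrite ler_pdivrMl// mulrC ler_pdivlMl// base_A.
Qed.

Let c_entire : entire c.
Proof.
move=> rho rho0; pose i0 := (Num.truncn rho).+1.
have r1 : 1 <= 1 + rho by rewrite lerDl ltW.
exists ((1 + rho) ^+ mbar i0) => m; rewrite ger0_norm//.
case: (cP m) => [[i e ->]|[_ ->]]; last by rewrite mul0r exprn_ge0// (le_trans ler01).
have [ii|ii] := leqP i0 i.
  rewrite -exprMn (le_trans _ (exprn_ege1 _ r1))//.
  rewrite exprn_ile1 ?mulr_ge0 ?invr_ge0 ?(ltW rho0) ?(ltW (base_gt0 i))//.
  rewrite ler_pdivrMl// mulr1; apply: le_trans (ltW (truncnS_gt _)) _.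
  by rewrite /base ler_nat (leq_trans ii)// leq_addr.
apply: (@le_trans _ _ (rho ^+ m)).
  rewrite ler_piMl ?exprn_ge0 ?(ltW rho0)//.
  by rewrite exprn_ile1 ?invr_ge0 ?(ltW (base_gt0 i))// invf_le1.
apply: (@le_trans _ _ ((1 + rho) ^+ m)).
  by rewrite lerXn2r ?nnegrE ?(ltW rho0) ?(le_trans ler01 r1)// lerDr.
by rewrite ler_weXn2l// ltnW// e mm_lt.
Qed.

Let hump_cvg J : cvgn (series (fun m => c m * t J m)).
Proof.
apply: normed_cvg; apply: (@series_le_cvg _ _ (fun m => 2 ^+ L J * (`|c m| * `|A| ^+ m))).
- by move=> m; exact: normr_ge0.
- by move=> m; rewrite !mulr_ge0 ?exprn_ge0.
- move=> m /=; rewrite normrM (ger0_norm A0) mulrCA ler_wpM2l//.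
- by apply: is_cvg_seriesZ; exact: entire_summable.
Qed.

(** On the row jj_k the column mm_k dominates: F_large compensates the columns
    on the left, bounded by T, and those on the right sum to at most 1. *)
Let hump_large k N : (mm k < N)%N ->
  k%:R + 1 <= `|\sum_(0 <= m < N) c m * t (jj k) m|.
Proof.
move=> kN; have mk := mbar_mm k.
rewrite (big_cat_nat (leq0n (mbar k)) (leq_trans mk (ltnW kN)))/=.
rewrite (big_cat_nat mk (ltnW kN))/=.
rewrite [X in _ + (X + _)]big_nat_cond [X in _ + (X + _)]big1 ?add0r; last first.
  move=> m; rewrite andbT => /andP[m1 m2].
  case: (cP m) => [[i e _]|[_ ->]]; last by rewrite mul0r.
  have [ik|ki|ik] := ltngtP i k; last by rewrite e ik ltnn in m2.
    by have := mm_lt ik; rewrite -e ltnNge m1.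
  by have := ltn_trans m2 (leq_trans (mm_lt ki) (mbar_mm i)); rewrite -e ltnn.
rewrite (big_ltn kN) addrCA.
set main := c (mm k) * _; set early := \sum_(0 <= m < mbar k) _; set late := \sum_(_ <= m < N) _.
have hmain : k.+2%:R + \sum_(0 <= m < mbar k) T m <= `|main|.
  rewrite /main cE normrM normrX ger0_norm ?invr_ge0 ?(ltW (base_gt0 k))// exprVn.
  by rewrite ler_pdivlMl ?exprn_gt0// mulrC F_large.
have hearly : `|early| <= \sum_(0 <= m < mbar k) T m.
  apply: le_trans (ler_norm_sum _ _ _) _; apply: ler_sum => m _.
  rewrite normrM ger0_norm// -[leRHS]mul1r ler_pM//.
have hlate : `|late| <= 1.
  apply: (le_trans (ler_norm_sum _ _ _)).
  pose e m : R := 2 ^+ L (jj k) * (2^-1 ^+ m * (mbar k.+1 <= m)%N%:R).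
  apply: (@le_trans _ _ (\sum_((mm k).+1 <= m < N) e m)).
    rewrite big_nat_cond [leRHS]big_nat_cond; apply: ler_sum => m.
    rewrite andbT => /andP[m1 m2]; rewrite /e.
    have [mb|mb] := leqP (mbar k.+1) m.
      rewrite mulr1 normrM ger0_norm//; apply: (@le_trans _ _ (c m * (2 ^+ L (jj k) * A ^+ m))).
        by rewrite ler_wpM2l.
      by rewrite mulrCA ler_wpM2l ?exprn_ge0.
    rewrite !mulr0; case: (cP m) => [[i ei _]|[_ ->]]; last by rewrite mul0r normr0.
    have [ik|ki|ik] := ltngtP i k; last by rewrite ei ik ltnn in m1.
      by have := leq_trans (mm_lt ik) (leq_trans mk (ltnW m1)); rewrite -ei ltnn.
    by have := leq_trans mb (leq_trans (mbar_le ki) (mbar_mm i)); rewrite -ei ltnn.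
  rewrite -mulr_sumr -ler_pdivlMl ?exprn_gt0// mulr1.
  apply: (@le_trans _ _ (\sum_(0 <= m < N) 2^-1 ^+ m * (mbar k.+1 <= m)%N%:R)).
    rewrite [leRHS](big_cat_nat (leq0n (mm k).+1) kN)/= lerDr.
    by apply: sumr_ge0 => m _; rewrite mulr_ge0// exprn_ge0// invr_ge0.
  apply: le_trans (geometric_tail _ _ N) _; apply: (@le_trans _ _ (2 * 2^-1 ^+ mbar k.+1)).
    by rewrite gerBl mulr_ge0// exprn_ge0// invr_ge0.
  rewrite mbarS exprS mulrA divff// mul1r -exprVn ler_wiXn2l ?invr_ge0// ?invf_le1 ?ler1n//.
  exact: leq_addl.
rewrite -[main]opprK addrC -opprB normrN.
apply: le_trans (lerB_dist _ _); rewrite normrN lerBrDr.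
apply: le_trans hmain; rewrite -[k.+2]addn2 natrD.
have := ler_normD early late.
lra.
Qed.

Lemma hump_absurd : False.
Proof.
have [B hB] := t_bounded c_entire.
pose k := (Num.truncn `|B|).+1.
have : k%:R + 1 <= `|limn (series (fun m => c m * t (jj k) m))|.
  have h : (fun N => `|series (fun m => c m * t (jj k) m) N|) @ \oo -->
      `|limn (series (fun m => c m * t (jj k) m))|.
    by apply: cvg_norm; exact: (@hump_cvg (jj k)).
  rewrite -(cvg_lim (@Rhausdorff R) h); apply: limr_ge; first by apply/cvg_ex; eexists; exact: h.
  by exists (mm k).+1 => // N /= kN; exact: hump_large.
apply/negP; rewrite -ltNge (le_lt_trans (hB _))// (le_lt_trans (ler_norm _))//.
by rewrite ltr_wpDr//; exact: truncnS_gt.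
Qed.
End Hump.

(** The uniform boundedness principle for the Frechet space of entire functions,
    applied to the functionals with coefficients t_J: pointwise boundedness
    implies one common geometric bound. If no such bound held, a lacunary series
    built from columns where t is huge would be unbounded. *)
Lemma hump_bound : exists B rho, [/\ 0 <= B, 1 <= rho & forall J m, `|t J m| <= B * rho ^+ m].
Proof.
apply: contrapT => hn.
have T0 m : 0 <= T m by exact: le_trans (normr_ge0 _) (tT 0 m).
have pick i M : exists Jm : nat * nat, (M <= Jm.2)%N /\
    (i.+2%:R + \sum_(0 <= m < M) T m) * base i ^+ Jm.2 <= `|t Jm.1 Jm.2|.
  apply: contrapT => hp; apply: hn.
  exists (i.+2%:R + \sum_(0 <= m < M) T m), (base i).
  have S0 : 0 <= \sum_(0 <= m < M) T m by exact: sumr_ge0.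
  split => //; first by rewrite addr_ge0.
  move=> J m; rewrite leNgt; apply/negP => h; apply: hp; exists (J, m); split; last exact: ltW.
  rewrite /= leqNgt; apply/negP => mM; move: h; apply/negP; rewrite -leNgt.
  apply: le_trans (tT J m) _.
  apply: (@le_trans _ _ (i.+2%:R + \sum_(0 <= m < M) T m)).
    rewrite ler_wpDl// (bigD1_seq m) ?iota_uniq ?mem_index_iota//= lerDl.
    exact: sumr_ge0.
  by apply: ler_peMr; [rewrite addr_ge0|exact: exprn_ege1].
pose F i M := projT1 (cid (pick i M)).
by apply: (@hump_absurd F) => i M; rewrite /F; case: cid => Jm [].
Qed.
End GlidingHump.

(** * Trigonometric polynomials *)

Section MaskFacts.
Variable R : realType.
Notation mu := (@completed_lebesgue_measure R).
Implicit Types (a : trigpoly R) (f : R -> R[i]).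

Lemma ae_leb_forall (P : nat -> R -> Prop) :
  (forall n, {ae mu, forall x : R, P n x}) ->
  {ae mu, forall x : R, forall n, P n x}.
Proof.
move=> h; apply/ae_lebP.
have := negligible_bigcup (fun n => (ae_lebP (P n)).1 (h n)).
apply: negligibleS => x /= /existsNP[n Pn].
by exists n.
Qed.

(** A strict violation at a point would persist on an interval, which is not
    null. *)
Lemma ae_le_everywhere f (y : R) : ccontinuous f ->
  {ae mu, forall x : R, normc (f x) <= y} -> forall x, normc (f x) <= y.
Proof.
move=> /ccontinuousP cf /ae_lebP h x; rewrite leNgt; apply/negP => fx.
have [|d d0 hd] := cf x (normc (f x) - y); first by rewrite subr_gt0.
have hn : (@lebesgue_measure R).-negligible `](x - d), (x + d)[%classic.
  apply: negligibleS h => z /=; rewrite in_itv/= => zx.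
  apply/negP; rewrite -ltNge.
  have /hd hz : `|z - x| < d by rewrite ltr_distl.
  have := lerB_normc (f x) (f z); rewrite (normcBC (f x)); lra.
have h0 : (@lebesgue_measure R `](x - d)%R, (x + d)%R[%classic = 0)%E.
  by apply/(negligibleP (@lebesgue_measure R) (measurable_itv _)).
move: h0; rewrite lebesgue_measure_itv/= lte_fin ifT; last by lra.
move=> /eqP; rewrite -EFinB eqe => /eqP; lra.
Qed.

Lemma trigpoly_bounded a : exists B, forall x, normc (a x) <= B.
Proof.
exists (\sum_(0 <= n < `|tp_hi a - tp_lo a|%N.+1) normc (tp_coef a (tp_lo a + n%:Z))) => x.
apply: le_trans (normc_sum _ _ _) _; apply: ler_sum => n _.
by rewrite normcM normc_expi mulr1.
Qed.

(** By continuity the almost everywhere bound holds everywhere. *)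
Lemma trigpoly_Linfnorm a : Linfnorm a \is a fin_num /\
  forall x, normc (a x) <= fine (Linfnorm a).
Proof.
have le y : (Linfnorm a <= y%:E)%E -> forall x, normc (a x) <= y.
  move=> /ess_supP h; apply: ae_le_everywhere; first exact: ccontinuous_trigpoly.
  exact: h.
have [B hB] := trigpoly_bounded a.
have hfin : Linfnorm a \is a fin_num.
  rewrite fin_numE; apply/andP; split.
    apply/eqP => h.
    have /le/(_ 0) : (Linfnorm a <= (-1)%:E)%E by rewrite h leNye.
    by rewrite leNgt (lt_le_trans _ (normc_ge0 _)).
  suff : (Linfnorm a <= B%:E)%E by move=> /le_lt_trans/(_ (ltry _)); rewrite lt_neqAle => /andP[].
  apply/ess_supP; apply: (@ae_leb_all R (fun x => ((normc (a x))%:E <= B%:E)%E)) => x.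
  by rewrite lee_fin.
by split => //; apply: le; rewrite fineK.
Qed.

(** The fibre is empty or a translate of 2 pi Z. *)
Lemma countable_expi (z : R[i]) : countable [set x : R | expi (- x) = z].
Proof.
have [[x0 hx0]|h] := pselect (exists x0 : R, expi (- x0) = z); last first.
  rewrite (_ : [set _ | _] = set0); first exact: countable0.
  by apply/seteqP; split => x //= hx; apply: h; exists x.
apply: (@sub_countable _ _ _ (range (fun n : int => x0 + 2 * pi * n%:~R : R))).
  apply: subset_card_le => x /= hx.
  have : expi (x0 - x) = 1.
    by rewrite addrC expiD hx -hx0 -expiD addNr expi0.
  move=> /expi_eq1[n hn]; exists (- n) => //.
  by rewrite rmorphN/= mulrN -hn; ring.
by apply: (sub_countable (card_image_le _ _)); exact: countableP.
Qed.

(** Up to a nonvanishing factor a trigonometric polynomial is a polynomial in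
    exp(-ix), hence has countably many zeros. *)
Lemma trigpoly_ae_neq0 a : {ae mu, forall x : R, a x != 0}.
Proof.
apply/ae_lebP; set Z := ~` _.
suff cZ : countable Z.
  have mZ : measurable (Z : set (measurableTypeR R)).
    by apply: countable_measurable cZ => x; exact: measurable_set1.
  apply/(negligibleP (@lebesgue_measure R) mZ).
  exact: countable_lebesgue_measure0.
pose D := `|tp_hi a - tp_lo a|%N.+1.
pose p : {poly R[i]} := \poly_(n < D) tp_coef a (tp_lo a + n%:Z).
have aE x : a x = expi (- ((tp_lo a)%:~R * x)) * p.[expi (- x)].
  rewrite /tp_eval horner_poly mulr_sumr big_mkord; apply: eq_bigr => n _.
  rewrite mulrCA expiX; congr (_ * _); rewrite -expiD; congr expi.
  rewrite rmorphD/=; ring.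
have p0 : p != 0.
  apply/eqP => /(congr1 (fun q : {poly R[i]} => q`_0)); rewrite coef0 coef_poly/= addr0 => c0.
  by have := tp_neq0 a; rewrite c0 mul0r eqxx.
have [r pr] := closed_field_poly_normal p.
apply: (@sub_countable _ _ _ (\bigcup_(z in [set` r]) [set x : R | expi (- x) = z])).
  apply: subset_card_le => x /= /negP/negPn/eqP; rewrite aE => /eqP.
  rewrite mulf_eq0 (negbTE (expi_neq0 _))/= => px.
  exists (expi (- x)) => //=; move: px; rewrite {1}pr hornerZ mulf_eq0 lead_coef_eq0 (negbTE p0)/=.
  by rewrite -/(root _ _) root_prod_XsubC.
apply: bigcup_countable => [|z _]; last exact: countable_expi.
exact: finite_set_countable (finite_seq r).
Qed.
End MaskFacts.

(** * Refinable functions *)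

Section Refinable.
Variables (R : realType) (d : nat -> int).
Notation mu := (@completed_lebesgue_measure R).
Notation lam := (lam R d).
Hypothesis d_neq0 : forall j, (0 < j)%N -> d j != 0.

Lemma lam0 : lam 0 = 1.
Proof. by rewrite /Defs.lam big_geq// invr1. Qed.

Lemma lamS j : lam j.+1 = lam j / (d j.+1)%:~R.
Proof. by rewrite /Defs.lam big_nat_recr//= invfM. Qed.

Lemma dR_neq0 j : (d j.+1)%:~R != 0 :> R.
Proof. by rewrite intr_eq0 d_neq0. Qed.

Lemma lam_neq0 j : lam j != 0.
Proof.
elim: j => [|j IH]; first by rewrite lam0 oner_eq0.
by rewrite lamS mulf_neq0// invr_neq0// dR_neq0.
Qed.

Lemma lam_small : (fun j : nat => \prod_(1 <= n < j.+1) `|(d n)%:~R : R|) @ \oo --> +oo ->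
  forall e, 0 < e -> exists N, forall j, (N <= j)%N -> `|lam j| < e.
Proof.
move=> /cvgryPgt d_lim e e0; have [N _ hN] := d_lim e^-1.
exists N => j /hN /= h; rewrite /Defs.lam normfV normr_prod.
by rewrite invf_plt// posrE (lt_trans _ h)// invr_gt0.
Qed.

Section Mask.
Variable a : nat -> trigpoly R.
Hypothesis a_at0 : forall j, (0 < j)%N -> a j 0 = 1.
Hypothesis a_sum : (\sum_(1 <= j <oo)
     (`|lam j| * (tp_deg (a j))%:R)%:E * Linfnorm (a j) < +oo)%E.

Let M n := fine (Linfnorm (a n)).
(** Summable by hypothesis; these numbers majorize the dilated masks by
    majorized_trigpoly. *)
Let s n := 3 * (`|lam n| * (tp_deg (a n))%:R * M n).
Let p n x := a n (lam n * x).

Let aM n x : normc (a n x) <= M n.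
Proof. exact: (trigpoly_Linfnorm (a n)).2. Qed.

Let M0 n : 0 <= M n.
Proof. exact: le_trans (normc_ge0 _) (aM n 0). Qed.

Let s_ge0 n : 0 <= s n.
Proof. by rewrite /s !mulr_ge0. Qed.

Let p_maj n : (0 < n)%N -> majorized (p n) (s n).
Proof. by move=> n0; apply: majorized_trigpoly; [exact: a_at0|exact: aM]. Qed.

Let s_cvg : cvgn (fun N => \sum_(1 <= n < N.+1) s n).
Proof.
pose u n : \bar R := ((`|lam n| * (tp_deg (a n))%:R)%:E * Linfnorm (a n))%E.
have uE n : u n = (`|lam n| * (tp_deg (a n))%:R * M n)%:E.
  by rewrite /u -(fineK (trigpoly_Linfnorm (a n)).1) EFinM.
have u0 n : (0 <= u n)%E by rewrite uE lee_fin !mulr_ge0.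
pose S := (\sum_(1 <= j <oo) u j)%E.
have S0 : (0 <= S)%E by apply: nneseries_ge0 => n _ _; exact: u0.
have Sf : S \is a fin_num by rewrite (ge0_fin_numE S0); exact: a_sum.
apply: nondecreasing_is_cvgn.
  apply/nondecreasing_seqP => n; rewrite [leRHS]big_nat_recr//= lerDl.
  exact: s_ge0.
exists (3 * fine S) => _ /= [N _ <-].
rewrite -mulr_sumr ler_wpM2l// -lee_fin fineK//.
apply: le_trans (@nneseries_lim_ge R u (fun=> true) 1 N.+1 (fun n _ _ => u0 n)).
by rewrite -sumEFin; apply: lee_sum => n _; rewrite uE.
Qed.

Lemma mask_productE j xi N : mask_product d a j xi N = partial_prod p j (xi / lam j) N.
Proof.
apply: eq_bigr => n _; rewrite /p; congr (a _ _).
by rewrite mulrAC mulrA.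
Qed.

Lemma refinableE j xi : refinable d a j xi = inf_prod p j (xi / lam j).
Proof.
rewrite /refinable /inf_prod.
by have /funext -> := mask_productE j xi.
Qed.

Lemma cvg_mask_product j xi : cvgn (mask_product d a j xi).
Proof.
rewrite (_ : mask_product d a j xi = partial_prod p j (xi / lam j)).
  by apply/cvg_ex; eexists; exact: (partial_prod_cvg s_ge0 p_maj s_cvg).
by apply/funext => N; exact: mask_productE.
Qed.

Lemma refinable_lam j y : refinable d a j (lam j * y) = inf_prod p j y.
Proof. by rewrite refinableE mulrAC divff ?lam_neq0// mul1r. Qed.

(** The first factor of the infinite product is the mask itself. *)
Lemma refinement j xi :
  refinable d a j ((d j.+1)%:~R * xi) = a j.+1 xi * refinable d a j.+1 xi.
Proof.
have d0 := dR_neq0 j; have l0 := lam_neq0 j.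
rewrite !refinableE (inf_prodS s_ge0 p_maj s_cvg) /p lamS.
have -> : (d j.+1)%:~R * xi / lam j = xi / (lam j / (d j.+1)%:~R).
  by field; rewrite l0 d0.
by congr (a _ _ * _); field; rewrite l0 d0.
Qed.

(** In the variable y = xi / lam_j the refinable function is the tail of one fixed
    product, so it tends to 1 with the tails of the series of majorants. *)
Lemma refinable_majorized : exists sigma : nat -> R, [/\ forall j, 0 <= sigma j,
  sigma j @[j --> \oo] --> (0 : R) &
  forall j, majorized (fun y => refinable d a j (lam j * y)) (sigma j)].
Proof.
exists (tail_sum s); split.
- by move=> j; exact: (tail_sum_ge0 s_ge0 s_cvg).
- exact: (tail_sum_cvg s_cvg).
- move=> j; under eq_fun do rewrite refinable_lam.
  exact: (inf_prod_majorized s_ge0 p_maj s_cvg).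
Qed.

Lemma refinable_continuous j : ccontinuous (refinable d a j).
Proof.
have -> : refinable d a j = fun xi => inf_prod p j ((lam j)^-1 * xi).
  by apply/funext => xi; rewrite refinableE mulrC.
apply: (@ccontinuous_comp _ (inf_prod p j) (fun x => (lam j)^-1 * x)).
  by move=> x; exact: mulrl_continuous.
exact: (ccontinuous_majorized (inf_prod_majorized s_ge0 p_maj s_cvg j)).
Qed.

(** Zeros come from zeros of the masks, countably many in all. *)
Lemma refinable_ae_neq0 j : {ae mu, forall xi : R, refinable d a j xi != 0}.
Proof.
have h n : {ae mu, forall xi : R, a n (lam n / lam j * xi + 0) != 0}.
  apply: (ae_leb_affine (P := fun x => a n x != 0)); last exact: trigpoly_ae_neq0.
  by apply: mulf_neq0; [|apply: invr_neq0]; exact: lam_neq0.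
apply: ae_leb_imp (ae_leb_forall h) => xi hxi; apply/eqP.
rewrite refinableE => /(inf_prod_zero s_ge0 p_maj s_cvg)[n _].
by rewrite /p => h0; have := hxi n; rewrite addr0 mulrAC -mulrA h0 eqxx.
Qed.

Lemma refinable_Linfloc j : Linfloc (refinable d a j).
Proof.
have cj := refinable_continuous j.
split; first exact: cmeasurable_continuous.
move=> K /compact_bounded[N [_ hN]].
have [B hB] := ccontinuous_bounded (`|N| + 1) cj.
exists B; apply: ae_leb_all => x Kx; apply: hB; apply: (hN (`|N| + 1)) => //.
by rewrite (le_lt_trans (ler_norm _))// ltrDl.
Qed.
End Mask.
End Refinable.

(** * Functions all of whose integrals vanish *)

Section VanishingIntegrals.
Variable R : realType.
Notation T := (lebesgueType R).
Notation mu := (@completed_lebesgue_measure R).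
Implicit Types (W : R -> R[i]) (S : set R) (a b : R).

Let setint W S : R[i] := cintegral (fun x => (\1_S x : R)%:C%C * W x).

Lemma cmeasurable_indic S : (measurable : set (set T)) S ->
  cmeasurable (fun x => (\1_S x : R)%:C%C).
Proof. by move=> mS; apply: cmeasurable_real; exact: measurable_indic. Qed.

Lemma cintegrable_indic W S : (measurable : set (set T)) S -> cintegrable W ->
  cintegrable (fun x => (\1_S x : R)%:C%C * W x).
Proof.
move=> mS [mW iW]; apply: (cintegrable_le _ iW).
  exact: (cmeasurableM (cmeasurable_indic mS) mW).
move=> x; rewrite normcM normc_real ler_piMl ?normc_ge0//.
by rewrite indicE; case: (_ \in _); rewrite ?normr1 ?normr0.
Qed.

(** At each point, the partial sums of the indicators of disjoint sets are
    eventually constant, being those of at most one set. *)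
Lemma indic_trivIset (F : nat -> set R) x : trivIset [set: nat] F ->
  ((forall n, \sum_(0 <= k < n) (\1_(F k) x : R) = 0) /\ \1_(\bigcup_k F k) x = 0 :> R) \/
  exists k0, (forall n, \sum_(0 <= k < n) (\1_(F k) x : R) = (k0 < n)%N%:R) /\
             \1_(\bigcup_k F k) x = 1 :> R.
Proof.
move=> tF; have [[k0 _ xk]|h] := pselect ((\bigcup_k F k) x); [right|left].
  exists k0; split; last by rewrite indicE mem_set//; exists k0.
  elim=> [|n IH]; first by rewrite big_nil.
  rewrite big_nat_recr//= IH indicE ltnS [(k0 <= n)%N]leq_eqVlt.
  have [e|k0n] := eqVneq k0 n; first by rewrite -e mem_set// ltnn add0r.
  rewrite memNset ?addr0//= => xn; move/eqP: k0n; apply.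
  by apply: (tF k0 n) => //; exists x.
split=> [n|]; last by rewrite indicE memNset.
by rewrite big1// => k _; rewrite indicE memNset// => xk; apply: h; exists k.
Qed.

(** The open intervals generate the Borel sets, so a monotone class argument
    extends the vanishing of the integral from them to all Borel sets. *)
Lemma setint_borel W : cintegrable W ->
  (forall a b, cintegral (fun x => ((a < x < b)%R%:R : R)%:C%C * W x) = 0) ->
  forall S, (measurable : set (set (measurableTypeR R))) S -> setint W S = 0.
Proof.
move=> iW W0; have [mW nW] := iW.
have Wab a b : setint W (`]a, b[%classic : set R) = 0.
  rewrite -(W0 a b); congr cintegral; apply/funext => x.
  by rewrite indicE mem_setE in_itv.
have small (c : R) x : `|c| <= 1 -> normc (c%:C%C * W x) <= normc (W x).
  by move=> c1; rewrite normcM normc_real ler_piMl ?normc_ge0.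
have i1 S x : `|\1_S x : R| <= 1.
  by rewrite indicE; case: (_ \in _); rewrite ?normr1 ?normr0.
have WT : setint W setT = 0.
  pose f n x := (\1_(`](- n%:R), n%:R[%classic : set R) x : R)%:C%C * W x.
  have mI (n : nat) : (measurable : set (set T)) (`](- n%:R), n%:R[%classic : set R).
    by apply: borel_lebesgue; exact: measurable_itv.
  have cvf : cintegral (f n) @[n --> \oo] --> setint W setT.
    apply: (cdominated _ _ _ nW).
    - by move=> n; exact: (cintegrable_indic (mI n) iW).1.
    - exact: (cintegrable_indic measurableT iW).1.
    - move=> x; apply: cvg_near_cst.
      exists (Num.truncn `|x|).+1 => // n /= nx.
      rewrite /f !indicE in_setT mem_set ?subrr ?normc0//=.
      by rewrite in_itv/= -ltr_norml (lt_le_trans (truncnS_gt _))// ler_nat.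
    - by move=> n x; apply: small.
  rewrite (_ : (fun n => cintegral (f n)) = fun=> 0) in cvf.
    by apply: (cvg_complex_unique cvf); exact: cvg_cst.
  by apply/funext => n; exact: Wab.
rewrite (RGenOpens.measurableE R).
apply: (@dynkin_induction _ (measurableTypeR R) _ (fun S => setint W S = 0)) => //.
- exact: (RGenOpens.measurableE R).
- move=> A B [a1 [b1 ->]] [a2 [b2 ->]].
  exists (Num.max a1 a2), (Num.min b1 b2); apply/seteqP; split => x /=;
    rewrite !in_itv/= gt_max lt_min; first by move=> [/andP[-> ->] /andP[-> ->]].
  by move=> /andP[/andP[-> ->] /andP[-> ->]].
- by move=> _ [a [b ->]]; exact: Wab.
- move=> S mS WS; have mS' := borel_lebesgue mS.
  rewrite /setint (_ : (fun x => _) = fun x =>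
    (\1_(setT : set R) x : R)%:C%C * W x - (\1_S x : R)%:C%C * W x).
    rewrite cintegralB; [|exact: (cintegrable_indic measurableT iW)|exact: cintegrable_indic].
    by rewrite -/(setint W setT) -/(setint W S) WT WS subr0.
  apply/funext => x; rewrite !indicE in_setT in_setC -mulrBl; case: (_ \in _) => /=.
    by rewrite subrr.
  by rewrite subr0.
- move=> F mF tF WF; have mF' k := borel_lebesgue (mF k).
  have mU : (measurable : set (set T)) (\bigcup_k F k).
    by apply: borel_lebesgue; exact: bigcup_measurable.
  pose f n x := \sum_(0 <= k < n) ((\1_(F k) x : R)%:C%C * W x).
  have fE n x : f n x = (\sum_(0 <= k < n) (\1_(F k) x : R))%:C%C * W x.
    by rewrite /f -mulr_suml rmorph_sum.
  have cvf : cintegral (f n) @[n --> \oo] --> setint W (\bigcup_k F k).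
    apply: (cdominated _ _ _ nW).
    - by move=> n; apply: cmeasurable_sum => k _; exact: (cintegrable_indic (mF' k) iW).1.
    - exact: (cintegrable_indic mU iW).1.
    - move=> x; apply: cvg_near_cst.
      case: (indic_trivIset x tF) => [[h0 ->]|[k0 [h0 ->]]].
        by near=> n; rewrite fE h0 subrr normc0.
      by exists k0.+1 => // n /= nx; rewrite fE h0 nx subrr normc0.
    - move=> n x; rewrite fE; apply: small.
      case: (indic_trivIset x tF) => [[-> _]|[k0 [-> _]]]; first by rewrite normr0.
      by case: (_ < _)%N; rewrite ?normr1 ?normr0.
  rewrite (_ : (fun n => cintegral (f n)) = fun=> 0) in cvf.
    by apply: (cvg_complex_unique cvf); exact: cvg_cst.
  apply/funext => n.
  have h k : true -> cintegrable (fun x => (\1_(F k) x : R)%:C%C * W x).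
    by move=> _; exact: (cintegrable_indic (mF' k) iW).
  rewrite /f (@cintegral_sum R _ _ xpredT _ h); apply: big1 => k _; exact: WF.
Unshelve. all: by end_near. Qed.

(** Integrate over the set where the real part is positive. *)
Let Re_nonpos_ae W : cintegrable W ->
  (forall S, (measurable : set (set (measurableTypeR R))) S -> setint W S = 0) ->
  {ae mu, forall x : R, ~ 0 < complex.Re (W x)}.
Proof.
move=> iW W0; have [[mR mI] _] := iW.
have mS : (measurable : set (set T)) [set x | 0 < complex.Re (W x)].
  have := mR measurableT _ (@measurable_itv R `]0, +oo[).
  rewrite setTI; congr measurable; apply/seteqP; split => x /=; rewrite in_itv/= andbT//.
have [X [N [mX nN SE]]] := lebesgue_split mS.
have XS x : X x -> 0 < complex.Re (W x).
  move=> Xx; have : (X `|` N) x by left.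
  by rewrite -SE.
have mX' := borel_lebesgue mX.
have iX := cintegrable_indic mX' iW.
have := W0 X mX; rewrite /setint /cintegral => /(congr1 (@complex.Re R)) /=.
set g := fun x => _ => g0.
have gE x : g x = \1_X x * complex.Re (W x) by rewrite /g cReM /= mul0r subr0.
have g_ge0 x : 0 <= g x.
  rewrite gE indicE; case: (boolP (x \in X)) => [|_]; last by rewrite mul0r.
  by rewrite inE mul1r => /XS/ltW.
have ig : lintegrable g := cintegrable_Re iX.
have mg : measurable_fun [set: T] (fun x => (g x)%:E).
  by apply/measurable_EFinP; exact: lintegrable_measurable ig.
have g0' : (\int[mu]_x `|(g x)%:E| = 0)%E.
  rewrite (eq_integral (fun x : T => (g x)%:E)); last first.
    by move=> x _ /=; rewrite ger0_norm.
  have fin := integrable_fin_num measurableT ig.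
  by rewrite -(fineK fin); congr EFin; exact: g0.
have /ae_lebP gz := (@ae_eq_integral_abs _ T R mu setT measurableT _ mg).1 g0'.
apply/ae_lebP; apply: negligibleS (negligibleU gz nN) => x /= /contrapT Wx.
have : (X `|` N) x by rewrite -SE.
move=> [Xx|Nx]; [left|by right] => /(_ I) /=; rewrite gE indicE mem_set// mul1r => -[h].
by rewrite h ltxx in Wx.
Qed.

(** Applied to the multiples of W by 1, -1, i and -i, the previous fact leaves
    only zero. *)
Lemma ae_eq0_intervals W : cintegrable W ->
  (forall a b, cintegral (fun x => ((a < x < b)%R%:R : R)%:C%C * W x) = 0) ->
  {ae mu, forall x : R, W x = 0}.
Proof.
move=> iW W0; have WS := setint_borel iW W0.
have hz (z : R[i]) : {ae mu, forall x : R, ~ 0 < complex.Re (z * W x)}.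
  apply: (Re_nonpos_ae (cintegrableZ z iW)) => S mS.
  have := cintegralZ z (cintegrable_indic (borel_lebesgue mS) iW).
  rewrite -/(setint W S) (WS _ mS) mulr0 => <-.
  by congr cintegral; apply/funext => x; rewrite mulrCA.
apply: ae_leb_imp (ae_leb_and (ae_leb_and (hz 1) (hz (- 1)))
  (ae_leb_and (hz 'i%C) (hz (- 'i%C)))) => x.
case: (W x) => u v; rewrite !mulNr !mul1r !cReN !cReM /= !mul0r !mul1r sub0r opprK.
move=> [[u1 u2] [v1 v2]]; apply/eqP; rewrite eq_complex/=.
by apply/andP; split; apply/eqP; lra.
Qed.
End VanishingIntegrals.

(** * Blocks of the frame expansion *)

Section LocallyIntegrable.
Variable R : realType.
Notation T := (lebesgueType R).
Notation mu := (@completed_lebesgue_measure R).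
Implicit Types (f g h W c : R -> R[i]) (x t A lam : R) (k : int).

(** Locally integrable complex functions: the products of two locally square
    integrable ones, which the frame expansion pairs with test functions. *)
Definition cloc W : Prop := cmeasurable W /\ loc_integrable (fun x => normc (W x)).

Lemma cloc_mulJ h1 h2 : L2loc h1 -> L2loc h2 ->
  cloc (fun x => (h1 x)^*%C * h2 x).
Proof.
move=> /L2loc_loc_integrable[m1 i1] /L2loc_loc_integrable[m2 i2].
have mW := cmeasurableM (cmeasurableJ m1) m2; split => //.
apply: (loc_integrable_le (normc_measurable mW) (loc_integrableD i1 i2)) => x.
by rewrite ger0_norm ?normc_ge0// (le_trans (normcM_le _ _))// normc_conj.
Qed.

Lemma clocD W1 W2 : cloc W1 -> cloc W2 -> cloc (fun x => W1 x + W2 x).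
Proof.
move=> [m1 i1] [m2 i2]; have mW := cmeasurableD m1 m2; split => //.
apply: (loc_integrable_le (normc_measurable mW) (loc_integrableD i1 i2)) => x.
by rewrite ger0_norm ?normc_ge0// le_normcD.
Qed.

Lemma cloc0 : cloc (fun=> 0).
Proof.
split; first exact: cmeasurable_cst.
have m0 : lmeasurable (fun _ : R => normc (0 : R[i])).
  exact: (normc_measurable (@cmeasurable_cst R 0)).
split => // A.
have := (@cintegrable0 R).2; rewrite normc0.
by under [X in _ -> lintegrable X]eq_fun do rewrite mulr0.
Qed.

Lemma cloc_sum I (r : seq I) (W : I -> R -> R[i]) :
  (forall i, cloc (W i)) -> cloc (fun x => \sum_(i <- r) W i x).
Proof.
move=> cW; elim: r => [|i r IH].
  by under eq_fun do rewrite big_nil; exact: cloc0.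
by under eq_fun do rewrite big_cons; exact: clocD.
Qed.

Lemma cloc_mul_continuous W c : cloc W -> ccontinuous c ->
  cloc (fun x => W x * c x).
Proof.
move=> [mW iW] cc; have mc := cmeasurable_continuous cc.
split; first exact: cmeasurableM.
under eq_fun do rewrite normcM.
apply: (loc_integrable_bounded_mul iW (normc_measurable mc)) => A.
have [B hB] := ccontinuous_bounded A cc.
by exists B => x /hB; rewrite ger0_norm ?normc_ge0.
Qed.

Lemma cloc_affine W s t : s != 0 -> cloc W -> cloc (fun x => W (s * x + t)).
Proof.
move=> s0 [mW iW]; split; first exact: cmeasurable_affine.
exact: (loc_integrable_affine t s0 iW).
Qed.

Lemma clocN W : cloc W -> cloc (fun x => - W x).
Proof.
move=> cW; have := cloc_mul_continuous cW (ccontinuous_cst (- 1)).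
by under eq_fun do rewrite mulrN1.
Qed.

Lemma L2loc_affine h s t : s != 0 -> L2loc h -> L2loc (fun x => h (s * x + t)).
Proof.
move=> s0 /L2loc_loc_integrable[mh ih]; apply/L2loc_loc_integrable; split.
  exact: cmeasurable_affine.
exact: (loc_integrable_affine t s0 ih).
Qed.

Lemma L2loc_mul_continuous h c : L2loc h -> ccontinuous c -> L2loc (fun x => h x * c x).
Proof.
move=> /L2loc_loc_integrable[mh ih] cc; apply/L2loc_loc_integrable.
have mc := cmeasurable_continuous cc; split; first exact: cmeasurableM.
under eq_fun do rewrite normcM exprMn.
apply: (loc_integrable_bounded_mul ih (normc_sqr_measurable mc)) => A.
have [B hB] := ccontinuous_bounded A cc.
exists (B ^+ 2) => x /hB xB; rewrite ger0_norm ?sqr_ge0//.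
by rewrite lerXn2r ?nnegrE ?normc_ge0// (le_trans (normc_ge0 _) xB).
Qed.

Lemma bounded_supportedM f g A : bounded_supported f A -> cmeasurable g ->
  (exists B, forall x, normc (g x) <= B) -> bounded_supported (fun x => f x * g x) A.
Proof.
move=> [mf sf [B fB]] mg [C gC]; split; first exact: cmeasurableM.
  by move=> x /sf ->; rewrite mul0r.
by exists (B * C) => x; rewrite normcM ler_pM ?normc_ge0.
Qed.

Lemma cintegrable_cut f W A : bounded_supported f A -> cloc W ->
  cintegrable (fun x => f x * W x).
Proof.
move=> [mf sf [B fB]] [mW [_ iW]].
apply: (cintegrable_le (cmeasurableM mf mW) (lintegrableZ B (iW A))) => x.
rewrite normcM; have [xA|xA] := leP `|x| A.
  by rewrite mul1r ler_wpM2r ?normc_ge0.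
by rewrite sf// normc0 !mul0r mulr0.
Qed.

Lemma bounded_supported_le f A B : A <= B -> bounded_supported f A -> bounded_supported f B.
Proof. by move=> AB [mf sf bf]; split => // x xB; apply: sf; exact: le_lt_trans xB. Qed.

(** Its integral is the correlation of f and g at lag t. *)
Definition corr f g t x : R[i] := f x * (g (x + t))^*%C.

Lemma corr_bounded f g t A : bounded_supported f A -> bounded_supported g A ->
  bounded_supported (corr f g t) A.
Proof.
move=> bf [mg _ [C gC]]; apply: (bounded_supportedM bf).
  exact: (cmeasurableJ (cmeasurable_shift t mg)).
by exists C => x; rewrite normc_conj.
Qed.

(** Points of [-A, A] are at most 2 A apart. *)
Lemma corr_far f g t A x : bsupp A f -> bsupp A g -> 2 * A < `|t| -> corr f g t x = 0.
Proof.
move=> sf sg tA; rewrite /corr; have [xA|/sf ->] := leP `|x| A; last by rewrite mul0r.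
rewrite sg ?conjc0 ?mulr0//.
have := ler_normB (x + t) x; rewrite (addrC x) addrK; lra.
Qed.

(** The bound on K ensures that all the translates of g that meet f occur. *)
Lemma frame_blocks f g lam n (phi tphi : 'I_n -> R -> R[i]) A K : lam != 0 -> 0 <= A ->
  bounded_supported f A -> bounded_supported g A ->
  (forall l, L2loc (phi l)) -> (forall l, L2loc (tphi l)) ->
  ((Num.truncn (A * `|lam|)).+1.*2 <= K)%N ->
  (forall l, abs_summable (frame_term f g lam (phi l) (tphi l))) /\
  \sum_(l < n) sumZ (frame_term f g lam (phi l) (tphi l)) =
  (2 * pi)%:C%C * \sum_(k <- freqs K) cintegral (fun x =>
    corr f g (2 * pi * k%:~R / lam) x *
    \sum_(l < n) (phi l (lam * x))^*%C * tphi l (lam * x + 2 * pi * k%:~R)).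
Proof.
move=> l0 A0 bf bg Lp Ltp; set M := (Num.truncn _).+1 => MK.
have AM : A * `|lam| < 2 * pi * M%:R.
  apply: (lt_le_trans (truncnS_gt _)); rewrite -/M ler_peMl//.
  by have := pi_ge2 R; lra.
have MK' : (2 * M <= K)%N by rewrite mul2n.
have h l := frame_sum l0 A0 bf bg (Lp l) (Ltp l) AM MK'.
split=> [l|]; first exact: (h l).1.
rewrite (eq_bigr _ (fun l _ => (h l).2)) -mulr_sumr exchange_big/=.
congr (_ * _); apply: eq_bigr => k _.
pose W l x := (phi l (lam * x))^*%C * tphi l (lam * x + 2 * pi * k%:~R).
have cW l : cloc (W l).
  have := cloc_mulJ (L2loc_affine 0 l0 (Lp l)) (L2loc_affine (2 * pi * k%:~R) l0 (Ltp l)).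
  by under eq_fun do rewrite addr0.
have bc := corr_bounded (2 * pi * k%:~R / lam) bf bg.
have iW l : true -> cintegrable (fun x => corr f g (2 * pi * k%:~R / lam) x * W l x).
  by move=> _; exact: (cintegrable_cut bc (cW l)).
have -> : (fun x => corr f g (2 * pi * k%:~R / lam) x *
    \sum_(l < n) (phi l (lam * x))^*%C * tphi l (lam * x + 2 * pi * k%:~R)) =
  (fun x => \sum_(l < n) corr f g (2 * pi * k%:~R / lam) x * W l x).
  by apply/funext => x; rewrite mulr_sumr.
rewrite (@cintegral_sum R _ _ xpredT _ iW); apply: eq_bigr => l _.
by congr cintegral; apply/funext => x; rewrite /corr /W mulrACA mulrA.
Qed.
End LocallyIntegrable.

(** * Localisation of the blocks *)

Section Localisation.
Variable R : realType.
Notation mu := (@completed_lebesgue_measure R).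
Implicit Types (W : R -> R[i]) (a b x lam : R) (k : int).

Lemma hat_shift n a b t x : hat n (a + t) (b + t) (x + t) = hat n a b x.
Proof. by congr (step (_ * _) * step (_ * _)); ring. Qed.

Lemma cintegral_hat_cvg W a b : cloc W ->
  cintegral (fun x => (hat n a b x ^+ 2)%:C%C * W x) @[n --> \oo] -->
  cintegral (fun x => ((a < x < b)%R%:R : R)%:C%C * W x).
Proof.
move=> [mW [_ iW]]; pose A := Num.max `|a| `|b|.
have inA x : a < x < b -> `|x| <= A.
  move=> /andP[ax xb]; rewrite /A le_max.
  by case: (ger0P x) => hx; case: (ger0P a) => ha; case: (ger0P b) => hb; lra.
have mB n : cmeasurable (fun x => (hat n a b x ^+ 2)%:C%C).
  apply: cmeasurable_real; apply: continuous_lmeasurable.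
  exact: (smooth_continuous (smoothM (smooth_hat n a b) (smooth_hat n a b))).
have cvx x : (hat n a b x ^+ 2)%:C%C @[n --> \oo] --> ((a < x < b)%R%:R : R)%:C%C.
  apply: cvg_near_cst; case: (boolP (a < x < b)) => xab.
    have [N hN] := hat_in xab.
    by exists N => // n /= /hN ->; rewrite expr1n.
  by near=> n; rewrite hat_out// expr0n.
have mI : cmeasurable (fun x => ((a < x < b)%R%:R : R)%:C%C).
  rewrite (_ : (fun x => _) = fun x => (\1_(`]a, b[%classic : set R) x : R)%:C%C).
    by apply: cmeasurable_indic; apply: borel_lebesgue; exact: measurable_itv.
  by apply/funext => x; rewrite indicE mem_setE in_itv.
apply: (cdominated (fun n => cmeasurableM (mB n) mW) (cmeasurableM mI mW) _ (iW A)).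
  move=> x; apply/cvg_complexP; apply: cvg_complexM; first exact: cvx.
  exact: cvg_cst.
move=> n x; rewrite normcM normc_real; case: (boolP (a < x < b)) => xab.
  rewrite (inA x xab) mul1r ler_piMl ?normc_ge0// ger0_norm ?sqr_ge0//.
  by rewrite exprn_ile1 ?hat_ge0 ?hat_le1.
by rewrite hat_out// expr0n normr0 mul0r mulr_ge0 ?normc_ge0.
Unshelve. all: by end_near. Qed.

Variables (lam : R) (W : int -> R -> R[i]).
Hypothesis lam0 : lam != 0.
Hypothesis cW : forall k, cloc (W k).
Hypothesis W0 : forall f g, test_function f -> test_function g ->
  exists N, forall K, (N <= K)%N -> \sum_(k <- freqs K)
    cintegral (fun x => corr f g (2 * pi * k%:~R / lam) x * W k x) = 0.

Let delta : R := 2 * pi / `|lam|.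

Let delta_gt0 : 0 < delta.
Proof. by rewrite divr_gt0 ?normr_gt0// mulr_gt0// pi_gt0. Qed.

(** On an interval shorter than the period 2 pi / |lam|, testing with a hat and
    a translate of it isolates the k-th term of the sum. *)
Lemma short_interval k a b : b - a < delta ->
  cintegral (fun x => ((a < x < b)%R%:R : R)%:C%C * W k x) = 0.
Proof.
move=> ab; have := @cintegral_hat_cvg (W k) a b (cW k).
rewrite (_ : (fun n => _) = fun=> 0) => [h|].
  by symmetry; apply: (cvg_complex_unique _ h); exact: cvg_cst.
apply/funext => n; pose t := 2 * pi * k%:~R / lam.
have [N hN] := W0 (test_hat n a b) (test_hat n (a + t) (b + t)).
pose K := maxn N `|k|.+1.
have := hN K (leq_maxl _ _).
have kK : k \in freqs K by rewrite mem_freqs /K; lia.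
rewrite (bigD1_seq k kK (freqs_uniq K))/= big1 ?addr0 => [<-|i ik].
  congr cintegral; apply/funext => x; congr (_ * _).
  by rewrite /corr hat_shift conjc_real -rmorphM -expr2.
have big : delta <= `|2 * pi * i%:~R / lam - t|.
  rewrite /t -mulrBl -mulrBr normrM normfV normrM ler_pM2r ?invr_gt0 ?normr_gt0//.
  rewrite (@ger0_norm _ (2 * pi)) ?mulr_ge0 ?pi_ge0//.
  rewrite ler_peMr ?mulr_ge0 ?pi_ge0// -intrB -intr_norm.
  by rewrite (ler_int R 1) -gtz0_ge1 normr_gt0 subr_eq0.
rewrite (_ : (fun x => _) = fun=> 0); first exact: cintegral0.
apply/funext => x; rewrite /corr conjc_real -rmorphM.
case: (boolP (a < x < b)) => xab; last by rewrite hat_out// mul0r mul0r.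
rewrite (@hat_out _ n (a + t)) ?mulr0 ?mul0r//.
apply/negP; move: xab => /andP[x1 x2] /andP[x3 x4].
move: big; apply/negP; rewrite -ltNge ltr_norml.
by apply/andP; split; lra.
Qed.

(** Countably many short intervals cover the line. *)
Lemma localised_zero k : {ae mu, forall x : R, W k x = 0}.
Proof.
have loc (c : R) : {ae mu, forall x : R, c < x < c + delta / 2 -> W k x = 0}.
  pose V x := ((c < x < c + delta / 2)%R%:R : R)%:C%C * W k x.
  have iV : cintegrable V.
    have mI : (measurable : set (set (lebesgueType R))) (`]c, (c + delta / 2)[%classic : set R).
      by apply: borel_lebesgue; exact: measurable_itv.
    have VE x : V x = (\1_(`]c, (c + delta / 2)[%classic : set R) x : R)%:C%C * W k x.
      by rewrite indicE mem_setE in_itv.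
    have [mW [_ iW]] := cW k; have mV := cmeasurableM (cmeasurable_indic mI) mW.
    have /funext -> := VE.
    apply: (cintegrable_le mV (iW (Num.max `|c| `|c + delta / 2|))) => x.
    rewrite -VE /V normcM normc_real normr_nat ler_wpM2r ?normc_ge0// ler_nat.
    case: (boolP (c < x < _)) => // /andP[x1 x2]; rewrite lt0b le_max.
    case: (ger0P x) => hx; case: (ger0P c) => h1;
      case: (ger0P (c + delta / 2)) => h2; lra.
  have V0 a b : cintegral (fun x => ((a < x < b)%R%:R : R)%:C%C * V x) = 0.
    rewrite -(@short_interval k (Num.max a c) (Num.min b (c + delta / 2))).
      congr cintegral; apply/funext => x; rewrite /V mulrA; congr (_ * _).
      rewrite -rmorphM -natrM mulnb; congr ((_%:R)%:C%C); congr nat_of_bool.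
      by rewrite gt_max lt_min; case: (a < x); case: (x < b); case: (c < x); case: (x < _).
    have := delta_gt0.
    have : Num.min b (c + delta / 2) <= c + delta / 2 by rewrite ge_min lexx orbT.
    have : c <= Num.max a c by rewrite le_max lexx orbT.
    lra.
  apply: ae_leb_imp (ae_eq0_intervals iV V0) => x; rewrite /V => Vx xc.
  by rewrite xc mul1r in Vx.
pose e := delta / 4; have e0 : 0 < e by rewrite divr_gt0.
have := ae_leb_forall (fun n => ae_leb_and (loc (n%:R * e)) (loc (- n%:R * e))).
apply: ae_leb_imp => x hx; pose m := Num.floor (x / e) - 1.
have mx : m%:~R * e < x < m%:~R * e + delta / 2.
  have -> : delta / 2 = 2 * e by rewrite /e; field.
  have -> : m%:~R = (Num.floor (x / e))%:~R - 1 :> R by rewrite /m rmorphB.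
  have := floor_le (x / e); have := floorD1_gt (x / e).
  rewrite rmorphD/= ler_pdivlMr// ltr_pdivrMr//.
  by move=> h1 h2; apply/andP; split; nra.
case: (m) mx => n mx; first by have [h _] := hx n; exact: h.
by have [_ h] := hx n.+1; apply: h; move: mx; rewrite NegzE mulrNz.
Qed.
End Localisation.

(** * Moments *)

Section Moments.
Variable R : realType.
Notation T := (lebesgueType R).
Notation mu := (@completed_lebesgue_measure R).
Implicit Types (F V h : R -> R[i]) (x A s B rho : R) (m n J : nat) (u : nat -> R[i]).

Lemma cvg_complex_Re u (l : R[i]) : u @ \oo --> l ->
  complex.Re (u n) @[n --> \oo] --> complex.Re l.
Proof.
move=> /cvg_complexP ul; apply/subr_cvg0; apply/cvgr0Pnorm_lt => e e0.
move/cvgr0Pnorm_lt : ul => /(_ _ e0); apply: filterS => n.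
rewrite (ger0_norm (normc_ge0 _)); apply: le_lt_trans.
by rewrite -cReN -cReD Re_le_normc.
Qed.

Lemma cvg_complex_Im u (l : R[i]) : u @ \oo --> l ->
  complex.Im (u n) @[n --> \oo] --> complex.Im l.
Proof.
move=> /cvg_complexP ul; apply/subr_cvg0; apply/cvgr0Pnorm_lt => e e0.
move/cvgr0Pnorm_lt : ul => /(_ _ e0); apply: filterS => n.
rewrite (ger0_norm (normc_ge0 _)); apply: le_lt_trans.
by rewrite -cImN -cImD Im_le_normc.
Qed.

Lemma cvg_complex_bounded u (l : R[i]) : u @ \oo --> l -> exists B, forall n, normc (u n) <= B.
Proof.
move=> /cvg_complexP ul.
have /cvg_seq_bounded[M [_ hM]] : cvgn (fun n => normc (u n - l)) by apply/cvg_ex; exists 0.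
exists (`|M| + 1 + normc l) => n; rewrite -{1}[u n](subrK l).
apply: (le_trans (le_normcD _ _)); rewrite lerD2r.
have M1 : M < `|M| + 1 by rewrite (le_lt_trans (ler_norm _))// ltrDl.
have /= := hM _ M1 n Logic.I.
by rewrite ger0_norm ?normc_ge0.
Qed.

Lemma normc_cintegral_le f (G : R -> R) : cintegrable f -> lintegrable G ->
  (forall x, normc (f x) <= G x) -> normc (cintegral f) <= 2 * \int[mu]_x G x.
Proof.
move=> fi iG fG; apply: (le_trans (normc_cintegral fi)); rewrite ler_wpM2l//.
by apply: (@le_Rintegral _ T R mu setT _ _ measurableT fi.2 iG) => x _; exact: fG.
Qed.

Definition moment F V m : R[i] := cintegral (fun x => F x * (V x * (x ^+ m)%:C%C)).

Lemma ccontinuous_power m : ccontinuous (fun x : R => (x ^+ m)%:C%C).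
Proof. by apply: ccontinuous_real; exact: exprn_continuous. Qed.

Lemma cintegrable_moment F V A m : bounded_supported F A -> cloc V ->
  cintegrable (fun x => F x * (V x * (x ^+ m)%:C%C)).
Proof.
move=> bF cV; exact: (cintegrable_cut bF (cloc_mul_continuous cV (ccontinuous_power m))).
Qed.

Lemma cintegrable_FV F V A : bounded_supported F A -> cloc V ->
  lintegrable (fun x => normc (F x * V x)).
Proof. by move=> bF cV; have [] := cintegrable_cut bF cV. Qed.

Lemma moment_le F V A m : 0 <= A -> bounded_supported F A -> cloc V ->
  normc (moment F V m) <= 2 * \int[mu]_x normc (F x * V x) * A ^+ m.
Proof.
move=> A0 bF cV; have iFV := cintegrable_FV bF cV.
rewrite -mulrA [_ * A ^+ m]mulrC.
rewrite -(@RintegralZl _ T R mu setT _ (A ^+ m) measurableT iFV).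
apply: (normc_cintegral_le (cintegrable_moment m bF cV) (lintegrableZ (A ^+ m) iFV)).
move=> x; have [xA|xA] := leP `|x| A.
  rewrite mulrA normcM normc_real normrX mulrC ler_wpM2r ?normc_ge0//.
  by rewrite lerXn2r ?nnegrE.
by have [_ sF _] := bF; rewrite sF// !mul0r normc0 mulr0.
Qed.

(** Termwise integration: on the support of F the partial sums are dominated by
    the sum of the |c_m| A ^ m. *)
Lemma moment_entire F V A (c : nat -> R) : 0 <= A -> bounded_supported F A -> cloc V ->
  entire c ->
  (fun N => \sum_(0 <= m < N) (c m)%:C%C * moment F V m) @ \oo -->
  cintegral (fun x => F x * (V x * (limn (pseries c x))%:C%C)).
Proof.
move=> A0 bF cV ec; have [mF sF _] := bF; have mV := cV.1.
have iFV := cintegrable_FV bF cV.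
pose f N x := F x * (V x * (pseries c x N)%:C%C).
pose S := limn (series (fun m => `|c m| * `|A| ^+ m)).
have cs := @entire_summable R c A ec.
have fE N : cintegral (f N) = \sum_(0 <= m < N) (c m)%:C%C * moment F V m.
  rewrite (_ : f N = fun x => \sum_(0 <= m < N) (c m)%:C%C * (F x * (V x * (x ^+ m)%:C%C))).
    have iS m : true -> cintegrable (fun x => (c m)%:C%C * (F x * (V x * (x ^+ m)%:C%C))).
      by move=> _; exact: (cintegrableZ _ (cintegrable_moment m bF cV)).
    rewrite (@cintegral_sum R _ _ xpredT _ iS); apply: eq_bigr => m _.
    exact: (cintegralZ _ (cintegrable_moment m bF cV)).
  apply/funext => x; rewrite /f /pseries /series/= rmorph_sum !mulr_sumr.
  by apply: eq_bigr => m _; rewrite rmorphM/=; ring.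
have /funext <- := fE.
have smooth_c := smooth_continuous (smooth_entire ec).
apply: (cdominated _ _ _ (lintegrableZ S iFV)).
- move=> N; rewrite /f; apply: (cmeasurableM mF); apply: (cmeasurableM mV).
  apply: cmeasurable_continuous; rewrite /pseries /series/=.
  under eq_fun do rewrite rmorph_sum.
  apply: ccontinuous_sum => m.
  under eq_fun do rewrite rmorphM/=.
  by apply: ccontinuousM; [exact: ccontinuous_cst|exact: ccontinuous_power].
- apply: (cmeasurableM mF); apply: (cmeasurableM mV).
  by apply: cmeasurable_continuous; apply: ccontinuous_real.
- move=> x; apply/cvg_complexP; rewrite /f.
  apply: cvg_complexM; first exact: cvg_cst.
  apply: cvg_complexM; first exact: cvg_cst.
  apply/cvg_complexP.
  rewrite (_ : (fun n => _) = fun n => `|pseries c x n - limn (pseries c x)|).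
    by apply/norm_cvg0P; apply/subr_cvg0; exact: (@entire_cvg R c x ec).
  by apply/funext => n; rewrite -rmorphB normc_real.
- move=> N x; rewrite /f mulrA normcM normc_real mulrC.
  have [xA|xA] := leP `|x| A; last by rewrite sF// !mul0r normc0 !mulr0.
  rewrite ler_wpM2r ?normc_ge0// /pseries /series/=.
  apply: (le_trans (ler_norm_sum _ _ _)).
  apply: (@le_trans _ _ (series (fun m => `|c m| * `|A| ^+ m) N)).
    rewrite /series/=; apply: ler_sum => m _.
    by rewrite normrM normrX ler_wpM2l// lerXn2r ?nnegrE// (ger0_norm A0).
  apply: nondecreasing_cvgn_le => //.
  apply/nondecreasing_seqP => n; rewrite /series/= big_nat_recr//= lerDl.
  by rewrite mulr_ge0// exprn_ge0.
Qed.

(** The test functions F c with c entire probe all the moments of F V_J at once,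
    and the gliding hump turns their individual boundedness into a common
    geometric bound. *)
Lemma moments_bounded F (V : nat -> R -> R[i]) : test_function F ->
  (forall J, cloc (V J)) ->
  (forall G, test_function G -> exists B, forall J,
     normc (cintegral (fun x => G x * V J x)) <= B) ->
  exists B rho, [/\ 0 <= B, 1 <= rho & forall J m, normc (moment F (V J) m) <= B * rho ^+ m].
Proof.
move=> tF cV hB; have [A A0 bF] := test_bounded_supported tF.
have mulE (g : R -> R) J : (fun x => F x * (g x)%:C%C * V J x) =
    (fun x => F x * (V J x * (g x)%:C%C)).
  by apply/funext => x; rewrite mulrAC mulrA.
have [T0 hT] : exists T0 : nat -> R, forall m J, normc (moment F (V J) m) <= T0 m.
  have h m : exists B, forall J, normc (moment F (V J) m) <= B.
    have sm : smooth (fun x : R => x ^+ m).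
      elim: m => [|m IH]; first by move=> n; exact: cn_cst.
      have /funext -> : forall x : R, x ^+ m.+1 = x * x ^+ m by move=> x; rewrite exprS.
      by apply: smoothM => // n; exact: cn_id.
    have [B hb] := hB _ (test_mul_smooth tF sm).
    by exists B => J; have := hb J; rewrite mulE.
  by have [T0 hT] := choice h; exists T0.
pose C J := 2 * \int[mu]_x normc (F x * V J x).
pose L J := (Num.truncn (C J)).+1.
have CL J : C J <= 2 ^+ L J.
  apply: (le_trans (ltW (truncnS_gt _))); rewrite -natrX ler_nat.
  exact: ltnW (ltn_expl _ _).
have tL J m : normc (moment F (V J) m) <= 2 ^+ L J * A ^+ m.
  apply: (le_trans (moment_le m A0 bF (cV J))).
  by apply: ler_wpM2r; [exact: exprn_ge0|exact: CL].
have ent c : entire c -> exists B, forall J,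
    normc (cintegral (fun x => F x * (V J x * (limn (pseries c x))%:C%C))) <= B.
  move=> ec; have [B hb] := hB _ (test_mul_smooth tF (smooth_entire ec)).
  by exists B => J; have := hb J; rewrite (mulE (fun x => limn (pseries c x))).
have [B1 [r1 [B10 r11 h1]]] : exists B rho, [/\ 0 <= B, 1 <= rho &
    forall J m, `|complex.Re (moment F (V J) m)| <= B * rho ^+ m].
  apply: (@hump_bound R (fun J m => complex.Re (moment F (V J) m)) A L T0 A0) => //.
  - by move=> J m; apply: (le_trans (Re_le_normc _)); exact: hT.
  - by move=> J m; apply: (le_trans (Re_le_normc _)); exact: tL.
  - move=> c ec; have [B hb] := ent c ec; exists B => J.
    have := cvg_complex_Re (moment_entire A0 bF (cV J) ec).
    rewrite (_ : (fun N => _) = series (fun m => c m * complex.Re (moment F (V J) m))).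
      move=> h; have -> := cvg_lim (@Rhausdorff R) h.
      exact: le_trans (Re_le_normc _) (hb J).
    apply/funext => N; rewrite /series/= raddf_sum; apply: eq_bigr => m _.
    by rewrite [LHS]cReM/= mul0r subr0.
have [B2 [r2 [B20 r21 h2]]] : exists B rho, [/\ 0 <= B, 1 <= rho &
    forall J m, `|complex.Im (moment F (V J) m)| <= B * rho ^+ m].
  apply: (@hump_bound R (fun J m => complex.Im (moment F (V J) m)) A L T0 A0) => //.
  - by move=> J m; apply: (le_trans (Im_le_normc _)); exact: hT.
  - by move=> J m; apply: (le_trans (Im_le_normc _)); exact: tL.
  - move=> c ec; have [B hb] := ent c ec; exists B => J.
    have := cvg_complex_Im (moment_entire A0 bF (cV J) ec).
    rewrite (_ : (fun N => _) = series (fun m => c m * complex.Im (moment F (V J) m))).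
      move=> h; have -> := cvg_lim (@Rhausdorff R) h.
      exact: le_trans (Im_le_normc _) (hb J).
    apply/funext => N; rewrite /series/= raddf_sum; apply: eq_bigr => m _.
    by rewrite [LHS]cImM/= mul0r addr0.
exists (B1 + B2), (Num.max r1 r2); split; first by rewrite addr_ge0.
  by rewrite le_max r11.
move=> J m; apply: (le_trans (normc_le_ReIm _)); rewrite mulrDl.
have p1 : 0 <= r1 by exact: le_trans r11.
have p2 : 0 <= r2 by exact: le_trans r21.
apply: lerD.
  apply: (le_trans (h1 J m)); rewrite ler_wpM2l// lerXn2r ?nnegrE ?le_max ?p1 ?lexx//.
apply: (le_trans (h2 J m)); rewrite ler_wpM2l// lerXn2r ?nnegrE ?le_max ?p2 ?lexx ?orbT//.
Qed.
End Moments.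

(** * Perturbation of a distributional limit *)

Section Perturbation.
Variable R : realType.
Notation T := (lebesgueType R).
Notation mu := (@completed_lebesgue_measure R).
Implicit Types (F V h : R -> R[i]) (x A s B rho : R) (m n i J : nat).

(** A majorized factor h = 1 + O(s|x|) is a power series in x, so
    multiplying by it changes the moments by a series in the moments
    themselves: their geometric growth controls the change. *)
Lemma moment_perturb F V A h s B rho i : 0 <= A -> bounded_supported F A -> cloc V ->
  0 <= s -> majorized h s -> 0 <= B -> 0 <= rho ->
  (forall m, normc (moment F V m) <= B * rho ^+ m) ->
  normc (moment F (fun x => V x * h x) i - moment F V i) <=
  B * rho ^+ i * (expR (s * rho) - 1).
Proof.
move=> A0 bF cV s0 hs B0 r0 hB; apply/ler_addgt0Pr => e e0.
have iFV := cintegrable_FV bF cV.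
pose C := 2 * \int[mu]_x normc (F x * V x) * A ^+ i + 1.
have C1 : 1 <= C.
  rewrite lerDr !mulr_ge0 ?exprn_ge0//.
  by apply: (@Rintegral_ge0 _ T R mu setT) => x _; exact: normc_ge0.
have C0 : 0 < C by exact: lt_le_trans C1.
(* the error of the approximation q contributes at most e to the moment *)
have [q [q0 qs] qh] := hs A (e / C) (divr_gt0 e0 C0).
have ch := ccontinuous_majorized hs.
have cq := ccontinuous_horner q.
have cd : ccontinuous (fun x => h x - q.[x%:C%C]).
  have := ccontinuousD ch (ccontinuousM (ccontinuous_cst (- 1)) cq).
  by under eq_fun do rewrite mulN1r.
pose W x := V x * (h x - q.[x%:C%C]).
have cW : cloc W := cloc_mul_continuous cV cd.
pose N := (size q).-1.
have NE : size q = N.+1.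
  rewrite /N prednK// lt0n; apply/eqP => sq0.
  by have := q0; rewrite nth_default ?sq0// => /eqP; rewrite eq_sym oner_eq0.
have splitE : moment F (fun x => V x * h x) i =
    moment F W i + \sum_(0 <= m < N.+1) q`_m * moment F V (m + i).
  have iS m : true -> cintegrable (fun x => q`_m * (F x * (V x * (x ^+ (m + i))%:C%C))).
    by move=> _; exact: (cintegrableZ _ (cintegrable_moment (m + i) bF cV)).
  have -> : \sum_(0 <= m < N.+1) q`_m * moment F V (m + i) =
      cintegral (fun x => \sum_(0 <= m < N.+1) q`_m * (F x * (V x * (x ^+ (m + i))%:C%C))).
    rewrite (@cintegral_sum R _ _ xpredT _ iS); apply: eq_bigr => m _; symmetry.
    exact: (cintegralZ _ (cintegrable_moment (m + i) bF cV)).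
  rewrite /moment -cintegralD; last 2 first.
  - exact: (cintegrable_moment i bF cW).
  - exact: (@cintegrable_sum R _ _ xpredT _ iS).
  congr cintegral; apply/funext => x.
  have -> : \sum_(0 <= m < N.+1) q`_m * (F x * (V x * (x ^+ (m + i))%:C%C)) =
     F x * (V x * (q.[x%:C%C] * (x ^+ i)%:C%C)).
    rewrite horner_coef NE big_mkord mulr_suml !mulr_sumr; apply: eq_bigr => m _.
    by rewrite exprD !rmorphM/= rmorphXn; ring.
  by rewrite /W; ring.
rewrite splitE big_nat_recl// q0 mul1r add0n; set S := \sum_(_ <= _ < _) _.
rewrite (_ : _ - _ = S + moment F W i); last by ring.
apply: (le_trans (le_normcD _ _)); apply: lerD.
  apply: (le_trans (normc_sum _ _ _)).
  have -> : B * rho ^+ i * (expR (s * rho) - 1) = B * rho ^+ i * (expR (s * rho)) - B * rho ^+ i.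
    by rewrite mulrBr mulr1.
  rewrite lerBrDr; apply: (@le_trans _ _ (B * rho ^+ i * expsum N.+1 (s * rho))); last first.
    by rewrite ler_wpM2l ?mulr_ge0 ?exprn_ge0// expsum_le// mulr_ge0.
  rewrite /expsum big_nat_recl// expr0 fact0 divr1 mulrDr mulr1 addrC lerD2l.
  rewrite mulr_sumr; apply: ler_sum => m _; rewrite normcM.
  apply: (@le_trans _ _ (s ^+ m.+1 / (m.+1)`!%:R * (B * rho ^+ (m.+1 + i)))).
    by apply: ler_pM; rewrite ?normc_ge0.
  by rewrite exprD exprMn le_eqVlt; apply/orP; left; apply/eqP; ring.
have ec0 : 0 <= e / C by rewrite divr_ge0 ?(ltW e0) ?(ltW C0).
apply: (@le_trans _ _ (2 * \int[mu]_x (e / C * A ^+ i * normc (F x * V x)))).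
  apply: (normc_cintegral_le (cintegrable_moment i bF cW)).
    exact: (lintegrableZ (e / C * A ^+ i) iFV).
  move=> x; have [xA|xA] := leP `|x| A; last first.
    by have [_ sF _] := bF; rewrite sF// !mul0r normc0 mulr0.
  rewrite /W -mulrA mulrA normcM mulrC ler_wpM2r ?normc_ge0//.
  rewrite normcM normc_real normrX ler_pM ?normc_ge0 ?exprn_ge0 ?qh//.
  by rewrite lerXn2r ?nnegrE.
rewrite (@RintegralZl _ T R mu setT _ (e / C * A ^+ i) measurableT iFV).
rewrite (_ : 2 * _ = e * ((C - 1) / C)); last by rewrite /C; field; rewrite -/C gt_eqF.
rewrite ler_piMr ?(ltW e0)// ler_pdivrMr// mul1r; lra.
Qed.

Section Limit.
Variables (V h : nat -> R -> R[i]) (sg : nat -> R).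
Hypothesis cV : forall J, cloc (V J).
Hypothesis sg0 : forall J, 0 <= sg J.
Hypothesis sg_cvg : sg @ \oo --> (0 : R).
Hypothesis h_maj : forall J, majorized (h J) (sg J).

Let eta_cvg (B rho : R) : (fun J => B * (expR (sg J * rho) - 1)) @ \oo --> (0 : R).
Proof.
have h1 : (fun J => B * (expR (sg J * rho) - 1)) @ \oo --> B * (expR (0 * rho) - 1).
  apply: cvgM; first exact: cvg_cst.
  apply: cvgB; last exact: cvg_cst.
  apply: (@continuous_cvg _ _ _ _ _ (fun J => sg J * rho) (@expR R)); first exact: continuous_expR.
  by apply: cvgM; [exact: sg_cvg|exact: cvg_cst].
by rewrite mul0r expR0 subrr mulr0 in h1.
Qed.

Let cVh J : cloc (fun x => V J x * h J x).
Proof. exact: (cloc_mul_continuous (cV J) (ccontinuous_majorized (@h_maj J))). Qed.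

Let moment0 F (W : R -> R[i]) : moment F W 0 = cintegral (fun x => F x * W x).
Proof. by congr cintegral; apply/funext => x; rewrite expr0 mulr1. Qed.

Let bounded_of_cvg (W : nat -> R -> R[i]) :
  (forall F, test_function F ->
     (fun J => cintegral (fun x => F x * W J x)) @ \oo --> cintegral F) ->
  forall G, test_function G -> exists B, forall J, normc (cintegral (fun x => G x * W J x)) <= B.
Proof. by move=> hW G /hW; exact: cvg_complex_bounded. Qed.

Let squeeze (u v : nat -> R[i]) (l : R[i]) (w : nat -> R) N : w @ \oo --> (0 : R) ->
  (forall J, (N <= J)%N -> normc (u J - v J) <= w J) -> v @ \oo --> l -> u @ \oo --> l.
Proof.
move=> w0 uv /cvg_complexP vl; apply/cvg_complexP.
apply: (@squeeze_cvgr _ _ _ _ (fun=> 0) (fun J => w J + normc (v J - l))).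
- exists N => // J /= NJ; rewrite normc_ge0/=.
  rewrite -(subrK (v J) (u J)) -addrA (le_trans (le_normcD _ _))// lerD2r.
  exact: uv.
- exact: cvg_cst.
- have h1 : (fun J => w J + normc (v J - l)) @ \oo --> (0 + 0 : R) by exact: cvgD.
  by rewrite addr0 in h1.
Qed.

(** The moments of V_J obey a common geometric bound, since the test integrals
    converge, and sigma_J tends to zero. *)
Lemma limit_perturbed F : test_function F ->
  (forall F, test_function F ->
     (fun J => cintegral (fun x => F x * V J x)) @ \oo --> cintegral F) ->
  (fun J => cintegral (fun x => F x * (V J x * h J x))) @ \oo --> cintegral F.
Proof.
move=> tF hV; have [A A0 bF] := test_bounded_supported tF.
have [B [rho [B0 r1 hB]]] := moments_bounded tF cV (bounded_of_cvg hV).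
have r0 : 0 <= rho by exact: le_trans r1.
apply: (squeeze (N := 0) (eta_cvg B rho) _ (hV F tF)) => J _.
have := moment_perturb 0 A0 bF (cV J) (sg0 J) (@h_maj J) B0 r0 (hB J).
by rewrite !moment0 expr0 mulr1.
Qed.

(** Conversely the moments of V_J h_J are bounded; those of V_J differ from
    them by at most half of any bound they satisfy once sigma_J is small, and
    iterating this self-improvement bounds them too. *)
Lemma limit_unperturbed F : test_function F ->
  (forall F, test_function F ->
    (fun J => cintegral (fun x => F x * (V J x * h J x))) @ \oo --> cintegral F) ->
  (fun J => cintegral (fun x => F x * V J x)) @ \oo --> cintegral F.
Proof.
move=> tF hV; have [A A0 bF] := test_bounded_supported tF.
have [B [rho0 [B0 r1 hB0]]] := moments_bounded tF cVh (bounded_of_cvg hV).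
pose rho := Num.max rho0 A.
have r0 : 0 <= rho by rewrite le_max A0 orbT.
have hB J m : normc (moment F (fun x => V J x * h J x) m) <= B * rho ^+ m.
  apply: (le_trans (hB0 J m)); rewrite ler_wpM2l// lerXn2r ?nnegrE ?(le_trans ler01 r1)//.
  by rewrite le_max lexx.
have [N hN] : exists N, forall J, (N <= J)%N -> expR (sg J * rho) - 1 <= 2^-1.
  have := eta_cvg 1 rho; under eq_fun do rewrite mul1r.
  move=> /cvgr0Pnorm_le/(_ 2^-1); rewrite invr_gt0 => /(_ (ltr0n _ 2))[N _ h2].
  by exists N => J /h2; apply: le_trans; exact: ler_norm.
have hV2 J : (N <= J)%N -> forall m, normc (moment F (V J) m) <= 2 * B * rho ^+ m.
  move=> NJ m; pose C := 2 * \int[mu]_x normc (F x * V J x).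
  have C0 : 0 <= C.
    rewrite mulr_ge0//.
    by apply: (@Rintegral_ge0 _ T R mu setT) => x _; exact: normc_ge0.
  (* a bound D improves to B + D / 2, whose fixed point is 2 B *)
  have iter n : forall m, normc (moment F (V J) m) <= (2 * B + C * 2^-1 ^+ n) * rho ^+ m.
    elim: n => [|n IH] {}m.
      apply: (le_trans (moment_le m A0 bF (cV J))); rewrite expr0 mulr1 -/C.
      rewrite mulrDl; apply: (@le_trans _ _ (C * rho ^+ m)).
        by rewrite ler_wpM2l// lerXn2r ?nnegrE// le_max lexx orbT.
      by rewrite lerDr !mulr_ge0 ?exprn_ge0.
    have D0 : 0 <= 2 * B + C * 2^-1 ^+ n.
      apply: addr_ge0; first exact: mulr_ge0.
      by apply: mulr_ge0 => //; apply: exprn_ge0; rewrite invr_ge0.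
    have hp := moment_perturb m A0 bF (cV J) (sg0 J) (@h_maj J) D0 r0 IH.
    have e0 : 0 <= expR (sg J * rho) - 1.
      by rewrite subr_ge0 -expR0 ler_expR mulr_ge0.
    have he := hN J NJ.
    rewrite normcBC in hp.
    rewrite -(subrK (moment F (fun x => V J x * h J x) m) (moment F (V J) m)).
    apply: (le_trans (le_normcD _ _)); apply: (le_trans (lerD hp (hB J m))).
    rewrite [leRHS](_ : _ = (2 * B + C * 2^-1 ^+ n) * rho ^+ m * 2^-1 + B * rho ^+ m).
      by rewrite lerD2r ler_wpM2l// mulr_ge0// exprn_ge0.
    by rewrite exprS; field.
  apply/ler_addgt0Pr => e e0.
  have : (fun n => (C * rho ^+ m) * 2^-1 ^+ n) @ \oo --> (C * rho ^+ m) * (0 : R).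
    apply: cvgM; first exact: cvg_cst.
    by apply: cvg_expr; rewrite ger0_norm ?invr_ge0// invf_lt1// ltr1n.
  rewrite mulr0 => /cvgr0Pnorm_le/(_ e e0)[n _ hn].
  apply: (le_trans (iter n m)); rewrite mulrDl lerD2l mulrAC.
  by apply: (le_trans (ler_norm _)); exact: (hn n (leqnn n)).
have B20 : 0 <= 2 * B by rewrite mulr_ge0.
apply: (squeeze (N := N) (eta_cvg (2 * B) rho) _ (hV F tF)) => J NJ.
have := moment_perturb 0 A0 bF (cV J) (sg0 J) (@h_maj J) B20 r0 (hV2 J NJ).
by rewrite !moment0 expr0 mulr1 normcBC.
Qed.
End Limit.
End Perturbation.

(** * The cascade *)

Lemma test_pair_bounded (R : realType) (f g : R -> R[i]) :
  test_function f -> test_function g ->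
  exists A, [/\ 0 <= A, bounded_supported f A & bounded_supported g A].
Proof.
move=> /test_bounded_supported[A A0 bf] /test_bounded_supported[B B0 bg].
exists (Num.max A B); split; first by rewrite le_max A0.
  by apply: bounded_supported_le bf; rewrite le_max lexx.
by apply: bounded_supported_le bg; rewrite le_max lexx orbT.
Qed.

Section Telescoping.
Variables (R : realType) (d : nat -> int) (a ta : nat -> trigpoly R).
Notation T := (lebesgueType R).
Notation mu := (@completed_lebesgue_measure R).
Notation lam := (lam R d).
Hypothesis d_neq0 : forall j, (0 < j)%N -> d j != 0.
Hypothesis a_at0 : forall j, (0 < j)%N -> a j 0 = 1.
Hypothesis ta_at0 : forall j, (0 < j)%N -> ta j 0 = 1.
Hypothesis a_sum : (\sum_(1 <= j <oo)
     (`|lam j| * (tp_deg (a j))%:R)%:E * Linfnorm (a j) < +oo)%E.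
Hypothesis ta_sum : (\sum_(1 <= j <oo)
     (`|lam j| * (tp_deg (ta j))%:R)%:E * Linfnorm (ta j) < +oo)%E.
Variables (r s : nat -> nat).
Variables (theta ttheta : forall j : nat, 'I_(r j.-1) -> R -> R[i])
  (b tb : forall j : nat, 'I_(s j.-1) -> R -> R[i]).
Hypothesis theta_per : forall j, (0 < j)%N -> forall l,
  [/\ periodic (@theta j l) (2 * pi), periodic (@ttheta j l) (2 * pi),
      L2loc (@theta j l) & L2loc (@ttheta j l)].
Hypothesis b_per : forall j, (0 < j)%N -> forall l,
  [/\ periodic (@b j l) (2 * pi), periodic (@tb j l) (2 * pi),
      L2loc (@b j l) & L2loc (@tb j l)].
Implicit Types (f g : R -> R[i]) (x y A : R) (k : int) (j J K : nat).

Notation phi := (refinable d a).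
Notation tphi := (refinable d ta).
Notation Th := (Theta theta ttheta).

Lemma periodicZ (h : R -> R[i]) x k : periodic h (2 * pi) -> h (x + 2 * pi * k%:~R) = h x.
Proof.
move=> ph; case: k => n; first by rewrite -pmulrn mulr_natr periodicn.
rewrite NegzE mulrNz mulrN -pmulrn mulr_natr.
by rewrite -(periodicn ph n.+1 (x - _)) subrK.
Qed.

Lemma phi_continuous j : ccontinuous (phi j).
Proof. exact: (refinable_continuous a_at0 a_sum). Qed.

Lemma tphi_continuous j : ccontinuous (tphi j).
Proof. exact: (refinable_continuous ta_at0 ta_sum). Qed.

Lemma L2loc_Phi j (l : 'I_(r j)) :
  L2loc (Phi d a theta l) /\ L2loc (Phi d ta ttheta l).
Proof.
have [_ _ L1 L2] := theta_per (ltn0Sn j) l; split.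
  exact: (L2loc_mul_continuous L1 (phi_continuous j)).
exact: (L2loc_mul_continuous L2 (tphi_continuous j)).
Qed.

Lemma L2loc_Psi j (l : 'I_(s j)) :
  L2loc (Psi d a b l) /\ L2loc (Psi d ta tb l).
Proof.
have [_ _ L1 L2] := b_per (ltn0Sn j) l.
have dV : (d j.+1)%:~R^-1 != 0 :> R by rewrite invr_neq0// dR_neq0.
have xE x : (d j.+1)%:~R^-1 * x + 0 = x / (d j.+1)%:~R by rewrite addr0 mulrC.
split.
  have := L2loc_affine 0 dV (L2loc_mul_continuous L1 (phi_continuous j.+1)).
  by under eq_fun do rewrite xE.
have := L2loc_affine 0 dV (L2loc_mul_continuous L2 (tphi_continuous j.+1)).
by under eq_fun do rewrite xE.
Qed.

Definition scaling_part J f g : R[i] :=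
  \sum_(l < r J) sumZ (frame_term f g (lam J) (Phi d a theta l) (Phi d ta ttheta l)).

Definition wavelet_part j f g : R[i] :=
  \sum_(l < s j) sumZ (frame_term f g (lam j) (Psi d a b l) (Psi d ta tb l)).

(** The k-th expression of the mixed extension principle at level j+1; it has to
    reproduce the next Theta when d_{j+1} divides k and to vanish otherwise. *)
Definition mixed j k y : R[i] :=
  Th j.+1 ((d j.+1)%:~R * y) * (a j.+1 y)^*%C
    * ta j.+1 (y + 2 * pi * k%:~R / (d j.+1)%:~R)
  + \sum_(l < s j) (@b j.+1 l y)^*%C
      * @tb j.+1 l (y + 2 * pi * k%:~R / (d j.+1)%:~R).

Definition defect j k y : R[i] :=
  (if (d j.+1 %| k)%Z then Th j.+2 y else 0) - mixed j k y.

Definition phi_corr j k y : R[i] :=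
  (phi j.+1 y)^*%C * tphi j.+1 (y + 2 * pi * k%:~R / (d j.+1)%:~R).

Definition scaling_kernel j k x : R[i] := \sum_(l < r j)
  (Phi d a theta l (lam j * x))^*%C * Phi d ta ttheta l (lam j * x + 2 * pi * k%:~R).

Definition wavelet_kernel j k x : R[i] := \sum_(l < s j)
  (Psi d a b l (lam j * x))^*%C * Psi d ta tb l (lam j * x + 2 * pi * k%:~R).

Lemma scaling_kernelE j k x : scaling_kernel j k x =
  Th j.+1 (lam j * x) * ((phi j (lam j * x))^*%C * tphi j (lam j * x + 2 * pi * k%:~R)).
Proof.
rewrite /Theta mulr_suml; apply: eq_bigr => l _.
have [_ p2 _ _] := theta_per (ltn0Sn j) l.
by rewrite /Phi (periodicZ _ _ p2) conjcM mulrACA.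
Qed.

Lemma lam_next j x : lam j * x = (d j.+1)%:~R * (lam j.+1 * x).
Proof. by rewrite lamS; field; exact: dR_neq0. Qed.

Lemma lam_next_shift j k x :
  lam j * x + 2 * pi * k%:~R =
  (d j.+1)%:~R * (lam j.+1 * x + 2 * pi * k%:~R / (d j.+1)%:~R).
Proof. by rewrite lamS; field; exact: dR_neq0. Qed.

(** The refinement equation expresses both families at level j through the
    refinable functions at level j+1. *)
Lemma mixedE j k x : scaling_kernel j k x + wavelet_kernel j k x =
  mixed j k (lam j.+1 * x) * phi_corr j k (lam j.+1 * x).
Proof.
have d0 := dR_neq0 R d_neq0 j.
rewrite scaling_kernelE lam_next_shift lam_next.
rewrite (refinement d_neq0 a_at0 a_sum) (refinement d_neq0 ta_at0 ta_sum).
rewrite /mixed /phi_corr [RHS]mulrDl conjcM; congr (_ + _); first by ring.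
rewrite mulr_suml; apply: eq_bigr => l _.
rewrite /Psi lam_next_shift lam_next.
by rewrite ![(d j.+1)%:~R * _]mulrC !mulfK// conjcM; ring.
Qed.

(** The translations at level j+1 are those at level j whose index is a multiple
    of d_{j+1}. *)
Lemma next_scaling_kernelE j k x : (d j.+1 %| k)%Z ->
  scaling_kernel j.+1 (k %/ d j.+1)%Z x =
  Th j.+2 (lam j.+1 * x) * phi_corr j k (lam j.+1 * x).
Proof.
move=> dk; rewrite scaling_kernelE /phi_corr; congr (_ * (_ * tphi _ (_ + _))).
rewrite -{2}(divzK dk) intrM; field; exact: dR_neq0.
Qed.

Lemma cloc_scaling_kernel j k : cloc (scaling_kernel j k).
Proof.
apply: cloc_sum => l; have [L1 L2] := L2loc_Phi l.
have l0 := lam_neq0 R d_neq0 j.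
have := cloc_mulJ (L2loc_affine 0 l0 L1) (L2loc_affine (2 * pi * k%:~R) l0 L2).
by under eq_fun do rewrite addr0.
Qed.

Lemma cloc_wavelet_kernel j k : cloc (wavelet_kernel j k).
Proof.
apply: cloc_sum => l; have [L1 L2] := L2loc_Psi l.
have l0 := lam_neq0 R d_neq0 j.
have := cloc_mulJ (L2loc_affine 0 l0 L1) (L2loc_affine (2 * pi * k%:~R) l0 L2).
by under eq_fun do rewrite addr0.
Qed.

(** The integrand responsible for a failure of the cascade identity. *)
Definition defect_kernel j k x : R[i] :=
  defect j k (lam j.+1 * x) * phi_corr j k (lam j.+1 * x).

Let next_kernel j k x : R[i] :=
  if (d j.+1 %| k)%Z then scaling_kernel j.+1 (k %/ d j.+1)%Z x else 0.

Let cloc_next_kernel j k : cloc (next_kernel j k).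
Proof.
by rewrite /next_kernel; case: (_ %| _)%Z; [exact: cloc_scaling_kernel|exact: cloc0].
Qed.

Let defect_kernelE j k x : defect_kernel j k x =
  next_kernel j k x - (scaling_kernel j k x + wavelet_kernel j k x).
Proof.
rewrite /defect_kernel /defect mulrBl -mixedE /next_kernel; congr (_ - _).
by case: ifP => dk; rewrite ?mul0r// next_scaling_kernelE.
Qed.

Lemma cloc_defect_kernel j k : cloc (defect_kernel j k).
Proof.
have /funext -> := defect_kernelE j k.
apply: clocD; first exact: cloc_next_kernel.
apply: clocN; apply: clocD; first exact: cloc_scaling_kernel.
exact: cloc_wavelet_kernel.
Qed.

Lemma reindex_multiples (m : int) (t : int -> R[i]) K : m != 0 ->
  (forall k, ~~ (m %| k)%Z -> t k = 0) ->
  (forall k, t k != 0 -> (`|k| < K)%N) ->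
  \sum_(k <- freqs K) t (m * k) = \sum_(k <- freqs K) t k.
Proof.
move=> m0 tm tK; rewrite -(big_map (fun k => m * k) xpredT t).
apply: big_uniq_supp.
- by rewrite map_inj_uniq ?freqs_uniq// => x y; exact: mulfI.
- exact: freqs_uniq.
- move=> k tk; have kK := tK k tk; apply/andP; split; last by rewrite mem_freqs; lia.
  have : (m %| k)%Z by apply/negPn/negP => /tm tk0; rewrite tk0 eqxx in tk.
  move=> /dvdzP[q kE]; apply/mapP; exists q; last by rewrite kE mulrC.
  rewrite mem_freqs; move: kK; rewrite kE abszM => kK.
  have : (`|q| < K)%N.
    by apply: leq_ltn_trans kK; rewrite leq_pmulr// absz_gt0.
  lia.
Qed.

(** One step of the cascade fails by the integrals of the defects against the
    correlations of f and g. *)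
Lemma cascade_defect f g A j : 0 <= A ->
  bounded_supported f A -> bounded_supported g A ->
  exists N, forall K, (N <= K)%N ->
  scaling_part j.+1 f g - (scaling_part j f g + wavelet_part j f g) =
  (2 * pi)%:C%C * \sum_(k <- freqs K) cintegral (fun x =>
    corr f g (2 * pi * k%:~R / lam j) x * defect_kernel j k x).
Proof.
move=> A0 bf bg; have l0 := lam_neq0 R d_neq0 j; have l1 := lam_neq0 R d_neq0 j.+1.
pose N0 := (Num.truncn (A * `|lam j|)).+1.*2.
pose N1 := (Num.truncn (A * `|lam j.+1|)).+1.*2.
exists (maxn N0 N1) => K; rewrite geq_max => /andP[K0 K1].
have [_ E1] := frame_blocks l1 A0 bf bg
  (fun l : 'I_(r j.+1) => (L2loc_Phi l).1) (fun l : 'I_(r j.+1) => (L2loc_Phi l).2) K1.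
have [_ E0] := frame_blocks l0 A0 bf bg
  (fun l : 'I_(r j) => (L2loc_Phi l).1) (fun l : 'I_(r j) => (L2loc_Phi l).2) K0.
have [_ EG] := frame_blocks l0 A0 bf bg
  (fun l : 'I_(s j) => (L2loc_Psi l).1) (fun l : 'I_(s j) => (L2loc_Psi l).2) K0.
rewrite /scaling_part /wavelet_part E1 E0 EG -mulrDr -mulrBr; congr (_ * _).
have bc k := corr_bounded (2 * pi * k%:~R / lam j) bf bg.
pose t k := cintegral (fun x => corr f g (2 * pi * k%:~R / lam j) x * next_kernel j k x).
have -> : \sum_(k <- freqs K) cintegral (fun x => corr f g (2 * pi * k%:~R / lam j.+1) x *
     scaling_kernel j.+1 k x) = \sum_(k <- freqs K) t k.
  have d0 := d_neq0 (ltn0Sn j).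
  rewrite -(@reindex_multiples (d j.+1) t K d0).
  - apply: eq_bigr => k _; congr cintegral; apply/funext => x.
    rewrite /next_kernel dvdz_mulr// mulKz//; congr (corr f g _ _ * _).
    by rewrite lamS intrM; field; rewrite l0 dR_neq0.
  - move=> k dk; rewrite /t /next_kernel (negbTE dk).
    under [fun x => _]funext do rewrite mulr0.
    exact: cintegral0.
  - move=> k; rewrite ltnNge; apply: contra => kK; apply/eqP.
    have far : 2 * A < `|2 * pi * k%:~R / lam j|.
      rewrite normrM normfV ltr_pdivlMr ?normr_gt0// !normrM.
      rewrite (ger0_norm (pi_ge0 R)) ger0_norm// -!mulrA ltr_pM2l//.
      apply: (@lt_le_trans _ _ `|k%:~R|).
        rewrite -intr_norm; apply: (lt_le_trans (truncnS_gt _)).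
        rewrite -[leLHS]/((_ : nat)%:R) -[`|k|]/(Posz _) -pmulrn ler_nat.
        by apply: leq_trans kK; apply: leq_trans K0; rewrite /N0 -addnn leq_addr.
      by rewrite ler_peMl//; have := pi_ge2 R; lra.
    rewrite /t (_ : (fun x => _) = fun=> 0); first exact: cintegral0.
    have [_ sf _] := bf; have [_ sg _] := bg.
    by apply/funext => x; rewrite (corr_far x sf sg far) mul0r.
rewrite -big_split/= -sumrB; apply: eq_bigr => k _.
have iN := cintegrable_cut (bc k) (cloc_next_kernel j k).
have iS := cintegrable_cut (bc k) (cloc_scaling_kernel j k).
have iW := cintegrable_cut (bc k) (cloc_wavelet_kernel j k).
rewrite -[X in _ - (X + _)]/(cintegral (fun x =>
  corr f g (2 * pi * k%:~R / lam j) x * scaling_kernel j k x)).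
rewrite -[X in _ - (_ + X)]/(cintegral (fun x =>
  corr f g (2 * pi * k%:~R / lam j) x * wavelet_kernel j k x)).
rewrite -(cintegralD iS iW) -(cintegralB iN (cintegrableD iS iW)).
congr cintegral; apply/funext => x.
by rewrite defect_kernelE -mulrDr -mulrBr.
Qed.

Lemma trigpolyDz (p : trigpoly R) x k : p (x + 2 * pi * k%:~R) = p x.
Proof.
rewrite /tp_eval; apply: eq_bigr => n _; congr (_ * _).
rewrite -(@expiDz R (- ((tp_lo p + n%:Z)%:~R * x)) (- ((tp_lo p + n%:Z) * k))).
by congr expi; rewrite mulrNz intrM; ring.
Qed.

(** Modulo d_{j+1}, only the residue of k matters, by periodicity. *)
Lemma mixed_multiple j k y : (d j.+1 %| k)%Z -> mixed j k y =
  Th j.+1 ((d j.+1)%:~R * y) * (a j.+1 y)^*%C * ta j.+1 y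
  + \sum_(l < s j) (@b j.+1 l y)^*%C * @tb j.+1 l y.
Proof.
move=> /dvdzP[q ->]; rewrite /mixed.
have -> : 2 * pi * (q * d j.+1)%:~R / (d j.+1)%:~R = 2 * pi * q%:~R :> R.
  by rewrite intrM; field; exact: dR_neq0.
rewrite trigpolyDz; congr (_ + _); apply: eq_bigr => l _.
by have [_ p2 _ _] := b_per (ltn0Sn j) l; rewrite (periodicZ _ _ p2).
Qed.

Lemma defect_conditions j :
  (forall k, {ae mu, forall y : R, defect j k y = 0}) <->
  {ae mu, forall xi : R,
     Th j.+1 ((d j.+1)%:~R * xi) * (a j.+1 xi)^*%C * ta j.+1 xi
     + \sum_(l < s j) (@b j.+1 l xi)^*%C * @tb j.+1 l xi = Th j.+2 xi} /\
  (forall omega : int, ~~ (d j.+1 %| omega)%Z ->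
   {ae mu, forall xi : R,
     Th j.+1 ((d j.+1)%:~R * xi) * (a j.+1 xi)^*%C
       * ta j.+1 (xi + 2 * pi * omega%:~R / (d j.+1)%:~R)
     + \sum_(l < s j) (@b j.+1 l xi)^*%C
         * @tb j.+1 l (xi + 2 * pi * omega%:~R / (d j.+1)%:~R) = 0}).
Proof.
split=> [h|[h1 h2] k].
  split=> [|k dk].
    apply: ae_leb_imp (h 0) => y; rewrite /defect dvdz0 mixed_multiple ?dvdz0//.
    by move=> /eqP; rewrite subr_eq0 => /eqP.
  apply: ae_leb_imp (h k) => y; rewrite /defect (negbTE dk) => /eqP.
  by rewrite sub0r oppr_eq0 => /eqP.
case: (boolP (d j.+1 %| k)%Z) => dk.
  apply: ae_leb_imp h1 => y hy; rewrite /defect dk mixed_multiple// hy.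
  exact: subrr.
apply: ae_leb_imp (h2 k dk) => y hy; rewrite /defect (negbTE dk) sub0r.
by apply/eqP; rewrite oppr_eq0; apply/eqP.
Qed.

(** The refinable functions vanish only on null sets and can be divided out. *)
Lemma defect_kernel_ae0 j k : {ae mu, forall x : R, defect_kernel j k x = 0} ->
  {ae mu, forall y : R, defect j k y = 0}.
Proof.
move=> h; have l1 := lam_neq0 R d_neq0 j.+1.
have n1 := refinable_ae_neq0 d_neq0 a_at0 a_sum j.+1.
have n2 := ae_leb_affine (2 * pi * k%:~R / (d j.+1)%:~R) (oner_neq0 R)
  (refinable_ae_neq0 d_neq0 ta_at0 ta_sum j.+1).
have l1V : (lam j.+1)^-1 != 0 by rewrite invr_neq0.
have h' := ae_leb_affine 0 l1V h.
apply: ae_leb_imp (ae_leb_and (ae_leb_and n1 n2) h') => y [[y1 y2]].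
rewrite addr0 /defect_kernel mulrA mulfV// mul1r => /eqP.
rewrite mulf_eq0 /phi_corr mulf_eq0 conjc_eq0 (negbTE y1)/=.
by rewrite mul1r in y2; rewrite (negbTE y2) orbF => /eqP.
Qed.

Lemma cascade_iff j :
  (forall f g, test_function f -> test_function g ->
     scaling_part j.+1 f g = scaling_part j f g + wavelet_part j f g) <->
  (forall k, {ae mu, forall y : R, defect j k y = 0}).
Proof.
have p0 : (2 * pi : R)%:C%C != 0.
  by rewrite eq_complex/= eqxx andbT mulf_neq0// gt_eqF// pi_gt0.
split=> [h k|h f g tf tg].
  apply: defect_kernel_ae0; move: k.
  apply: (localised_zero (lam_neq0 R d_neq0 j) (cloc_defect_kernel j)) => f g tf tg.
  have [A [A0 bf bg]] := test_pair_bounded tf tg.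
  have [N hN] := cascade_defect j A0 bf bg.
  exists N => K /hN; rewrite h// subrr => /esym/eqP.
  by rewrite mulf_eq0 (negbTE p0)/= => /eqP.
have [A [A0 bf bg]] := test_pair_bounded tf tg.
have [N hN] := cascade_defect j A0 bf bg.
apply/eqP; rewrite -subr_eq0 (hN N (leqnn N)) big1 ?mulr0// => k _.
rewrite -[RHS](@cintegral0 R); apply: cintegral_ae.
- have bc := corr_bounded (2 * pi * k%:~R / lam j) bf bg.
  exact: (cintegrable_cut bc (cloc_defect_kernel j k)).1.
- exact: cmeasurable_cst.
- have := ae_leb_affine 0 (lam_neq0 R d_neq0 j.+1) (h k).
  apply: ae_leb_imp => x; rewrite addr0 /defect_kernel => ->.
  by rewrite mul0r mulr0.
Qed.

Lemma scaling_summable j f g : test_function f -> test_function g -> forall l : 'I_(r j),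
  abs_summable (frame_term f g (lam j) (Phi d a theta l) (Phi d ta ttheta l)).
Proof.
move=> tf tg; have [A [A0 bf bg]] := test_pair_bounded tf tg.
exact: (frame_blocks (lam_neq0 R d_neq0 j) A0 bf bg
  (fun l : 'I_(r j) => (L2loc_Phi l).1) (fun l : 'I_(r j) => (L2loc_Phi l).2) (leqnn _)).1.
Qed.

Lemma wavelet_summable j f g : test_function f -> test_function g -> forall l : 'I_(s j),
  abs_summable (frame_term f g (lam j) (Psi d a b l) (Psi d ta tb l)).
Proof.
move=> tf tg; have [A [A0 bf bg]] := test_pair_bounded tf tg.
exact: (frame_blocks (lam_neq0 R d_neq0 j) A0 bf bg
  (fun l : 'I_(s j) => (L2loc_Psi l).1) (fun l : 'I_(s j) => (L2loc_Psi l).2) (leqnn _)).1.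
Qed.

Let partial_frame J f g J' : R[i] :=
  scaling_part J f g + \sum_(J <= j < J') wavelet_part j f g.

Let partial_frame_cascade J f g J' : (J <= J')%N ->
  (forall j, scaling_part j.+1 f g = scaling_part j f g + wavelet_part j f g) ->
  partial_frame J f g J' = scaling_part J' f g.
Proof.
move=> + h; elim: J' => [|J' IH].
  by rewrite leqn0 => /eqP ->; rewrite /partial_frame big_geq// addr0.
rewrite leq_eqVlt => /orP[/eqP ->|].
  by rewrite /partial_frame big_geq// addr0.
rewrite ltnS => JJ; rewrite h -(IH JJ) /partial_frame big_nat_recr//.
by rewrite addrA.
Qed.

(** Comparing the expansions that start at the levels J and J+1 shows that
    the frames at all levels amount to one step of the cascade together with
    the convergence of the scaling part alone. *)
Lemma frames_iff :
  (forall J : nat, dual_wavelet_frames lam J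
     (Phi d a theta (j := J)) (Phi d ta ttheta (j := J)) (Psi d a b) (Psi d ta tb)) <->
  (forall j f g, test_function f -> test_function g ->
     scaling_part j.+1 f g = scaling_part j f g + wavelet_part j f g) /\
  (forall f g, test_function f -> test_function g ->
     (fun J => scaling_part J f g) @ \oo --> (2 * pi)%:C%C * pairing f g).
Proof.
split=> [fr|[casc lim] J f g tf tg].
- have fr' J f g : test_function f -> test_function g ->
      partial_frame J f g @ \oo --> (2 * pi)%:C%C * pairing f g.
    by move=> tf tg; have [_ _ h] := fr J f g tf tg.
  have casc j f g : test_function f -> test_function g ->
      scaling_part j.+1 f g = scaling_part j f g + wavelet_part j f g.
    move=> tf tg; pose D := scaling_part j.+1 f g - (scaling_part j f g + wavelet_part j f g).
    have h2 : (fun J' => partial_frame j f g J' + D) @ \oo --> (2 * pi)%:C%C * pairing f g.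
      apply/cvg_complexP; move/cvg_complexP : (fr' j.+1 f g tf tg).
      apply: cvg_trans; apply: near_eq_cvg; exists j.+1 => // J' /= jJ.
      congr (normc (_ - _)); rewrite /partial_frame /D (big_ltn jJ).
      by ring.
    have h3 : (fun J' => partial_frame j f g J' + D) @ \oo -->
        (2 * pi)%:C%C * pairing f g + D.
      by apply: cvg_complexD; [exact: fr'|exact: cvg_cst].
    have := cvg_complex_unique h3 h2.
    move/(congr1 (fun z => z - (2 * pi)%:C%C * pairing f g)).
    rewrite addrAC subrr add0r => /eqP.
    by rewrite subr_eq0 => /eqP.
  split=> // f g tf tg; have := fr' 0%N f g tf tg.
  have /funext -> // : forall J', partial_frame 0 f g J' = scaling_part J' f g.
  by move=> J'; apply: partial_frame_cascade => // j; exact: casc.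
- split; [exact: scaling_summable|by move=> j _; exact: wavelet_summable|].
  apply/cvg_complexP; move/cvg_complexP : (lim f g tf tg).
  apply: cvg_trans; apply: near_eq_cvg; exists J => // J' /= JJ.
  congr (normc (_ - _)); rewrite -(partial_frame_cascade JJ)//.
  by move=> j; exact: casc.
Qed.

Hypothesis d_lim :
  (fun j : nat => \prod_(1 <= n < j.+1) `|(d n)%:~R : R|) @ \oo --> +oo.

Let V J x : R[i] := Th J.+1 (lam J * x).
Let h J x : R[i] := (phi J (lam J * x))^*%C * tphi J (lam J * x).

Let cV J : cloc (V J).
Proof.
have cT : cloc (Th J.+1).
  apply: cloc_sum => l; have [_ _ L1 L2] := theta_per (ltn0Sn J) l.
  exact: cloc_mulJ.
have := cloc_affine 0 (lam_neq0 R d_neq0 J) cT.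
by under eq_fun do rewrite addr0.
Qed.

Let h_maj : exists sg : nat -> R, [/\ forall J, 0 <= sg J, sg @ \oo --> (0 : R) &
  forall J, majorized (h J) (sg J)].
Proof.
have [s1 [p1 c1 m1]] := refinable_majorized d_neq0 a_at0 a_sum.
have [s2 [p2 c2 m2]] := refinable_majorized d_neq0 ta_at0 ta_sum.
exists (fun J => s1 J + s2 J); split => [J||J].
- exact: addr_ge0.
- have h1 : (fun J => s1 J + s2 J) @ \oo --> (0 + 0 : R) by exact: cvgD.
  by rewrite addr0 in h1.
- by apply: majorizedM => //; exact: majorizedJ.
Qed.

(** At fine scales the translates of f and g by nonzero multiples of
    2 pi / lam_J no longer overlap. *)
Lemma scaling_part_fine f g A : 0 <= A -> bounded_supported f A -> bounded_supported g A ->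
  exists N, forall J, (N <= J)%N ->
  scaling_part J f g = (2 * pi)%:C%C *
    cintegral (fun x => (f x * (g x)^*%C) * (V J x * h J x)).
Proof.
move=> A0 bf bg; have A1 : 0 < A + 1 by rewrite ltr_wpDl.
have [|N hN] := lam_small d_lim (_ : 0 < (A + 1)^-1); first by rewrite invr_gt0.
exists N => J NJ; have l0 := lam_neq0 R d_neq0 J.
have small : A * `|lam J| < 1.
  apply: (@le_lt_trans _ _ ((A + 1) * `|lam J|)); first by rewrite ler_wpM2r// lerDl.
  by rewrite -ltr_pdivlMl// mulr1 hN.
have [_ E] := frame_blocks l0 A0 bf bg
  (fun l : 'I_(r J) => (L2loc_Phi l).1) (fun l : 'I_(r J) => (L2loc_Phi l).2) (leqnn _).
rewrite /scaling_part E; congr (_ * _).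
have k0 : 0 \in freqs (Num.truncn (A * `|lam J|)).+1.*2 by rewrite mem_freqs.
rewrite (bigD1_seq (0 : int) k0 (freqs_uniq _))/= big1 ?addr0 => [|k kn0].
  congr cintegral; apply/funext => x.
  rewrite -/(scaling_kernel J 0 x) scaling_kernelE /corr.
  by rewrite !mulr0 !mul0r !addr0.
have far : 2 * A < `|2 * pi * k%:~R / lam J|.
  rewrite normrM normfV ltr_pdivlMr ?normr_gt0// !normrM.
  rewrite (ger0_norm (pi_ge0 R)) ger0_norm// -!mulrA ltr_pM2l//.
  apply: (lt_le_trans small); apply: (@le_trans _ _ `|k%:~R|).
    by rewrite -intr_norm (ler_int R 1) -gtz0_ge1 normr_gt0.
  by rewrite ler_peMl//; have := pi_ge2 R; lra.
rewrite (_ : (fun x => _) = fun=> 0); first exact: cintegral0.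
have [_ sf _] := bf; have [_ sg _] := bg.
by apply/funext => x; rewrite (corr_far x sf sg far) mul0r.
Qed.

Lemma distribution_cvgE : distribution_cvg V (fun=> 1) <->
  forall F, test_function F ->
    (fun J => cintegral (fun x => F x * V J x)) @ \oo --> cintegral F.
Proof.
split=> dc F tF.
  have := dc _ (test_conj tF); rewrite /pairing.
  under eq_fun do under [X in cintegral X]eq_fun do rewrite conjcK mulrC.
  by under [X in _ --> cintegral X]eq_fun do rewrite conjcK mul1r.
have := dc _ (test_conj tF); rewrite /pairing.
under eq_fun do under [X in cintegral X]eq_fun do rewrite mulrC.
by under [X in _ -> _ --> cintegral X]eq_fun do rewrite mul1r.
Qed.

(** With g equal to 1 on the support of F, the product f conj(g) with f = F is
    F itself, an arbitrary test function. *)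
Lemma scaling_limit_iff :
  (forall f g, test_function f -> test_function g ->
     (fun J => scaling_part J f g) @ \oo --> (2 * pi)%:C%C * pairing f g) <->
  distribution_cvg V (fun=> 1).
Proof.
have [sg [sg0 sgc sgm]] := h_maj.
have p0 : (2 * pi : R)%:C%C != 0.
  by rewrite eq_complex/= eqxx andbT mulf_neq0// gt_eqF// pi_gt0.
split=> [sc|/distribution_cvgE dc f g tf tg].
- apply/distribution_cvgE => F tF; apply: (limit_unperturbed cV sg0 sgc sgm tF) => {}F {}tF.
  have [A A0 bF] := test_bounded_supported tF.
  pose g x : R[i] := (hat 1 (- A - 1) (A + 1) x)%:C%C.
  have tg : test_function g by exact: test_hat.
  have Fg x : F x * (g x)^*%C = F x.
    have [xA|xA] := leP `|x| A; last by have [_ sF _] := bF; rewrite sF// mul0r.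
    rewrite /g conjc_real hat_eq1 ?mulr1//; move: xA; rewrite ler_norml mul1r; lra.
  have [B [B0 bF' bg]] := test_pair_bounded tF tg.
  have [N hN] := scaling_part_fine B0 bF' bg.
  have pE : pairing F g = cintegral F by rewrite /pairing; have /funext -> := Fg.
  have pV z : (2 * pi : R)%:C%C^-1 * ((2 * pi : R)%:C%C * z) = z.
    by rewrite mulrA (mulVf p0) mul1r.
  have h1 : (fun J => (2 * pi : R)%:C%C^-1 * scaling_part J F g) @ \oo --> cintegral F.
    rewrite -(pV (cintegral F)) -pE.
    by apply: cvg_complexM; [exact: cvg_cst|exact: sc].
  apply/cvg_complexP; move/cvg_complexP : h1.
  apply: cvg_trans; apply: near_eq_cvg; exists N => // J NJ.
  congr (normc (_ - _)); rewrite (hN J NJ) pV.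
  by congr cintegral; apply/funext => x; rewrite Fg.
- have tF := test_mul tf (test_conj tg).
  have [A [A0 bf bg]] := test_pair_bounded tf tg.
  have [N hN] := scaling_part_fine A0 bf bg.
  have h1 : (fun J => (2 * pi : R)%:C%C * cintegral (fun x => f x * (g x)^*%C * (V J x * h J x)))
      @ \oo --> (2 * pi : R)%:C%C * pairing f g.
    apply: cvg_complexM; first exact: cvg_cst.
    exact: (limit_perturbed cV sg0 sgc sgm tF dc).
  apply/cvg_complexP; move/cvg_complexP : h1.
  apply: cvg_trans; apply: near_eq_cvg; exists N => // J NJ.
  by rewrite (hN J NJ).
Qed.
End Telescoping.

Theorem theorem16 (R : realType) (d : nat -> int)
  (d_neq0 : forall j, (0 < j)%N -> d j != 0)
  (d_lim : (fun j : nat => \prod_(1 <= n < j.+1) `|(d n)%:~R : R|) @ \oo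
             --> +oo)
  (a ta : nat -> trigpoly R)
  (a_at0 : forall j, (0 < j)%N -> a j 0 = 1)
  (ta_at0 : forall j, (0 < j)%N -> ta j 0 = 1)
  (a_sum : (\sum_(1 <= j <oo)
     (`|lam R d j| * (tp_deg (a j))%:R)%:E * Linfnorm (a j) < +oo)%E)
  (ta_sum : (\sum_(1 <= j <oo)
     (`|lam R d j| * (tp_deg (ta j))%:R)%:E * Linfnorm (ta j) < +oo)%E) :
  [/\ forall j xi, cvgn (mask_product d a j xi) /\
                   cvgn (mask_product d ta j xi),
      forall j, (0 < j)%N ->
        Linfloc (refinable d a j.-1) /\ Linfloc (refinable d ta j.-1)
    & forall j xi, (0 < j)%N ->
        refinable d a j.-1 ((d j)%:~R * xi) = a j xi * refinable d a j xi /\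
        refinable d ta j.-1 ((d j)%:~R * xi) = ta j xi * refinable d ta j xi]
  /\
  forall (r s : nat -> nat)
    (r_gt0 : forall j, (0 < r j)%N) (s_gt0 : forall j, (0 < s j)%N)
    (theta ttheta : forall j : nat, 'I_(r j.-1) -> R -> R[i])
    (b tb : forall j : nat, 'I_(s j.-1) -> R -> R[i])
    (theta_per : forall j, (0 < j)%N -> forall l,
       [/\ periodic (theta j l) (2 * pi), periodic (ttheta j l) (2 * pi),
           L2loc (theta j l) & L2loc (ttheta j l)])
    (b_per : forall j, (0 < j)%N -> forall l,
       [/\ periodic (b j l) (2 * pi), periodic (tb j l) (2 * pi),
           L2loc (b j l) & L2loc (tb j l)]),
  (forall j : nat,
     (forall l : 'I_(r j),
        L2loc (Phi d a theta l) /\ L2loc (Phi d ta ttheta l)) /\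
     (forall l : 'I_(s j),
        L2loc (Psi d a b l) /\ L2loc (Psi d ta tb l)))
  /\
  ((forall J : nat,
      dual_wavelet_frames (lam R d) J
        (Phi d a theta (j := J)) (Phi d ta ttheta (j := J))
        (Psi d a b) (Psi d ta tb))
   <->
   [/\ forall j, (0 < j)%N ->
         {ae leb, forall xi : R,
           Theta theta ttheta j ((d j)%:~R * xi) * (a j xi)^*%C * ta j xi
           + \sum_(l < s j.-1) (b j l xi)^*%C * tb j l xi
           = Theta theta ttheta j.+1 xi},
       forall j, (0 < j)%N -> forall omega : int, ~~ (d j %| omega)%Z ->
         {ae leb, forall xi : R,
           Theta theta ttheta j ((d j)%:~R * xi) * (a j xi)^*%C
             * ta j (xi + 2 * pi * omega%:~R / (d j)%:~R)
           + \sum_(l < s j.-1) (b j l xi)^*%C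
               * tb j l (xi + 2 * pi * omega%:~R / (d j)%:~R)
           = 0}
     & distribution_cvg
         (fun j xi => Theta theta ttheta j.+1 (lam R d j * xi))
         (fun=> 1)]).
Proof.
split.
  split.
  - move=> j xi; split.
      exact: (cvg_mask_product a_at0 a_sum).
    exact: (cvg_mask_product ta_at0 ta_sum).
  - move=> j _; split; first exact: (refinable_Linfloc a_at0 a_sum).
    exact: (refinable_Linfloc ta_at0 ta_sum).
  - move=> [//|j] xi _; split; first exact: (refinement d_neq0 a_at0 a_sum).
    exact: (refinement d_neq0 ta_at0 ta_sum).
move=> r s _ _ theta ttheta b tb theta_per b_per; split.
  move=> j; split=> l.
    exact: (L2loc_Phi a_at0 ta_at0 a_sum ta_sum theta_per).
  exact: (L2loc_Psi d_neq0 a_at0 ta_at0 a_sum ta_sum b_per).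
have casc j := cascade_iff d_neq0 a_at0 ta_at0 a_sum ta_sum theta_per b_per j.
have cond j := defect_conditions a ta d_neq0 theta ttheta b_per j.
have lim := scaling_limit_iff d_neq0 a_at0 ta_at0 a_sum ta_sum theta_per d_lim.
rewrite (frames_iff d_neq0 a_at0 ta_at0 a_sum ta_sum theta_per b_per); split.
  move=> [hc hl]; have hd j := (cond j).1 ((casc j).1 (hc j)).
  split; last exact: (lim.1 hl).
    by move=> [//|j] _; exact: (hd j).1.
  by move=> [//|j] _; exact: (hd j).2.
move=> [h1 h2 h3]; split; last exact: (lim.2 h3).
move=> j; apply/(casc j)/(cond j); split; first exact: h1.
exact: h2.
Qed.
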